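(* Let $G$ be a Lie group and $X$ a $G$-space. Suppose that $A$ is a compact normal subgroup of $G$ acting trivially on $X$. Let $p:E\to X$ be a finite-dimensional $G$-vector bundle. Then there is an isomorphism of $G$-vector bundles, natural in $X$, $$\bigoplus_{[\rho]\in G\backslash \operatorname{Irr}(A)}\operatorname{Ind}_{G_{[\rho]}}^{G}\big(\rho\otimes\operatorname{Hom}_A(\rho,E)\big)\to E,$$ where $[\rho]$ runs over representatives of the orbits of the $G$-action on the set $\operatorname{Irr}(A)$ of isomorphism classes of irreducible representations of $A$.
   Context: Vector bundles are complex. $\operatorname{Irr}(A)$ is the (discrete) set of equivalence classes of irreducible unitary representations of $A$, with left $G$-action $g\cdot[\rho]=[a\mapsto\rho(g^{-1}ag)]$. $G_{[\rho]}\supseteq A$ is the isotropy group of $[\rho]$ under this action. For $\rho:A\to U(V_\rho)$ irreducible, $\operatorname{Hom}_A(\rho,E)$ is the bundle over $X$ whose fibre at $x$ is the space of $A$-equivariant linear maps $V_\rho\to E_x$, and $\rho$ also denotes the trivial bundle $X\times V_\rho$. The bundle $\rho\otimes\operatorname{Hom}_A(\rho,E)$ is a $G_{[\rho]}$-vector bundle as follows: for $g\in G_{[\rho]}$ choose $u\in U(V_\rho)$ with $\rho(gag^{-1})=u\rho(a)u^{-1}$ for all $a\in A$ ($u$ is unique up to a scalar in $S^1$) and set $g\cdot(v\otimes\phi)=uv\otimes(g\circ\phi\circ u^{-1})$. This is independent of the choice of $u$. *Induction.* Let $H\subseteq G$ be a subgroup of finite index, $X$ a $G$-space and $E'\to X$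 an $H$-vector bundle. The space $G\times_HE'$ is a $G$-vector bundle over $G\times_HX$, which is identified $G$-equivariantly with $G/H\times X$ by $[g,x]\mapsto(gH,gx)$. The induction $\operatorname{Ind}_H^G(E')$ is the $G$-vector bundle over $X$ obtained from $G\times_HE'\to G\times_HX\cong G/H\times X\to X$ (last map the projection), its fibre over $x$ being the finite direct sum $\bigoplus_{gH\in G/H}\{[g,e]: e\in E'_{g^{-1}x}\}$, with $G$ acting by $g'\cdot[g,e]=[g'g,e]$. Up to isomorphism it is the unique $G$-vector bundle over $X$ with natural identifications $\operatorname{Hom}_G(\operatorname{Ind}_H^G(E'),F)\cong\operatorname{Hom}_H(E',F)$ for all $G$-vector bundles $F$ over $X$. *Applicability of the induction.* Since $E$ is finite-dimensional, there are only finitely many classes $[\rho]$ with $\operatorname{Hom}_A(\rho,E)\neq 0$; if $[\rho]$ is one of them then so is every element of its $G$-orbit, and hence $G_{[\rho]}$ has finite index in $G$, so that the induction above is defined for each such $[\rho]$. Classes with $\operatorname{Hom}_A(\rho,E)=0$ contribute zero to the sum. *)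

(* Defs.v *)
From HB Require Import structures.
From mathcomp Require Import all_boot all_order all_algebra.
From mathcomp Require Import all_classical all_reals all_analysis.
From mathcomp Require Import complex.

Set Implicit Arguments.
Unset Strict Implicit.
Unset Printing Implicit Defensive.

Import Order.TTheory GRing.Theory Num.Theory numFieldNormedType.Exports.

Local Open Scope classical_set_scope.
Local Open Scope ring_scope.

HB.mixin Record isTopologicalGroup G of Group G & Topological G := {
  mulg_continuous : continuous (fun p : G * G => (p.1 * p.2)%g);
  invg_continuous : continuous (fun g : G => (g^-1)%g)
}.

#[short(type="topologicalGroupType")]
HB.structure Definition TopologicalGroup :=
  {G of isTopologicalGroup G & Group G & Topological G}.

Section smooth.
Context {R : realType} {V W : normedModType R}.

Fixpoint iter_derive (s : seq V) (f : V -> W) : V -> W :=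
  if s is v :: s' then fun x => 'D_v (iter_derive s' f) x else f.

(* C^infinity on an open set: the iterated directional derivatives of all     *)
(* orders exist and are continuous.                                           *)
Definition smooth_on (U : set V) (f : V -> W) : Prop :=
  forall (s : seq V) (x : V), U x ->
    {for x, continuous (iter_derive s f)} /\
    forall v, derivable (iter_derive s f) x v.

End smooth.

Section lie_group.
Context (R : realType) (G : topologicalGroupType).

(* Only the restrictions of chart_fun to chart_dom and of chart_inv to the    *)
(* image of chart_dom are meaningful.                                         *)
Record chart (n : nat) := Chart {
  chart_dom : set G;
  chart_fun :> G -> 'rV[R]_n;
  chart_inv : 'rV[R]_n -> G;
  chart_dom_open : open chart_dom;
  chart_img_open : open (chart_fun @` chart_dom);
  chart_funK : forall g, chart_dom g -> chart_inv (chart_fun g) = g;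
  chart_fun_continuous : {within chart_dom, continuous chart_fun};
  chart_inv_continuous :
    {within chart_fun @` chart_dom, continuous chart_inv}
}.

Record lie_atlas (n : nat) (atlas : set (chart n)) : Prop := LieAtlas {
  atlas_cover : forall g, exists2 c, atlas c & chart_dom c g;
  atlas_smooth : forall c d, atlas c -> atlas d ->
    smooth_on (c @` (chart_dom c `&` chart_dom d))
              (fun y => d (chart_inv c y));
  atlas_mul_smooth : forall c d e, atlas c -> atlas d -> atlas e ->
    smooth_on [set p | exists g h, [/\ chart_dom c g, chart_dom d h,
                         chart_dom e (g * h)%g & p = (c g, d h)]]
              (fun p => e (chart_inv c p.1 * chart_inv d p.2)%g);
  atlas_inv_smooth : forall c d, atlas c -> atlas d ->
    smooth_on [set y | exists g, [/\ chart_dom c g, chart_dom d (g^-1)%g &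
                         y = c g]]
              (fun y => d ((chart_inv c y)^-1)%g)
}.

(* No countability condition is imposed.                                      *)
Definition lie_group : Prop :=
  hausdorff_space G /\
  exists (n : nat) (atlas : set (chart n)), lie_atlas atlas.

End lie_group.

Record subgroup (G : topologicalGroupType) := Subgroup {
  subgroup_mem :> G -> Prop;
  subgroup1 : subgroup_mem 1%g;
  subgroupM : forall g h,
    subgroup_mem g -> subgroup_mem h -> subgroup_mem (g * h)%g;
  subgroupV : forall g, subgroup_mem g -> subgroup_mem (g^-1)%g
}.

Coercion subgroup_set (G : topologicalGroupType) (H : subgroup G) : set G :=
  [set g | H g].

Record normal_subgroup (G : topologicalGroupType) := NormalSubgroup {
  normal_subgroup_base :> subgroup G;
  subgroupJ : forall g a,
    normal_subgroup_base a -> normal_subgroup_base (g * a * g^-1)%g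
}.

Lemma subgroupJV (G : topologicalGroupType) (A : normal_subgroup G) g a :
  A a -> A (g^-1 * a * g)%g.
Proof. by move=> /(subgroupJ g^-1%g); rewrite invgK. Qed.

Definition whole (G : topologicalGroupType) : subgroup G :=
  @Subgroup G (fun=> True) I (fun _ _ _ _ => I) (fun _ _ => I).

Record gspace (G : topologicalGroupType) := GSpace {
  gspace_sort :> topologicalType;
  act : G -> gspace_sort -> gspace_sort;
  act1 : forall x, act 1%g x = x;
  actM : forall g h x, act (g * h)%g x = act g (act h x);
  act_continuous :
    continuous (fun p : G * gspace_sort => act p.1 p.2)
}.

Definition acts_trivially (G : topologicalGroupType) (A : subgroup G)
    (X : gspace G) : Prop :=
  forall a x, A a -> act a x = x :> X.

Definition equivariant (G : topologicalGroupType) (Y X : gspace G)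
    (f : Y -> X) : Prop :=
  forall g y, f (act g y) = act g (f y).

Section act_theory.
Context {G : topologicalGroupType} {X : gspace G}.

Lemma actK (g : G) (x : X) : act g^-1%g (act g x) = x.
Proof. by rewrite -actM mulVg act1. Qed.

Lemma actKV (g : G) (x : X) : act g (act g^-1%g x) = x.
Proof. by rewrite -actM mulgV act1. Qed.

End act_theory.

(* Equalities between vectors lying in fibres over points that are only       *)
(* provably equal are stated in the total space {x & E x}.                    *)
Lemma existT_lin (C : pzRingType) (T : eqType) (E : T -> lmodType C) x y
    (c : C) (p p' : E x) (q q' : E y) :
  existT E x p = existT E y q -> existT E x p' = existT E y q' ->
  existT E x (c *: p + p') = existT E y (c *: q + q').
Proof.
move=> e; have exy : x = y := congr1 (@projT1 T E) e.
case: _ / exy q q' e => q q' e e'.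
by rewrite (eq_from_Tagged e) (eq_from_Tagged e').
Qed.

Lemma existT_0 (C : pzRingType) (T : Type) (E : T -> lmodType C) x y :
  x = y -> existT E x 0 = existT E y 0.
Proof. by move->. Qed.

(* An H-family over X: complex vector spaces indexed by the points of X, a    *)
(* topology on the total space, and an action of H on the total space by      *)
(* linear maps between fibres that covers the action on X.                    *)
Record gfamily (C : numClosedFieldType) (G : topologicalGroupType)
    (H : subgroup G) (X : gspace G) := GFamily {
  fibre :> X -> lmodType C;
  total_open : set (set {x & fibre x});
  total_openT : total_open setT;
  total_openI : setI_closed total_open;
  total_open_bigcup : forall (I : Type) (U : I -> set {x & fibre x}),
    (forall i, total_open (U i)) -> total_open (\bigcup_i U i);
  fact : forall g, H g -> forall x, {linear fibre x -> fibre (act g x)};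
  fact1 : forall (h1 : H 1%g) x (e : fibre x),
    existT fibre (act 1%g x) (fact h1 x e) = existT fibre x e;
  factM : forall g h (Hg : H g) (Hh : H h) (Hgh : H (g * h)%g) x (e : fibre x),
    existT fibre (act (g * h)%g x) (fact Hgh x e) =
    existT fibre (act g (act h x)) (fact Hg (act h x) (fact Hh x e))
}.

Arguments fact {C G H X E g} Hg x : rename.

Definition total C G H X (E : @gfamily C G H X) : Type := {x : X & E x}.

Section total.
Context {C : numClosedFieldType} {G : topologicalGroupType} {H : subgroup G}.
Context {X : gspace G} (E : gfamily C H X).

HB.instance Definition _ := Choice.on (total E).
HB.instance Definition _ := isOpenTopological.Build (total E)
  (@total_openT _ _ _ _ E) (@total_openI _ _ _ _ E)
  (@total_open_bigcup _ _ _ _ E).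

Definition Total (x : X) (e : E x) : total E := existT (fibre E) x e.

Definition base (e : total E) : X := projT1 e.

Definition tact (g : G) (Hg : H g) (e : total E) : total E :=
  Total (fact Hg (projT1 e) (projT2 e)).

Lemma tact1 (H1 : H 1%g) e : tact H1 e = e.
Proof. by case: e => x e; exact: fact1. Qed.

Lemma tactM g h (Hg : H g) (Hh : H h) (Hgh : H (g * h)%g) e :
  tact Hgh e = tact Hg (tact Hh e).
Proof. exact: factM. Qed.

Lemma tact_ext g h (Hg : H g) (Hh : H h) e : g = h -> tact Hg e = tact Hh e.
Proof. by move=> gh; subst h; rewrite (Prop_irrelevance Hg Hh). Qed.

Lemma tactK g (Hg : H g) (HVg : H g^-1%g) e : tact HVg (tact Hg e) = e.
Proof.
have H1 : H 1%g := subgroup1 H.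
have HVgg : H (g^-1 * g)%g by rewrite mulVg.
by rewrite -(tactM _ _ HVgg) (tact_ext _ H1) ?mulVg// tact1.
Qed.

Lemma tactKV g (Hg : H g) (HVg : H g^-1%g) e : tact Hg (tact HVg e) = e.
Proof.
have H1 : H 1%g := subgroup1 H.
have HgVg : H (g * g^-1)%g by rewrite mulgV.
by rewrite -(tactM _ _ HgVg) (tact_ext _ H1) ?mulgV// tact1.
Qed.

(* The rank is allowed to vary with the point.                                *)
Definition locally_trivial : Prop :=
  forall x0 : X, exists (n : nat) (U : set X)
    (phi : forall x, E x -> 'cV[C]_n) (psi : forall x, 'cV[C]_n -> E x),
  [/\ open_nbhs x0 U,
      forall x, U x -> [/\ linear (phi x), cancel (phi x) (psi x) &
                           cancel (psi x) (phi x)],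
      {within base @^-1` U,
        continuous (fun e : total E => phi (projT1 e) (projT2 e))} &
      {within U `*` setT,
        continuous (fun p : X * 'cV[C]_n => Total (psi p.1 p.2))}].

Record is_gbundle : Prop := IsGBundle {
  gbundle_base_continuous : continuous base;
  gbundle_locally_trivial : locally_trivial;
  gbundle_act_continuous :
    continuous (fun p : set_type H * total E => tact (set_valP p.1) p.2)
}.

End total.

Record gmap (C : numClosedFieldType) (G : topologicalGroupType)
    (H : subgroup G) (Y X : gspace G) (f : Y -> X)
    (E' : gfamily C H Y) (E : gfamily C H X) := GMap {
  gmap_fun :> forall y, {linear E' y -> E (f y)};
  gmap_fact : forall g (Hg : H g) y (e : E' y),
    Total (gmap_fun (act g y) (fact Hg y e)) =
    tact Hg (Total (gmap_fun y e))
}.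

Section gmap.
Context {C : numClosedFieldType} {G : topologicalGroupType} {H : subgroup G}.
Context {Y X : gspace G} {f : Y -> X}.
Context {E' : gfamily C H Y} {E : gfamily C H X}.

Definition tmap (m : gmap f E' E) (e : total E') : total E :=
  Total (m (projT1 e) (projT2 e)).

Lemma tmap_tact m g (Hg : H g) e : tmap m (tact Hg e) = tact Hg (tmap m e).
Proof. by case: e => y e; exact: gmap_fact. Qed.

(* A bundle map exhibiting E' as the pullback of E along f.                   *)
Definition cartesian (m : gmap f E' E) : Prop :=
  continuous (tmap m) /\ forall y, bijective (m y).

End gmap.

Definition is_gbundle_iso (C : numClosedFieldType) (G : topologicalGroupType)
    (H : subgroup G) (X : gspace G) (E F : gfamily C H X)
    (m : gmap idfun E F) : Prop :=
  exists m' : gmap idfun F E,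
    [/\ continuous (tmap m), continuous (tmap m'),
        forall x, cancel (m x) (m' x) & forall x, cancel (m' x) (m x)].

Section initial_total.
Context {T : choiceType} {S : topologicalType} (i : T -> S).

Definition initial_open : set (set T) := @open (initial_topology i).

Lemma initial_openT : initial_open setT.
Proof. exact: openT. Qed.

Lemma initial_openI : setI_closed initial_open.
Proof. by move=> ? ?; exact: openI. Qed.

Lemma initial_open_bigcup (I : Type) (U : I -> set T) :
  (forall i, initial_open (U i)) -> initial_open (\bigcup_i U i).
Proof. by move=> oU; apply: bigcup_open => j _; exact: oU. Qed.

End initial_total.

Section dsum.
Context {C : pzRingType} {I : Type} (F : I -> lmodType C).

Record dsum := DSum {
  dsum_fun :> forall i, F i;
  dsum_finite : finite_set [set i | dsum_fun i != 0]
}.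

HB.instance Definition _ := gen_eqMixin dsum.
HB.instance Definition _ := gen_choiceMixin dsum.

Lemma dsumP (s t : dsum) : (forall i, s i = t i) -> s = t.
Proof.
case: s t => [s hs] [t ht] /= st.
have {}st : s = t by apply: functional_extensionality_dep.
by subst t; rewrite (Prop_irrelevance hs ht).
Qed.

Fact dsum0_finite : finite_set [set i | (0 : F i) != 0].
Proof.
by rewrite (_ : [set _ | _] = set0) // -subset0 => i /=; rewrite eqxx.
Qed.
Definition dsum0 := DSum dsum0_finite.

Fact dsum_opp_finite (s : dsum) : finite_set [set i | - s i != 0].
Proof.
by apply: sub_finite_set (dsum_finite s) => i /=; rewrite oppr_eq0.
Qed.
Definition dsum_opp s := DSum (dsum_opp_finite s).

Fact dsum_add_finite (s t : dsum) : finite_set [set i | s i + t i != 0].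
Proof.
have : finite_set ([set i | s i != 0] `|` [set i | t i != 0]).
  by rewrite finite_setU; split; exact: dsum_finite.
apply: sub_finite_set => i /= st0.
have [s0|] := eqVneq (s i) 0; last by left.
by right; move: st0; rewrite s0 add0r.
Qed.
Definition dsum_add s t := DSum (dsum_add_finite s t).

Fact dsum_scale_finite (c : C) (s : dsum) :
  finite_set [set i | c *: s i != 0].
Proof.
apply: sub_finite_set (dsum_finite s) => i /=.
by apply: contraNN => /eqP ->; rewrite scaler0.
Qed.
Definition dsum_scale c s := DSum (dsum_scale_finite c s).

Lemma dsum_addA : associative dsum_add.
Proof. by move=> s t u; apply: dsumP => i /=; rewrite addrA. Qed.
Lemma dsum_addC : commutative dsum_add.
Proof. by move=> s t; apply: dsumP => i /=; rewrite addrC. Qed.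
Lemma dsum_add0 : left_id dsum0 dsum_add.
Proof. by move=> s; apply: dsumP => i /=; rewrite add0r. Qed.
Lemma dsum_addN : left_inverse dsum0 dsum_opp dsum_add.
Proof. by move=> s; apply: dsumP => i /=; rewrite addNr. Qed.

HB.instance Definition _ :=
  GRing.isZmodule.Build dsum dsum_addA dsum_addC dsum_add0 dsum_addN.

Lemma dsum_scaleA a b s : dsum_scale a (dsum_scale b s) = dsum_scale (a * b) s.
Proof. by apply: dsumP => i /=; rewrite scalerA. Qed.
Lemma dsum_scale1 : left_id 1 dsum_scale.
Proof. by move=> s; apply: dsumP => i /=; rewrite scale1r. Qed.
Lemma dsum_scaleDr : right_distributive dsum_scale +%R.
Proof. by move=> a s t; apply: dsumP => i /=; rewrite scalerDr. Qed.
Lemma dsum_scaleDl s : {morph dsum_scale^~ s : a b / a + b}.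
Proof. by move=> a b; apply: dsumP => i /=; rewrite scalerDl. Qed.

HB.instance Definition _ := GRing.Zmodule_isLmodule.Build C dsum
  dsum_scaleA dsum_scale1 dsum_scaleDr dsum_scaleDl.

Lemma dsum_linE (c : C) (s t : dsum) i : (c *: s + t) i = c *: s i + t i.
Proof. by []. Qed.

End dsum.

Section dsum_map.
Context {C : pzRingType} {I : Type} {F F' : I -> lmodType C}.
Variable h : forall i, {linear F i -> F' i}.

Fact dsum_map_finite (s : dsum F) : finite_set [set i | h i (s i) != 0].
Proof.
apply: sub_finite_set (dsum_finite s) => i /=.
by apply: contraNN => /eqP ->; rewrite linear0.
Qed.
Definition dsum_map (s : dsum F) : dsum F' := DSum (dsum_map_finite s).

Lemma dsum_map_linear : linear dsum_map.
Proof. by move=> c s t; apply: dsumP => i /=; rewrite linearP. Qed.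

HB.instance Definition _ :=
  GRing.isLinear.Build C (dsum F) (dsum F') *:%R dsum_map dsum_map_linear.

End dsum_map.

(* Finite-dimensional, as irreducible unitary representations of a compact    *)
(* group are. The space V_rho is C^n with its standard Hermitian product.     *)
(* Only the restriction of irrep_mx to A is meaningful.                       *)
Record irrep (C : numClosedFieldType) (G : topologicalGroupType)
    (A : subgroup G) := Irrep {
  irrep_dim : nat;
  irrep_mx :> G -> 'M[C]_irrep_dim;
  irrep_unitary : forall a, A a -> irrep_mx a \is unitarymx;
  irrepM : forall a b, A a -> A b ->
    irrep_mx (a * b)%g = irrep_mx a *m irrep_mx b;
  irrep_continuous : {within A, continuous irrep_mx};
  irrep_dim_gt0 : (0 < irrep_dim)%N;
  irrep_simple : forall W : {vspace 'cV[C]_irrep_dim},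
    (forall a v, A a -> v \in W -> irrep_mx a *m v \in W) ->
    W = 0%VS \/ W = fullv
}.

Section irrep_theory.
Context {C : numClosedFieldType} {G : topologicalGroupType} {A : subgroup G}.

Definition unitary_equiv (rho sigma : irrep C A) : Prop :=
  exists u : 'M[C]_(irrep_dim sigma, irrep_dim rho),
  [/\ u *m (u ^t*)%sesqui = 1%:M, (u ^t*)%sesqui *m u = 1%:M &
      forall a, A a -> sigma a *m u = u *m rho a].

Definition irr_class (rho : irrep C A) : set (irrep C A) :=
  [set sigma | unitary_equiv rho sigma].

Lemma unitary_equiv_refl rho : unitary_equiv rho rho.
Proof.
exists 1%:M; rewrite trmx1 map_mx1 mulmx1; split => // a _.
by rewrite mulmx1 mul1mx.
Qed.

Lemma unitary_equiv_sym rho sigma :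
  unitary_equiv rho sigma -> unitary_equiv sigma rho.
Proof.
move=> [u [uu' u'u uA]]; exists (u ^t*)%sesqui.
rewrite trmxCK; split => // a Aa; set w := (u ^t*)%sesqui in uu' u'u *.
have := congr1 (fun M => w *m (M *m w)) (uA a Aa).
by rewrite -(mulmxA (sigma a)) uu' mulmx1 !mulmxA u'u mul1mx.
Qed.

Lemma unitary_equiv_trans rho sigma tau :
  unitary_equiv rho sigma -> unitary_equiv sigma tau -> unitary_equiv rho tau.
Proof.
move=> [u [uu' u'u uA]] [v [vv' v'v vA]]; exists (v *m u).
have -> : ((v *m u) ^t* = u ^t* *m v ^t*)%sesqui by rewrite trmx_mul map_mxM.
split.
- by rewrite mulmxA -(mulmxA v) uu' mulmx1.
- by rewrite mulmxA -(mulmxA _ _ v) v'v mulmx1.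
- by move=> a Aa; rewrite mulmxA vA// -!mulmxA uA.
Qed.

Lemma irr_classP rho sigma :
  irr_class rho = irr_class sigma <-> unitary_equiv rho sigma.
Proof.
split=> [e|rs].
  have : irr_class sigma sigma by exact: unitary_equiv_refl.
  by rewrite -e.
apply/seteqP; split=> tau /=; last exact: unitary_equiv_trans.
by apply: unitary_equiv_trans; exact: unitary_equiv_sym.
Qed.

End irrep_theory.

Section irrep_act.
Context {C : numClosedFieldType} {G : topologicalGroupType}.
Context {A : normal_subgroup G}.

Section irrep_act_def.
Variables (g : G) (rho : irrep C A).

Let rhog (a : G) := rho (g^-1 * a * g)%g.

Fact irrep_act_unitary a : A a -> rhog a \is unitarymx.
Proof. by move=> Aa; apply: irrep_unitary; exact: subgroupJV. Qed.

Fact irrep_actM a b : A a -> A b -> rhog (a * b)%g = rhog a *m rhog b.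
Proof.
move=> Aa Ab; rewrite /rhog -irrepM; try exact: subgroupJV.
by congr (rho _); rewrite !mulgA mulgK.
Qed.

Fact irrep_act_continuous : {within A, continuous rhog}.
Proof.
have conj_cont : continuous (fun a : G => (g^-1 * a * g)%g).
  have pair_cont (h k : G -> G) : continuous h -> continuous k ->
      continuous (fun a => (h a * k a)%g).
    move=> ch ck a; apply: (@continuous_comp _ _ _ (fun a => (h a, k a))
      (fun p : G * G => (p.1 * p.2)%g)); last exact: mulg_continuous.
    by apply: cvg_pair; [exact: ch|exact: ck].
  apply: (pair_cont (fun a => (g^-1 * a)%g) (fun=> g)); last exact: cst_continuous.
  by apply: (pair_cont (fun=> g^-1)%g id) => [|a //]; exact: cst_continuous.
apply/subspace_continuousP => a Aa.
apply: (@cvg_comp _ _ _ (fun a => (g^-1 * a * g)%g) rho _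
  (within A (nbhs (g^-1 * a * g)%g))); last first.
  have := @irrep_continuous _ _ _ rho; rewrite subspace_continuousP.
  by move=> rho_cont; exact: (rho_cont _ (subgroupJV g Aa)).
move=> P /= PA; have {}PA := conj_cont a _ PA.
apply: (@filterS _ (nbhs a) _ _ _ _ PA) => b /= PAb Ab.
exact: PAb (subgroupJV g Ab).
Qed.

Fact irrep_act_simple (W : {vspace 'cV[C]_(irrep_dim rho)}) :
  (forall a v, A a -> v \in W -> rhog a *m v \in W) -> W = 0%VS \/ W = fullv.
Proof.
move=> HW; apply: (@irrep_simple _ _ _ rho) => a v Aa vW.
by have := HW (g * a * g^-1)%g v (subgroupJ g Aa) vW; rewrite /rhog !mulgA mulVg mul1g mulgVK.
Qed.

Definition irrep_act : irrep C A :=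
  Irrep irrep_act_unitary irrep_actM irrep_act_continuous
    (irrep_dim_gt0 rho) irrep_act_simple.

End irrep_act_def.

Lemma irrep_act_equiv g rho sigma : unitary_equiv rho sigma ->
  unitary_equiv (irrep_act g rho) (irrep_act g sigma).
Proof.
by move=> [u [? ? uA]]; exists u; split => //= a Aa; apply: uA; exact: subgroupJV.
Qed.

Lemma irrep_act_id rho : unitary_equiv (irrep_act 1%g rho) rho.
Proof.
exists (1%:M : 'M[C]_(irrep_dim rho)); rewrite trmx1 map_mx1 mulmx1.
by split => // a _; rewrite mulmx1 mul1mx /= invg1 mul1g mulg1.
Qed.

Lemma irrep_act_comp g h rho :
  unitary_equiv (irrep_act (g * h)%g rho) (irrep_act g (irrep_act h rho)).
Proof.
exists (1%:M : 'M[C]_(irrep_dim rho)); rewrite trmx1 map_mx1 mulmx1.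
by split => // a _; rewrite mulmx1 mul1mx /= invgM !mulgA.
Qed.

Definition in_isotropy (rho : irrep C A) (g : G) : Prop :=
  irr_class (irrep_act g rho) = irr_class rho.

Fact isotropy1 rho : in_isotropy rho 1%g.
Proof. by apply/irr_classP; exact: irrep_act_id. Qed.

Fact isotropyM rho g h :
  in_isotropy rho g -> in_isotropy rho h -> in_isotropy rho (g * h)%g.
Proof.
move=> /irr_classP rg /irr_classP rh; apply/irr_classP.
apply: unitary_equiv_trans rg; apply: unitary_equiv_trans (irrep_act_comp _ _ _) _.
exact: irrep_act_equiv.
Qed.

Fact isotropyV rho g : in_isotropy rho g -> in_isotropy rho (g^-1)%g.
Proof.
move=> /irr_classP rg; apply/irr_classP; apply: unitary_equiv_sym.
apply: unitary_equiv_trans (irrep_act_equiv g^-1%g rg).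
apply: unitary_equiv_trans (irrep_act_comp _ _ _); rewrite mulVg.
by apply: unitary_equiv_sym; exact: irrep_act_id.
Qed.

Definition isotropy (rho : irrep C A) : subgroup G :=
  Subgroup (isotropy1 rho) (@isotropyM rho) (@isotropyV rho).

Definition orbit_representatives (S : set (irrep C A)) : Prop :=
  (forall rho, exists2 sigma, S sigma &
     exists g, irr_class (irrep_act g sigma) = irr_class rho) /\
  (forall sigma tau, S sigma -> S tau ->
     (exists g, irr_class (irrep_act g sigma) = irr_class tau) -> sigma = tau).

Definition intertwiner (rho : irrep C A) (g : G) (u : 'M[C]_(irrep_dim rho)) :=
  u \is unitarymx /\
  forall a, A a -> rho (g * a * g^-1)%g = u *m rho a *m invmx u.

Arguments intertwiner rho g u : clear implicits.

Lemma intertwiner_ex rho g : isotropy rho g -> exists u, intertwiner rho g u.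
Proof.
move=> /irr_classP [u [uu' u'u uA]].
have Uu : u \is unitarymx by apply/unitarymxP.
exists u; split => // a Aa; rewrite (invmx_unitary Uu).
have := uA _ (subgroupJ g Aa) => /=.
rewrite !mulgA mulVg mul1g mulgVK => <-.
by rewrite -mulmxA uu' mulmx1.
Qed.

Definition choose_intertwiner (rho : irrep C A) (g : G) : 'M[C]_(irrep_dim rho) :=
  xget 1%:M [set u | intertwiner rho g u].

Lemma choose_intertwinerP rho g :
  isotropy rho g -> intertwiner rho g (choose_intertwiner rho g).
Proof. by move=> /intertwiner_ex [u hu]; exact: (xgetPex _ (ex_intro _ u hu)). Qed.

Lemma irrep_schur (rho : irrep C A) (M : 'M[C]_(irrep_dim rho)) :
  (forall a, A a -> rho a *m M = M *m rho a) -> exists c, M = c%:M.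
Proof.
move=> MA; have [c] := eigenvalue_closed M^T (irrep_dim_gt0 rho).
case/eigenvalueP => v vM v0; exists c.
pose f := linfun (mulmx (M - c%:M) : 'cV[C]_(irrep_dim rho) -> 'cV[C]_(irrep_dim rho)).
have fE w : f w = M *m w - c *: w by rewrite lfunE /= mulmxBl mul_scalar_mx.
have [|k0|kT] := @irrep_simple _ _ _ rho (lker f).
- move=> a w Aa; rewrite !memv_ker !fE => /eqP fw.
  by rewrite mulmxA -MA // -mulmxA scalemxAr -mulmxBr fw mulmx0.
- have : v^T \in lker f.
    rewrite memv_ker fE; apply/eqP/trmx_inj.
    by rewrite linearB /= trmx_mul trmxK vM linearZ /= trmxK subrr trmx0.
  by rewrite k0 memv0 -(inj_eq trmx_inj) trmxK trmx0 (negPf v0).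
- apply/eqP; rewrite -subr_eq0; apply/eqP/matrixP => i j.
  have : delta_mx j 0 \in lker f by rewrite kT memvf.
  rewrite memv_ker => /eqP/matrixP/(_ i 0).
  by rewrite lfunE /= -colE !mxE.
Qed.

Lemma intertwiner_unique rho g (u v : 'M[C]_(irrep_dim rho)) :
  intertwiner rho g u -> intertwiner rho g v -> exists2 c : C, c != 0 & u = c *: v.
Proof.
move=> [/unitarymx_unit Uu uA] [/unitarymx_unit Uv vA].
have [|c cE] := @irrep_schur rho (invmx v *m u).
  move=> a Aa; have := uA a Aa; rewrite (vA a Aa).
  move=> /(congr1 (fun M => invmx v *m (M *m u))).
  by rewrite !mulmxA mulVmx // mul1mx -!mulmxA mulVmx // mulmx1.
have uE : u = c *: v by rewrite -[u](mulKVmx Uv) cE mul_mx_scalar.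
exists c => //; apply/eqP => c0; pose i := Ordinal (irrep_dim_gt0 rho).
have := mulmxV Uu; rewrite {1}uE c0 scale0r mul0mx => /matrixP/(_ i i)/eqP.
by rewrite !mxE eqxx eq_sym oner_eq0.
Qed.

Lemma intertwiner1 rho : intertwiner rho 1%g (1%:M : 'M[C]_(irrep_dim rho)).
Proof.
split; first by apply/unitarymxP; rewrite trmx1 map_mx1 mulmx1.
by move=> a _; rewrite invmx1 mulmx1 mul1mx mul1g invg1 mulg1.
Qed.

Lemma intertwinerM rho g h (u v : 'M[C]_(irrep_dim rho)) :
  intertwiner rho g u -> intertwiner rho h v -> intertwiner rho (g * h)%g (u *m v).
Proof.
move=> [Uu uA] [Uv vA]; have Uuv : u *m v \is unitarymx by exact: mul_unitarymx.
split=> //.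
move=> a Aa; rewrite invgM !mulgA -(mulgA g) -(mulgA g).
rewrite uA; last by exact: subgroupJ.
by rewrite vA // !invmx_unitary // trmx_mul map_mxM !mulmxA.
Qed.

End irrep_act.

Arguments intertwiner {C G A} rho g u.

(* C^n (x) W, modelled by W^n: the family t stands for the sum of the         *)
(* e_i (x) t_i. See tens_universal.                                           *)
Definition tens (C : pzRingType) (n : nat) (W : lmodType C) : lmodType C :=
  {ffun 'I_n -> W}.

Section tens.
Context {C : comNzRingType} {n : nat}.

Definition pure_tensor (W : lmodType C) (v : 'cV[C]_n) (w : W) : tens n W :=
  [ffun i => v i 0 *: w].

Lemma tens_universal (W U : lmodType C) (b : 'cV[C]_n -> W -> U) :
  (forall w, linear (b^~ w)) -> (forall v, linear (b v)) ->
  exists! f : tens n W -> U,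
    linear f /\ forall v w, f (pure_tensor v w) = b v w.
Proof.
move=> bl br.
pose bL w : {linear 'cV[C]_n -> U} :=
  HB.pack (b^~ w) (GRing.isLinear.Build C _ U *:%R (b^~ w) (bl w)).
pose bR v : {linear W -> U} :=
  HB.pack (b v) (GRing.isLinear.Build C _ U *:%R (b v) (br v)).
exists (fun t : tens n W => \sum_i b (delta_mx i 0) (t i)); split; [split|].
- move=> c s t; rewrite scaler_sumr -big_split; apply: eq_bigr => i _ /=.
  by rewrite !ffunE; exact: (br (delta_mx i 0)).
- move=> v w; rewrite {2}(matrix_sum_delta v) -[RHS]/(bL w _) linear_sum /=.
  apply: eq_bigr => i _; rewrite big_ord1 ffunE -[RHS]/(bL w _) linearZ /=.
  by rewrite -[LHS]/(bR (delta_mx i 0) _) linearZ.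
move=> f [fl fb].
pose fL : {linear tens n W -> U} :=
  HB.pack f (GRing.isLinear.Build C _ U *:%R f fl).
apply/funext => t.
have {2}-> : t = \sum_i pure_tensor (delta_mx i 0) (t i).
  apply/ffunP => j; rewrite sum_ffunE (bigD1 j) //= big1 => [|i ij].
    by rewrite addr0 ffunE mxE !eqxx scale1r.
  by rewrite ffunE mxE eq_sym (negPf ij) scale0r.
rewrite -[RHS]/(fL _) linear_sum /=.
by apply: eq_bigr => i _; rewrite fb.
Qed.

Definition tens_map (W W' : lmodType C) (u : 'M[C]_n) (h : W -> W')
    (t : tens n W) : tens n W' :=
  [ffun j => \sum_i u j i *: h (t i)].

Lemma tens_map_pure (W W' : lmodType C) u (h : {linear W -> W'}) v w :
  tens_map u h (pure_tensor v w) = pure_tensor (u *m v) (h w).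
Proof.
apply/ffunP => j; rewrite !ffunE mxE scaler_suml; apply: eq_bigr => i _.
by rewrite ffunE linearZ scalerA.
Qed.

Lemma tens_map_linear (W W' : lmodType C) u (h : {linear W -> W'}) :
  linear (tens_map u h).
Proof.
move=> c s t; apply/ffunP => j; rewrite !ffunE scaler_sumr -big_split.
apply: eq_bigr => i _ /=; rewrite !ffunE linearP scalerDr.
by rewrite !scalerA (mulrC c).
Qed.

End tens.

Section homA.
Context {C : numClosedFieldType} {G : topologicalGroupType}.
Context {A : normal_subgroup G} {X : gspace G}.
Variables (E : gfamily C (whole G) X) (rho : irrep C A).
Local Notation n := (irrep_dim rho).

Definition is_homA (x : X) (phi : 'cV[C]_n -> E x) : Prop :=
  linear phi /\ forall a v, A a ->
    Total (phi (rho a *m v)) = tact (I : whole G a) (Total (phi v)).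

Definition homA_pred (x : X) : {pred 'cV[C]_n -> E x} :=
  fun phi => `[< is_homA phi >].

(* Hom_A(rho, E)_x; it is a vector space because A acts trivially on X. *)
Record homA (AX : acts_trivially A X) (x : X) := HomA {
  homA_fun :> 'cV[C]_n -> E x;
  homA_prop : homA_pred homA_fun
}.

Section homA_lmod.
Variables (AX : acts_trivially A X) (x : X).

HB.instance Definition _ := [isSub for @homA_fun AX x].
HB.instance Definition _ := [Choice of homA AX x by <:].

Fact homA_submod : GRing.submod_closed (@homA_pred x).
Proof.
split.
  apply/asboolP; split => [c v w|a v Aa] /=.
    by rewrite scaler0 addr0.
  rewrite /tact /Total /= linear0; apply: existT_0; symmetry; exact: AX.
move=> c phi psi /asboolP[philin phiA] /asboolP[psilin psiA].
apply/asboolP; split => [d v w|a v Aa] /=.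
  rewrite -[LHS]/(c *: phi (d *: v + w) + psi (d *: v + w)).
  have -> : phi (d *: v + w) = d *: phi v + phi w by exact: philin.
  have -> : psi (d *: v + w) = d *: psi v + psi w by exact: psilin.
  by rewrite !scalerDr !scalerA (mulrC c d) addrACA.
rewrite /tact /Total /= linearP; apply: existT_lin; [exact: phiA|exact: psiA].
Qed.

HB.instance Definition _ :=
  GRing.isSubmodClosed.Build C ('cV[C]_n -> E x) (@homA_pred x) homA_submod.
HB.instance Definition _ := [SubChoice_isSubLmodule of homA AX x by <:].

End homA_lmod.
End homA.

Section rep_homA.
Context {C : numClosedFieldType} {G : topologicalGroupType}.
Context {A : normal_subgroup G} {X : gspace G}.
Variables (AX : acts_trivially A X) (E : gfamily C (whole G) X).
Variable rho : irrep C A.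
Local Notation n := (irrep_dim rho).
Local Notation homA := (homA E rho AX).

Lemma homAP x (phi psi : homA x) : (forall v, phi v = psi v) -> phi = psi.
Proof. by move=> h; apply/val_inj/funext. Qed.

Lemma homA_linear x (phi : homA x) : linear phi.
Proof. by case: phi => f /= /asboolP[]. Qed.

Lemma homA_equiv x (phi : homA x) a v : A a ->
  Total (phi (rho a *m v)) = tact (I : whole G a) (Total (phi v)).
Proof. by case: phi => f /= /asboolP[_]; apply. Qed.

Lemma homAZ x (phi : homA x) c v : phi (c *: v) = c *: phi v.
Proof.
have phi0 : phi 0 = 0.
  by have := homA_linear phi (-1) 0 0; rewrite scaler0 addr0 scaleN1r addNr.
by have := homA_linear phi c v 0; rewrite !addr0 phi0 addr0.
Qed.

Lemma homA_linE x (c : C) (phi psi : homA x) v :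
  (c *: phi + psi) v = c *: phi v + psi v.
Proof. by []. Qed.

Lemma homA_sumE x I (r : seq I) (c : I -> C) (phi : I -> homA x) v :
  (\sum_(i <- r) c i *: phi i) v = \sum_(i <- r) c i *: phi i v.
Proof. by elim/big_rec2: _ => //= i y1 y2 _ <-. Qed.

Section homA_act.
Variables (g : G) (u : 'M[C]_n) (gu : intertwiner rho g u) (x : X).

Fact homA_act_subproof (phi : homA x) :
  homA_pred (fun v => fact (I : whole G g) x (phi (invmx u *m v))).
Proof.
apply/asboolP; split=> [c v w|a v Aa].
  by rewrite mulmxDr -scalemxAr homA_linear linearP.
have Aga : A (g^-1 * a * g)%g by exact: subgroupJV.
have [/unitarymx_unit Uu /(_ _ Aga)] := gu.
rewrite !mulgA mulgV mul1g mulgK => ->.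
rewrite -!mulmxA mulKmx //.
rewrite -[LHS]/(tact (I : whole G g) (Total (phi _))) homA_equiv //.
rewrite -[X in _ = tact _ X]/(tact (I : whole G g) (Total (phi _))).
rewrite -(tactM _ _ (I : whole G (g * (g^-1 * a * g))%g)).
rewrite -(tactM _ _ (I : whole G (a * g)%g)).
by apply: tact_ext; rewrite !mulgA mulgV mul1g.
Qed.

(* phi |-> g o phi o u^-1 *)
Definition homA_act (phi : homA x) : homA (act g x) :=
  HomA AX (homA_act_subproof phi).

Fact homA_act_linear : linear homA_act.
Proof. by move=> c phi psi; apply: homAP => v; exact: linearP. Qed.

HB.instance Definition _ := GRing.isLinear.Build C (homA x) (homA (act g x))
  *:%R homA_act homA_act_linear.

End homA_act.

Definition rep_homA_fibre (x : X) : lmodType C := tens n (homA x).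

(* Through a basis of V_rho, the bundle rho (x) Hom_A(rho, E) is a subbundle  *)
(* of a product of copies of E: a vector of it amounts to the vectors         *)
(* phi_i(v) of E.                                                             *)
Definition rep_homA_embed (t : {x & rep_homA_fibre x}) :
    X * prod_topology (fun _ : 'I_n * 'cV[C]_n => total E) :=
  (projT1 t, fun iv => Total ((projT2 t : tens n _) iv.1 iv.2)).

Lemma rep_homA_ext x y (s : tens n (homA x)) (t : tens n (homA y)) : x = y ->
  (forall i v, Total (s i v) = Total (t i v)) ->
  existT rep_homA_fibre x s = existT rep_homA_fibre y t.
Proof.
move=> xy; subst y => st; congr existT; apply/ffunP => i; apply: homAP => v.
exact: eq_from_Tagged (st i v).
Qed.

(* g . (v (x) phi) = u v (x) g o phi o u^-1 *)
Definition rep_homA_act g (Hg : isotropy rho g) x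
    (t : rep_homA_fibre x) : rep_homA_fibre (act g x) :=
  tens_map (choose_intertwiner rho g)
    (homA_act (choose_intertwinerP Hg) (x:=x)) t.

Fact rep_homA_act_linear g (Hg : isotropy rho g) x :
  linear (@rep_homA_act g Hg x).
Proof. exact: tens_map_linear. Qed.

HB.instance Definition _ g (Hg : isotropy rho g) x :=
  GRing.isLinear.Build C (rep_homA_fibre x) (rep_homA_fibre (act g x)) *:%R
    (@rep_homA_act g Hg x) (@rep_homA_act_linear g Hg x).

Lemma rep_homA_act_val g (Hg : isotropy rho g) x (t : tens n (homA x)) j v :
  (rep_homA_act Hg t : tens n (homA (act g x))) j v =
  \sum_i choose_intertwiner rho g j i *:
    fact (I : whole G g) x (t i (invmx (choose_intertwiner rho g) *m v)).
Proof. by rewrite ffunE homA_sumE. Qed.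

Lemma rep_homA_actE g (Hg : isotropy rho g) u (gu : intertwiner rho g u) x t :
  @rep_homA_act g Hg x t = tens_map u (homA_act gu (x:=x)) t.
Proof.
have hu := choose_intertwinerP Hg.
have [c c0 cE] := intertwiner_unique hu gu.
apply/ffunP => j; rewrite !ffunE; apply: eq_bigr => i _; apply: homAP => v.
rewrite -[LHS]/(choose_intertwiner rho g j i *:
  fact (I : whole G g) x (t i (invmx (choose_intertwiner rho g) *m v))).
rewrite cE invmxZ; last by rewrite -cE; apply: unitarymx_unit; case: hu.
rewrite -scalemxAl homAZ linearZ /= mxE scalerA mulrAC mulfV // mul1r.
by [].
Qed.

Lemma rep_homA_fact1 (h1 : isotropy rho 1%g) x (t : rep_homA_fibre x) :
  existT rep_homA_fibre (act 1%g x) (rep_homA_act h1 t) =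
  existT rep_homA_fibre x t.
Proof.
apply: rep_homA_ext => [|i v]; first exact: act1.
rewrite (rep_homA_actE _ (intertwiner1 rho)) ffunE homA_sumE.
rewrite (bigD1 i) //= big1 => [|k ki]; last first.
  by rewrite mxE eq_sym (negPf ki) scale0r.
rewrite addr0 mxE eqxx scale1r invmx1 mul1mx.
exact: (tact1 (E := E) I (Total (t i v))).
Qed.

Lemma rep_homA_factM g h (Hg : isotropy rho g) (Hh : isotropy rho h)
    (Hgh : isotropy rho (g * h)%g) x (t : rep_homA_fibre x) :
  existT rep_homA_fibre (act (g * h)%g x) (rep_homA_act Hgh t) =
  existT rep_homA_fibre (act g (act h x)) (rep_homA_act Hg (rep_homA_act Hh t)).
Proof.
set u := choose_intertwiner rho g; set v := choose_intertwiner rho h.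
have gu : intertwiner rho g u := choose_intertwinerP Hg.
have hv : intertwiner rho h v := choose_intertwinerP Hh.
have [[Uu _] [Uv _]] := (gu, hv).
have Uuv : u *m v \is unitarymx by exact: mul_unitarymx.
apply: rep_homA_ext => [|j w]; first exact: actM.
rewrite (rep_homA_actE _ (intertwinerM gu hv)) (rep_homA_actE _ gu).
rewrite (rep_homA_actE _ hv) !ffunE !homA_sumE /=.
have -> : invmx (u *m v) = invmx v *m invmx u.
  by rewrite !invmx_unitary // trmx_mul map_mxM.
pose F i := fact (I : whole G h) x (t i (invmx v *m (invmx u *m w))).
transitivity (Total (\sum_i (u *m v) j i *:
    fact (I : whole G g) (act h x) (F i))); last first.
  congr Total; under [RHS]eq_bigr => i _.
    rewrite ffunE homA_sumE linear_sum scaler_sumr.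
    over.
  rewrite exchange_big; apply: eq_bigr => i _ /=.
  rewrite mxE scaler_suml; apply: eq_bigr => k _.
  by rewrite linearZ scalerA.
elim/big_rec2: _ => [|i y1 y2 _ IH]; first by apply: existT_0; exact: actM.
apply: existT_lin IH; rewrite -mulmxA.
exact: (tactM (E := E) I I I (Total (t i _))).
Qed.

Definition rep_homA : gfamily C (isotropy rho) X :=
  @GFamily C G (isotropy rho) X rep_homA_fibre
    (initial_open rep_homA_embed) (initial_openT rep_homA_embed)
    (@initial_openI _ _ rep_homA_embed)
    (@initial_open_bigcup _ _ rep_homA_embed)
    (fun g Hg x => @rep_homA_act g Hg x) rep_homA_fact1 rep_homA_factM.

End rep_homA.

Local Open Scope quotient_scope.

Section cosets.
Context {G : topologicalGroupType} (H : subgroup G).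

Definition coset_rel : rel G :=
  fun g g' => `[< exists2 h, H h & g' = (g * h)%g >].

Fact coset_rel_refl : reflexive coset_rel.
Proof.
by move=> g; apply/asboolP; exists 1%g; rewrite ?mulg1//; exact: subgroup1.
Qed.

Fact coset_rel_sym : symmetric coset_rel.
Proof.
have sub g g' : coset_rel g g' -> coset_rel g' g.
  move=> /asboolP[h Hh ->]; apply/asboolP; exists (h^-1)%g.
    exact: subgroupV.
  by rewrite mulgK.
by move=> g g'; apply/idP/idP; exact: sub.
Qed.

Fact coset_rel_trans : transitive coset_rel.
Proof.
move=> g g' g'' /asboolP[h Hh ->] /asboolP[k Hk ->]; apply/asboolP.
by exists (h * k)%g; rewrite ?mulgA//; exact: subgroupM.
Qed.

Canonical coset_equiv :=
  EquivRel coset_rel coset_rel_refl coset_rel_sym coset_rel_trans.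

Definition cosets : Type := {eq_quot coset_rel}.
HB.instance Definition _ := Choice.on cosets.

Definition coset (g : G) : cosets := \pi_({eq_quot coset_rel}) g.
Definition coset_repr (c : cosets) : G := repr (c : {eq_quot coset_rel}).

Lemma coset_reprK c : coset (coset_repr c) = c.
Proof. exact: reprK. Qed.

Lemma cosetP g g' : coset g = coset g' <-> exists2 h, H h & g' = (g * h)%g.
Proof.
split=> [/eqmodP/asboolP//|gg']; apply/eqmodP; exact/asboolP.
Qed.

Definition coset_act (g : G) (c : cosets) : cosets :=
  coset (g * coset_repr c)%g.

Lemma coset_actE g g' : coset_act g (coset g') = coset (g * g')%g.
Proof.
apply/cosetP; have /cosetP[h Hh g'E] := coset_reprK (coset g').
by exists h => //; rewrite -mulgA -g'E.
Qed.

Lemma coset_actM g g' c :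
  coset_act (g * g')%g c = coset_act g (coset_act g' c).
Proof. by rewrite -[c]coset_reprK !coset_actE mulgA. Qed.

Lemma coset_act1 c : coset_act 1%g c = c.
Proof. by rewrite -[c]coset_reprK coset_actE mul1g. Qed.

End cosets.

Section balanced.
Context {C : numClosedFieldType} {G : topologicalGroupType} {H : subgroup G}.
Context {X : gspace G} (E : gfamily C H X).

(* (g h, e) ~ (g, h e) *)
Definition balanced_rel : rel (G * total E) :=
  fun p q => `[< exists h (Hh : H h),
    p.1 = (q.1 * h)%g /\ q.2 = tact Hh p.2 >].

Fact balanced_rel_refl : reflexive balanced_rel.
Proof.
move=> p; apply/asboolP; exists 1%g, (subgroup1 H).
by rewrite mulg1 tact1.
Qed.

Fact balanced_rel_sym : symmetric balanced_rel.
Proof.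
have sub p q : balanced_rel p q -> balanced_rel q p.
  move=> /asboolP[h [Hh [pq qp]]]; apply/asboolP.
  exists (h^-1)%g, (subgroupV Hh); split; first by rewrite pq mulgK.
  by rewrite qp tactK.
by move=> p q; apply/idP/idP; exact: sub.
Qed.

Fact balanced_rel_trans : transitive balanced_rel.
Proof.
move=> q p r /asboolP[h [Hh [pq qp]]] /asboolP[k [Hk [qr rq]]].
apply/asboolP; exists (k * h)%g, (subgroupM Hk Hh).
by rewrite pq qr mulgA rq qp (tactM Hk Hh).
Qed.

Canonical balanced_equiv := EquivRel balanced_rel
  balanced_rel_refl balanced_rel_sym balanced_rel_trans.

Definition balanced : Type := quotient_topology {eq_quot balanced_rel}.
HB.instance Definition _ := Topological.on balanced.

Definition bclass (g : G) (e : total E) : balanced :=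
  \pi_({eq_quot balanced_rel}) (g, e).
Definition brepr (o : balanced) : G * total E :=
  repr (o : {eq_quot balanced_rel}).

Lemma breprK o : bclass (brepr o).1 (brepr o).2 = o.
Proof. by rewrite /bclass -surjective_pairing; exact: reprK. Qed.

Lemma bclassP g e g' e' : bclass g e = bclass g' e' <->
  exists h (Hh : H h), g = (g' * h)%g /\ e' = tact Hh e.
Proof. by split=> [/eqmodP/asboolP//|gg']; apply/eqmodP; exact/asboolP. Qed.

Lemma bclassM g h (Hh : H h) e : bclass (g * h)%g e = bclass g (tact Hh e).
Proof. by apply/bclassP; exists h, Hh. Qed.

(* G x_H E -> G x_H X = G/H x X, the identification being [g, x] |-> (gH, gx) *)
Definition bproj (o : balanced) : cosets H * X :=
  (coset H (brepr o).1, act (brepr o).1 (base (brepr o).2)).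

Lemma bprojE g e : bproj (bclass g e) = (coset H g, act g (base e)).
Proof.
have /bclassP[h [Hh [rg eE]]] := breprK (bclass g e).
rewrite /bproj; congr pair; last by rewrite [in RHS]eE /base /= -actM -rg.
rewrite rg; apply/cosetP; exists h^-1%g; last by rewrite mulgK.
exact: subgroupV.
Qed.

Definition bact (g : G) (o : balanced) : balanced :=
  bclass (g * (brepr o).1)%g (brepr o).2.

Lemma bactE g g' e : bact g (bclass g' e) = bclass (g * g')%g e.
Proof.
have /bclassP[h [Hh [rg eE]]] := breprK (bclass g' e).
by rewrite /bact rg mulgA (bclassM _ Hh) -eE.
Qed.

Lemma bproj_bact g o :
  bproj (bact g o) = (coset_act g (bproj o).1, act g (bproj o).2).
Proof. by rewrite -(breprK o) bactE !bprojE /= coset_actE actM. Qed.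

Lemma bactM g g' o : bact (g * g')%g o = bact g (bact g' o).
Proof. by rewrite -(breprK o) !bactE mulgA. Qed.

Lemma bact1 o : bact 1%g o = o.
Proof. by rewrite -(breprK o) bactE mul1g. Qed.

(* The fibre of G x_H E over (c, x), whose elements are the [g, e] with       *)
(* gH = c and e in the fibre of E over g^-1 x.                                *)
Record bfibre (c : cosets H) (x : X) := BFibre {
  bfibre_val :> balanced;
  bfibre_proj : bproj bfibre_val = (c, x)
}.

Lemma bfibreP c x (s t : bfibre c x) : s = t :> balanced -> s = t.
Proof.
by case: s t => s ps [t pt] /= st; subst t; rewrite (Prop_irrelevance ps pt).
Qed.

Section bfibre_mk.
Variables (g : G) (c : cosets H) (x : X).

Fact bfibre_mk_subproof (gc : coset H g = c) (e : E (act g^-1%g x)) :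
  bproj (bclass g (Total e)) = (c, x).
Proof. by rewrite bprojE gc /base /= actKV. Qed.

Definition bfibre_mk (gc : coset H g = c) (e : E (act g^-1%g x)) :
    bfibre c x :=
  BFibre (bfibre_mk_subproof gc e).

Lemma bfibre_mk_ex (gc : coset H g = c) (s : bfibre c x) :
  exists e, bfibre_mk gc e = s.
Proof.
case: s => o; rewrite -(breprK o); case: (brepr o) => g' [y e] /= p.
have := p; rewrite bprojE => -[g'c g'y].
have [h Hh gE] : exists2 h, H h & g' = (g * h)%g by apply/cosetP; rewrite gc.
have xy : act h y = act g^-1%g x by rewrite -g'y gE actM actK.
have : projT1 (tact Hh (Total e)) = act g^-1%g x by [].
case eE : (tact Hh (Total e)) => [z e'] /= zx; subst z.
exists e'; apply: bfibreP; rewrite /= -[Total e']/(existT (fibre E) _ e').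
by rewrite -eE -bclassM gE.
Qed.

Lemma bfibre_mk_inj (gc : coset H g = c) : injective (bfibre_mk gc).
Proof.
move=> e e' /(congr1 (@bfibre_val c x)) /= /bclassP[h [Hh [gE eE]]].
have h1 : h = 1%g by have := mulKg g h; rewrite -gE mulVg.
subst h; move: eE; rewrite tact1 => eE; symmetry.
exact: (@eq_from_Tagged X (fibre E) _ _ _ eE).
Qed.

End bfibre_mk.

Section bfibre_lmod.
Variables (c : cosets H) (x : X).
Local Notation F := (bfibre c x).
Local Notation gc := (coset_reprK c).

Let mk : E (act (coset_repr c)^-1%g x) -> F := bfibre_mk gc.
Let rep (s : F) : E (act (coset_repr c)^-1%g x) :=
  sval (cid (bfibre_mk_ex gc s)).

Let repK : cancel rep mk.
Proof. by move=> s; rewrite /rep; case: cid. Qed.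
Let mkK : cancel mk rep.
Proof. by move=> e; apply: (@bfibre_mk_inj _ _ _ gc); exact: repK. Qed.

(* The operations are [g, e] + [g, e'] = [g, e + e'] and                      *)
(* k [g, e] = [g, k e], computed here with the chosen representative g of c;  *)
(* any other one gives the same result, see bfibre_mk_linear.                 *)
Definition bfibre0 : F := mk 0.
Definition bfibre_opp (s : F) : F := mk (- rep s).
Definition bfibre_add (s t : F) : F := mk (rep s + rep t).
Definition bfibre_scale (k : C) (s : F) : F := mk (k *: rep s).

HB.instance Definition _ := gen_eqMixin F.
HB.instance Definition _ := gen_choiceMixin F.

Fact bfibre_addA : associative bfibre_add.
Proof. by move=> s t u; rewrite /bfibre_add !mkK addrA. Qed.
Fact bfibre_addC : commutative bfibre_add.
Proof. by move=> s t; rewrite /bfibre_add addrC. Qed.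
Fact bfibre_add0 : left_id bfibre0 bfibre_add.
Proof. by move=> s; rewrite /bfibre_add /bfibre0 mkK add0r repK. Qed.
Fact bfibre_addN : left_inverse bfibre0 bfibre_opp bfibre_add.
Proof. by move=> s; rewrite /bfibre_add /bfibre_opp mkK addNr. Qed.

HB.instance Definition _ :=
  GRing.isZmodule.Build F bfibre_addA bfibre_addC bfibre_add0 bfibre_addN.

Fact bfibre_scaleA a b s :
  bfibre_scale a (bfibre_scale b s) = bfibre_scale (a * b) s.
Proof. by rewrite /bfibre_scale mkK scalerA. Qed.
Fact bfibre_scale1 : left_id 1 bfibre_scale.
Proof. by move=> s; rewrite /bfibre_scale scale1r repK. Qed.
Fact bfibre_scaleDr : right_distributive bfibre_scale +%R.
Proof.
move=> a s t; rewrite /bfibre_scale -[s + t]/(bfibre_add s t) /bfibre_add mkK.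
by rewrite scalerDr -[RHS]/(bfibre_add _ _) /bfibre_add !mkK.
Qed.
Fact bfibre_scaleDl s : {morph bfibre_scale^~ s : a b / a + b}.
Proof.
move=> a b; rewrite -[RHS]/(bfibre_add _ _) /bfibre_add /bfibre_scale !mkK.
by rewrite scalerDl.
Qed.

HB.instance Definition _ := GRing.Zmodule_isLmodule.Build C F
  bfibre_scaleA bfibre_scale1 bfibre_scaleDr bfibre_scaleDl.

Let mk_linear : linear mk.
Proof.
move=> k e e'; rewrite -[RHS]/(bfibre_add (bfibre_scale _ _) _).
by rewrite /bfibre_add /bfibre_scale !mkK.
Qed.

Lemma bfibre_mk_linear g (gc' : coset H g = c) :
  linear (@bfibre_mk g c x gc').
Proof.
have /cosetP[h Hh gE] : coset H (coset_repr c) = coset H g.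
  by rewrite gc' coset_reprK.
have tr (e : E (act g^-1%g x)) : exists e', bfibre_mk gc' e = mk e' /\
    Total e' = tact Hh (Total e).
  have [e' e'E] := bfibre_mk_ex gc (bfibre_mk gc' e); exists e'; split=> //.
  have : bclass (coset_repr c) (tact Hh (Total e)) =
         bclass (coset_repr c) (Total e').
    by rewrite -bclassM -gE; exact: esym (congr1 (@bfibre_val c x) e'E).
  move=> /bclassP[k [Hk [kE ->]]]; have k1 : k = 1%g.
    by have := mulKg (coset_repr c) k; rewrite -kE mulVg.
  by subst k; rewrite tact1.
move=> k e e'; have [a [-> ae]] := tr e; have [a' [-> ae']] := tr e'.
rewrite -mk_linear; apply: bfibreP => /=.
have -> : Total (k *: a + a') = tact Hh (Total (k *: e + e')).
  rewrite /tact /= linearP; apply: existT_lin; [exact: ae|exact: ae'].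
by rewrite -bclassM -gE.
Qed.

End bfibre_lmod.
End balanced.

Lemma fibre_transport (C : numClosedFieldType) (G : topologicalGroupType)
    (H : subgroup G) (X : gspace G) (E : gfamily C H X) (x y : X) : x = y ->
  exists2 tr : E x -> E y, (forall e, Total (tr e) = Total e) & linear tr.
Proof. by move=> xy; subst y; exists idfun. Qed.

Section Ind.
Context {C : numClosedFieldType} {G : topologicalGroupType} {H : subgroup G}.
Context {X : gspace G} (E : gfamily C H X).

Section bfibre_act.
Variables (g : G) (c : cosets H) (x : X).

Fact bfibre_act_subproof (s : bfibre E (coset_act g^-1%g c) x) :
  bproj (bact g s) = (c, act g x).
Proof.
by rewrite bproj_bact bfibre_proj /= -coset_actM mulgV coset_act1.
Qed.

Definition bfibre_act (s : bfibre E (coset_act g^-1%g c) x) :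
    bfibre E c (act g x) :=
  BFibre (bfibre_act_subproof s).

Fact bfibre_act_linear : linear bfibre_act.
Proof.
set c' := coset_act g^-1%g c; pose k := coset_repr c'.
have kc : coset H k = c' := coset_reprK c'.
have gkc : coset H (g * k)%g = c.
  by rewrite -coset_actE kc /c' -coset_actM mulgV coset_act1.
have kx : act k^-1%g x = act (g * k)^-1%g (act g x).
  by rewrite invgM actM actK.
have [tr trE tr_lin] := fibre_transport E kx.
have mkE e : bfibre_act (bfibre_mk kc e) = bfibre_mk gkc (tr e).
  by apply: bfibreP; rewrite /= bactE trE.
move=> a s t; have [e <-] := bfibre_mk_ex kc s; have [e' <-] := bfibre_mk_ex kc t.
by rewrite -bfibre_mk_linear !mkE tr_lin bfibre_mk_linear.
Qed.

HB.instance Definition _ := GRing.isLinear.Build C _ _ *:%R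
  bfibre_act bfibre_act_linear.

End bfibre_act.

(* The sum over G/H of the spaces {[g, e] | gH = c, e in E over g^-1 x}. It   *)
(* is finitely supported, so that no condition on the index of H is needed.   *)
Definition Ind_fibre (x : X) : lmodType C := dsum (fun c => bfibre E c x).

(* The topology is the one of the fibre product over X, indexed by c in G/H,  *)
(* of the restrictions of G x_H E to {c} x X.                                 *)
Definition Ind_embed (s : {x & Ind_fibre x}) :
    X * prod_topology (fun _ : cosets H => balanced E) :=
  (projT1 s, fun c => bfibre_val ((projT2 s : dsum _) c)).

Lemma Ind_ext x y (s : Ind_fibre x) (t : Ind_fibre y) : x = y ->
  (forall c, (s : dsum _) c = (t : dsum _) c :> balanced E) ->
  existT Ind_fibre x s = existT Ind_fibre y t.
Proof.
by move=> xy; subst y => st; congr existT; apply: dsumP => c; exact: bfibreP.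
Qed.

Section Ind_act.
Variables (g : G) (x : X).

Fact Ind_act_finite (s : Ind_fibre x) : finite_set
  [set c | bfibre_act ((s : dsum _) (coset_act g^-1%g c)) != 0].
Proof.
apply: (@sub_finite_set _ _
  (coset_act g @` [set c | (s : dsum _) c != 0])); last first.
  by apply: finite_image; exact: dsum_finite.
move=> c /= sc0; exists (coset_act g^-1%g c).
  by apply: contraNN sc0 => /eqP ->; rewrite linear0.
by rewrite -coset_actM mulgV coset_act1.
Qed.

(* g' . [g, e] = [g' g, e] *)
Definition Ind_act (s : Ind_fibre x) : Ind_fibre (act g x) :=
  DSum (Ind_act_finite s).

Fact Ind_act_linear : linear Ind_act.
Proof. by move=> a s t; apply: dsumP => c; exact: linearP. Qed.

HB.instance Definition _ := GRing.isLinear.Build C (Ind_fibre x)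
  (Ind_fibre (act g x)) *:%R Ind_act Ind_act_linear.

End Ind_act.

Fact Ind_fact1 (h1 : whole G 1%g) x (s : Ind_fibre x) :
  existT Ind_fibre (act 1%g x) (Ind_act 1%g s) = existT Ind_fibre x s.
Proof.
apply: Ind_ext => [|c]; first exact: act1.
by rewrite /= bact1 invg1 coset_act1.
Qed.

Fact Ind_factM g h (Hg : whole G g) (Hh : whole G h)
    (Hgh : whole G (g * h)%g) x (s : Ind_fibre x) :
  existT Ind_fibre (act (g * h)%g x) (Ind_act (g * h)%g s) =
  existT Ind_fibre (act g (act h x)) (Ind_act g (Ind_act h s)).
Proof.
apply: Ind_ext => [|c]; first exact: actM.
by rewrite /= bactM invgM coset_actM.
Qed.

Definition Ind : gfamily C (whole G) X :=
  @GFamily C G (whole G) X Ind_fibre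
    (initial_open Ind_embed) (initial_openT Ind_embed)
    (@initial_openI _ _ Ind_embed) (@initial_open_bigcup _ _ Ind_embed)
    (fun g _ x => @Ind_act g x) Ind_fact1 Ind_factM.

End Ind.

Section bigoplus.
Context {C : numClosedFieldType} {G : topologicalGroupType} {H : subgroup G}.
Context {X : gspace G} {I : Type} (F : I -> gfamily C H X).

Definition bigoplus_fibre (x : X) : lmodType C := dsum (fun i => F i x).

Definition bigoplus_embed (s : {x & bigoplus_fibre x}) :
    X * prod_topology (fun i => total (F i)) :=
  (projT1 s, fun i => Total ((projT2 s : dsum _) i)).

Lemma bigoplus_ext x y (s : bigoplus_fibre x) (t : bigoplus_fibre y) : x = y ->
  (forall i, Total ((s : dsum _) i) = Total ((t : dsum _) i)) ->
  existT bigoplus_fibre x s = existT bigoplus_fibre y t.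
Proof.
move=> xy; subst y => st; congr existT; apply: dsumP => i.
exact: (@eq_from_Tagged X (fibre (F i)) _ _ _ (st i)).
Qed.

Definition bigoplus_act g (Hg : H g) x :
    {linear bigoplus_fibre x -> bigoplus_fibre (act g x)} :=
  dsum_map (fun i => @fact _ _ _ _ (F i) g Hg x).

Fact bigoplus_fact1 (h1 : H 1%g) x (s : bigoplus_fibre x) :
  existT bigoplus_fibre (act 1%g x) (bigoplus_act h1 x s) =
  existT bigoplus_fibre x s.
Proof. by apply: bigoplus_ext => [|i]; [exact: act1|exact: fact1]. Qed.

Fact bigoplus_factM g h (Hg : H g) (Hh : H h)
    (Hgh : H (g * h)%g) x (s : bigoplus_fibre x) :
  existT bigoplus_fibre (act (g * h)%g x) (bigoplus_act Hgh x s) =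
  existT bigoplus_fibre (act g (act h x))
    (bigoplus_act Hg (act h x) (bigoplus_act Hh x s)).
Proof. by apply: bigoplus_ext => [|i]; [exact: actM|exact: factM]. Qed.

Definition bigoplus : gfamily C H X :=
  @GFamily C G H X bigoplus_fibre
    (initial_open bigoplus_embed) (initial_openT bigoplus_embed)
    (@initial_openI _ _ bigoplus_embed) (@initial_open_bigcup _ _ bigoplus_embed)
    bigoplus_act bigoplus_fact1 bigoplus_factM.

End bigoplus.

Definition decomposition (C : numClosedFieldType) (G : topologicalGroupType)
    (A : normal_subgroup G) (S : set (irrep C A)) (X : gspace G)
    (AX : acts_trivially A X) (E : gfamily C (whole G) X) :
    gfamily C (whole G) X :=
  bigoplus (fun rho : set_type S => Ind (rep_homA AX E (val rho))).

Section rep_homA_map.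
Context {C : numClosedFieldType} {G : topologicalGroupType}.
Context {A : normal_subgroup G} {Y X : gspace G} {f : Y -> X}.
Variables (fG : equivariant f).
Variables (AY : acts_trivially A Y) (AX : acts_trivially A X).
Context {E' : gfamily C (whole G) Y} {E : gfamily C (whole G) X}.
Variables (m : gmap f E' E) (rho : irrep C A).

Section homA_map.
Variable y : Y.

Fact homA_map_subproof (phi : homA E' rho AY y) :
  @homA_pred _ _ _ _ E rho (f y) (fun v => m y (phi v)).
Proof.
apply/asboolP; split=> [c v w|a v Aa]; first by rewrite homA_linear linearP.
have := congr1 (tmap m) (homA_equiv phi v Aa).
by rewrite tmap_tact.
Qed.

Definition homA_map (phi : homA E' rho AY y) : homA E rho AX (f y) :=
  HomA AX (homA_map_subproof phi).

Fact homA_map_linear : linear homA_map.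
Proof. by move=> c phi psi; apply: homAP => v; exact: linearP. Qed.

HB.instance Definition _ := GRing.isLinear.Build C (homA E' rho AY y)
  (homA E rho AX (f y)) *:%R homA_map homA_map_linear.

(* v (x) phi |-> v (x) m o phi *)
Definition rep_homA_map_fun (t : rep_homA AY E' rho y) :
  rep_homA AX E rho (f y) := tens_map 1%:M homA_map t.

Fact rep_homA_map_linear : linear rep_homA_map_fun.
Proof. exact: tens_map_linear. Qed.

HB.instance Definition _ := GRing.isLinear.Build C (rep_homA AY E' rho y)
  (rep_homA AX E rho (f y)) *:%R rep_homA_map_fun rep_homA_map_linear.

End homA_map.

Lemma rep_homA_map_funE y (t : rep_homA AY E' rho y) i :
  (rep_homA_map_fun t : tens _ _) i = homA_map ((t : tens _ _) i).
Proof.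
rewrite ffunE (bigD1 i) //= big1 => [|k ki]; last first.
  by rewrite mxE eq_sym (negPf ki) scale0r.
by rewrite mxE eqxx scale1r addr0.
Qed.

Fact rep_homA_map_fact g (Hg : isotropy rho g) y (t : rep_homA AY E' rho y) :
  Total (rep_homA_map_fun (fact Hg y t)) =
  tact Hg (Total (rep_homA_map_fun t)).
Proof.
apply: rep_homA_ext => [|j v]; first exact: fG.
rewrite rep_homA_map_funE.
rewrite -[LHS]/(tmap m (Total ((rep_homA_act Hg t : tens _ _) j v))).
rewrite -[X in _ = Total X]/((rep_homA_act Hg (rep_homA_map_fun t) : tens _ _) j v).
rewrite !rep_homA_act_val /tmap /Total /= linear_sum.
elim/big_rec2: _ => [|i y1 y2 _ IH]; first by apply: existT_0; exact: fG.
rewrite linearZ; apply: existT_lin IH; rewrite rep_homA_map_funE.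
exact: (gmap_fact m (I : whole G g)).
Qed.

Definition rep_homA_map : gmap f (rep_homA AY E' rho) (rep_homA AX E rho) :=
  @GMap C G (isotropy rho) Y X f (rep_homA AY E' rho) (rep_homA AX E rho)
    (fun y => @rep_homA_map_fun y) rep_homA_map_fact.

End rep_homA_map.

Section Ind_map.
Context {C : numClosedFieldType} {G : topologicalGroupType} {H : subgroup G}.
Context {Y X : gspace G} {f : Y -> X} (fG : equivariant f).
Context {E' : gfamily C H Y} {E : gfamily C H X}.
Variable m : gmap f E' E.

Definition bmap (o : balanced E') : balanced E :=
  bclass (brepr o).1 (tmap m (brepr o).2).

Lemma bmapE g e : bmap (bclass g e) = bclass g (tmap m e).
Proof.
have /bclassP[h [Hh [rg eE]]] := breprK (bclass g e).
by rewrite /bmap rg (bclassM _ Hh) -tmap_tact -eE.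
Qed.

Lemma bmap_bact g o : bmap (bact g o) = bact g (bmap o).
Proof. by rewrite -(breprK o) bactE !bmapE bactE. Qed.

Section bfibre_map.
Variables (c : cosets H) (y : Y).

Fact bfibre_map_subproof (s : bfibre E' c y) : bproj (bmap s) = (c, f y).
Proof.
case: s => o /=; rewrite -(breprK o) bmapE !bprojE => -[-> <-].
by rewrite fG.
Qed.

(* [g, e] |-> [g, m e] *)
Definition bfibre_map (s : bfibre E' c y) : bfibre E c (f y) :=
  BFibre (bfibre_map_subproof s).

Fact bfibre_map_linear : linear bfibre_map.
Proof.
pose k := coset_repr c; have kc : coset H k = c := coset_reprK c.
have kx : f (act k^-1%g y) = act k^-1%g (f y) by exact: fG.
have [tr trE tr_lin] := fibre_transport E kx.
have mkE e : bfibre_map (bfibre_mk kc e) = bfibre_mk kc (tr (m _ e)).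
  by apply: bfibreP; rewrite /= bmapE trE.
move=> a s t; have [e <-] := bfibre_mk_ex kc s; have [e' <-] := bfibre_mk_ex kc t.
by rewrite -bfibre_mk_linear !mkE linearP tr_lin bfibre_mk_linear.
Qed.

HB.instance Definition _ := GRing.isLinear.Build C (bfibre E' c y)
  (bfibre E c (f y)) *:%R bfibre_map bfibre_map_linear.

End bfibre_map.

Definition Ind_map_fun (y : Y) : {linear Ind E' y -> Ind E (f y)} :=
  dsum_map (fun c => @bfibre_map c y).

Fact Ind_map_fact g (Hg : whole G g) y (s : Ind E' y) :
  Total (Ind_map_fun (act g y) (fact Hg y s)) =
  tact Hg (Total (Ind_map_fun y s)).
Proof.
by apply: Ind_ext => [|c]; [exact: fG|rewrite /= bmap_bact].
Qed.

Definition Ind_map : gmap f (Ind E') (Ind E) := GMap Ind_map_fact.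

End Ind_map.

Section bigoplus_map.
Context {C : numClosedFieldType} {G : topologicalGroupType} {H : subgroup G}.
Context {Y X : gspace G} {f : Y -> X} (fG : equivariant f) {I : Type}.
Context {F' : I -> gfamily C H Y} {F : I -> gfamily C H X}.
Variable m : forall i, gmap f (F' i) (F i).

Definition bigoplus_map_fun (y : Y) :
    {linear bigoplus F' y -> bigoplus F (f y)} :=
  dsum_map (fun i => m i y).

Fact bigoplus_map_fact g (Hg : H g) y (s : bigoplus F' y) :
  Total (bigoplus_map_fun (act g y) (fact Hg y s)) =
  tact Hg (Total (bigoplus_map_fun y s)).
Proof. by apply: bigoplus_ext => [|i]; [exact: fG|exact: gmap_fact]. Qed.

Definition bigoplus_map : gmap f (bigoplus F') (bigoplus F) :=
  GMap bigoplus_map_fact.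

End bigoplus_map.

Definition decomposition_map (C : numClosedFieldType)
    (G : topologicalGroupType) (A : normal_subgroup G) (S : set (irrep C A))
    (Y X : gspace G) (f : Y -> X) (fG : equivariant f)
    (AY : acts_trivially A Y) (AX : acts_trivially A X)
    (E' : gfamily C (whole G) Y) (E : gfamily C (whole G) X)
    (m : gmap f E' E) :
    gmap f (decomposition S AY E') (decomposition S AX E) :=
  bigoplus_map fG (fun rho : set_type S =>
    Ind_map fG (rep_homA_map fG AY AX m (val rho))).

(* Main.v *)
From HB Require Import structures.
Require Import Defs.
From mathcomp Require Import all_boot all_order all_algebra.
From mathcomp Require Import all_classical all_reals all_analysis.
From mathcomp Require Import complex ring lra.

(* On a compact group, uniform continuity and finite covers produce an        *)
(* invariant mean on continuous functions, hence complete reducibility and    *)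
(* the Schur orthogonality relations. In each fibre of E the evaluation map   *)
(* is therefore bijective, and every component of its inverse is an average   *)
(* over A against matrix coefficients of rho, so it is continuous on E. Near  *)
(* x0 only the finitely many summands that occur at x0 can occur: 1 minus the *)
(* sum of their projections is idempotent, so that its trace is a natural     *)
(* number, and it varies continuously and vanishes at x0. Thus the evaluation *)
(* map is locally a finite sum, it is a homeomorphism, and the direct sum is  *)
(* a bundle because E is one.                                                 *)

Set Implicit Arguments.
Unset Strict Implicit.
Unset Printing Implicit Defensive.

Import Order.TTheory GRing.Theory Num.Theory numFieldNormedType.Exports.

Local Open Scope classical_set_scope.
Local Open Scope ring_scope.

(** * Invariant means on compact groups *)

(** As A fixes X pointwise, each fibre of E is a finite-dimensional representation of A and is the
    sum of its isotypic parts; the sigma-part at x is the image of sigma (x) Hom_A(sigma, E_x) under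
    evaluation v (x) phi |-> phi(v). An element g carries the rho-part at g^-1 x onto the part of
    g.rho at x, and the orbit of rho is the coset space of its isotropy group. So the parts
    belonging to one orbit make up the fibre of an induced bundle, and [g, v (x) phi] |-> g phi(v)
    is bijective on fibres. This map is [Phi]; its formula makes it equivariant ([Phi_fact]) and
    natural ([Phi_natural]).

    The inverse [Psi] is explicit as well. The i-th component of the projection to the rho-part
    sends e to the homomorphism v |-> dim(rho) times the mean over A of (rho(a^-1) v)_i a e.
    [schur_orthogonality] and [schur_orthogonality_neq] show that this inverts evaluation on the
    rho-part and kills the others; [twist_surj] and [twist_inj] say that pairs of an orbit
    representative and a coset enumerate Irr(A) exactly once; [rep_semisimple] then yields that the
    projections add up to the identity ([sum_Psi_comp]).

    [Psi] is continuous because means over a compact group depend continuously on parameters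
    ([imean_continuous], [wmean_cvg]). [Phi] is a sum over possibly infinitely many summands, and
    its continuity rests on [Psi_comp_locally_finite]. The bundle structure of the source is then
    carried over from E by [is_gbundle_transfer]. *)

Section group_limits.
Context {G : topologicalGroupType} {T : Type} {F : set_system T}.
Context {FF : Filter F}.

Lemma cvg_mulg (f g : T -> G) (a b : G) :
  f @ F --> a -> g @ F --> b -> (fun x => f x * g x)%g @ F --> (a * b)%g.
Proof.
by move=> fa gb; apply: cvg_comp2 fa gb _; exact: (@mulg_continuous G (a, b)).
Qed.

Lemma cvg_invg (f : T -> G) (a : G) :
  f @ F --> a -> (fun x => (f x)^-1)%g @ F --> (a^-1)%g.
Proof. by move=> fa; apply: (cvg_comp _ _ fa); exact: invg_continuous. Qed.

End group_limits.

Section within_continuous.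
Context {T : topologicalType} (A : set T).

Lemma within_comp {S U : topologicalType} (B : set S) (h : T -> S) (f : S -> U) :
  (forall x, A x -> B (h x)) ->
  (forall x, A x -> h @ within A (nbhs x) --> h x) ->
  {within B, continuous f} -> {within A, continuous (fun x => f (h x))}.
Proof.
move=> AB hA /(subspace_continuousP B f) fB; apply/subspace_continuousP => x Ax.
apply: (@cvg_comp _ _ _ h f _ (within B (nbhs (h x)))); last exact: fB (AB x Ax).
move=> P /= PB; have := hA x Ax _ PB; rewrite /= /nbhs /=.
by apply: (@filterS _ (nbhs x)) => y Py Ay; exact: Py Ay (AB y Ay).
Qed.

Context {K : numFieldType}.

Lemma within_cst (c : K) : {within A, continuous (fun=> c)}.
Proof. by move=> x; exact: cvg_cst. Qed.

Lemma within_add (f g : T -> K) : {within A, continuous f} ->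
  {within A, continuous g} -> {within A, continuous (fun x => f x + g x)}.
Proof. by move=> fA gA x; apply: cvgD; [exact: fA|exact: gA]. Qed.

Lemma within_mul (f g : T -> K) : {within A, continuous f} ->
  {within A, continuous g} -> {within A, continuous (fun x => f x * g x)}.
Proof. by move=> fA gA x; apply: cvgM; [exact: fA|exact: gA]. Qed.

Lemma within_lin k (f g : T -> K) : {within A, continuous f} ->
  {within A, continuous g} -> {within A, continuous (fun x => k * f x + g x)}.
Proof. by move=> fA gA; apply: within_add => //; apply: within_mul => //; exact: within_cst. Qed.

Lemma within_sum (I : eqType) (r : seq I) (f : I -> T -> K) :
  (forall i, i \in r -> {within A, continuous (f i)}) ->
  {within A, continuous (fun x => \sum_(i <- r) f i x)}.
Proof.
elim: r => [|i r IH] fA.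
  rewrite (_ : (fun x => _) = fun=> 0); first exact: within_cst.
  by apply/funext => x; rewrite big_nil.
rewrite (_ : (fun x => _) = fun x => f i x + \sum_(i <- r) f i x).
  apply: within_add; first by apply: fA; rewrite mem_head.
  by apply: IH => j jr; apply: fA; rewrite inE jr orbT.
by apply/funext => x; rewrite big_cons.
Qed.

End within_continuous.

(** * Means of real functions as limits of finite averages *)

Section averages.
Context {R : realType} {G : topologicalGroupType} (A : subgroup G).
Implicit Types f g : G -> R.

Definition avg (s : seq G) (f : G -> R) : R :=
  (\sum_(a <- s) f a) / (size s)%:R.

(** Repetitions are allowed, so that the products of two samples form a sample and iterated averages
    are averages ([avg_allpairs]). *)
Definition sample (s : seq G) : Prop :=
  (0 < size s)%N /\ forall a, a \in s -> A a.

Lemma sample_size_gt0 s : sample s -> 0 < (size s)%:R :> R.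
Proof. by case=> s0 _; rewrite ltr0n. Qed.

Lemma avg_cst s c : sample s -> avg s (fun=> c) = c.
Proof.
move=> ss; rewrite /avg big_const_seq count_predT iter_addr_0 -[c *+ _]mulr_natr mulfK//.
by rewrite gt_eqF// sample_size_gt0.
Qed.

Lemma avg_lin s k f g : avg s (fun a => k * f a + g a) = k * avg s f + avg s g.
Proof. by rewrite /avg big_split -mulr_sumr /= mulrDl mulrA. Qed.

Lemma avgC s t (f : G -> G -> R) :
  avg s (fun a => avg t (f a)) = avg t (fun b => avg s (f^~ b)).
Proof.
rewrite /avg -!mulr_suml exchange_big /= -!mulrA; congr (_ * _); exact: mulrC.
Qed.

Lemma avg_le s f g : sample s -> (forall a, A a -> f a <= g a) ->
  avg s f <= avg s g.
Proof.
move=> ss fg; apply: ler_wpM2r; first by rewrite invr_ge0 ler0n.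
by rewrite big_seq [leRHS]big_seq; apply: ler_sum => a /(ss.2 a)/fg.
Qed.

Lemma avg_close s f c e : sample s -> (forall a, A a -> `|f a - c| <= e) ->
  `|avg s f - c| <= e.
Proof.
move=> ss fc; rewrite ler_distl -[c - e](avg_cst _ ss) -[c + e](avg_cst _ ss).
by apply/andP; split; apply: avg_le => // a /fc; rewrite ler_distl => /andP[].
Qed.

Lemma avg_allpairs s t (f : G -> R) :
  avg s (fun a => avg t (fun b => f (a * b)%g)) =
  avg [seq (a * b)%g | a <- s, b <- t] f.
Proof.
rewrite /avg big_allpairs_dep size_allpairs natrM invfM -mulr_suml -mulrA.
by rewrite [X in _ * X]mulrC.
Qed.

Lemma sample_allpairs s t : sample s -> sample t ->
  sample [seq (a * b)%g | a <- s, b <- t].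
Proof.
move=> [s0 sA] [t0 tA]; split; first by rewrite size_allpairs muln_gt0 s0.
by move=> _ /allpairsP[[a b] /= [/sA Aa /tA Ab ->]]; exact: subgroupM.
Qed.

(** The constant c is a uniform limit on A of averages of right translates of f, as in von Neumann's
    construction of the mean. *)
Definition right_approx (f : G -> R) (c : R) : Prop :=
  forall e, 0 < e -> exists2 s, sample s &
    forall x, A x -> `|avg s (fun a => f (x * a)%g) - c| <= e.

Definition left_approx (f : G -> R) (c : R) : Prop :=
  forall e, 0 < e -> exists2 s, sample s &
    forall x, A x -> `|avg s (fun a => f (a * x)%g) - c| <= e.

(** The double average of f (b * a) is close to c when a is averaged first and close to d when b is.
    This is the source of all uniqueness statements about the mean. *)
Lemma right_left_approx f c d : right_approx f c -> left_approx f d -> c = d.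
Proof.
move=> fc fd; apply/eqP; rewrite -subr_eq0 -normr_le0; apply/ler_addgt0Pr => e e0.
have e20 : 0 < e / 2 by rewrite divr_gt0.
have [s ss sc] := fc _ e20; have [t tt td] := fd _ e20.
pose z := avg t (fun b => avg s (fun a => f (b * a)%g)).
have zc : `|z - c| <= e / 2 by apply: avg_close => // b /sc.
have zd : `|z - d| <= e / 2 by rewrite /z avgC; apply: avg_close => // a /td.
rewrite add0r (splitr e) (le_trans (ler_distD z _ _))// lerD//.
by rewrite distrC.
Qed.

Lemma right_approx_inv f c :
  right_approx (fun x => f (x^-1)%g) c -> left_approx f c.
Proof.
move=> fc e /fc[s [s0 sA] sc]; exists (map (fun a => a^-1)%g s).
  split; first by rewrite size_map.
  by move=> _ /mapP[a /sA Aa ->]; exact: subgroupV.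
move=> x /subgroupV/sc; rewrite /avg big_map size_map.
rewrite (eq_bigr (fun a => f (a^-1 * x)%g)) // => a _.
by rewrite invgM invgK.
Qed.

Hypothesis Acompact : compact (A : set G).

(** The estimate holds for (x', v) near each (x, 1); the near-covering form of compactness makes it
    uniform in x. *)
Lemma uniform_continuity (f : G -> R) (e : R) : {within A, continuous f} ->
  0 < e -> \forall v \near nbhs (1%g : G),
    A v -> forall x, A x -> `|f (v * x)%g - f x| <= e.
Proof.
move=> fA e0.
pose P v x := A v -> A x -> `|f (v * x)%g - f x| <= e.
have := (compact_near_coveringP _).1 Acompact G (nbhs (1%g : G)) P _.
have aux : forall x, A x ->
    \forall x' \near x & v \near nbhs (1%g : G), P v x'.
  move=> x Ax; have e20 : 0 < e / 2 by rewrite divr_gt0.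
  have fx := (subspace_continuousP _ _).1 fA x Ax.
  have near_fx : \forall y \near x, A y -> `|f x - f y| <= e / 2.
    exact: (@cvgr_dist_le _ _ _ (within A (nbhs x)) _ f (f x) fx _ e20).
  have mulx : (fun p : G * G => (p.2 * p.1)%g) @ nbhs (x, 1%g : G) --> x.
    by rewrite -[X in _ --> X]mul1g; apply: cvg_mulg; [exact: cvg_snd|exact: cvg_fst].
  have H1 : \forall p \near nbhs (x, 1%g : G),
      A (p.2 * p.1)%g -> `|f x - f (p.2 * p.1)%g| <= e / 2.
    exact: (mulx _ near_fx).
  have H2 : \forall p \near nbhs (x, 1%g : G), A p.1 -> `|f x - f p.1| <= e / 2.
    exact: (@cvg_fst _ _ (nbhs x) (nbhs (1%g : G)) _ _ near_fx).
  apply: (@filterS2 _ (nbhs (x, 1%g : G)) _ _ _ _ _ H1 H2) => p h1 h2 Ap2 Ap1.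
  rewrite (splitr e) (le_trans (ler_distD (f x) _ _))// lerD ?h2//.
  by rewrite distrC h1//; exact: subgroupM.
move=> /(_ (nbhs_filter _) aux); apply: filterS => v Pv Av x Ax; exact: Pv.
Qed.

Lemma finite_cover (V : set G) : nbhs 1%g V -> exists2 s, sample s &
  forall x, A x -> exists b v, [/\ b \in s, A v, V v & x = (v * b)%g].
Proof.
(* In this filter a property is near when it holds for every list containing some fixed list. The
   near-covering form of compactness for it produces one finite list of centres that serves all of
   A. *)
move=> V1; pose F := filter_from (@setT (seq G)) (fun s => [set s' : seq G | {subset s <= s'}]).
have FF : Filter F.
  apply: filter_from_filter; first by exists [::].
  move=> s t _ _; exists (s ++ t) => // u /= stu.
  by split=> a ain; apply: stu; rewrite mem_cat ain ?orbT.
pose P (s : seq G) (x : G) := exists b v, [/\ b \in s, A b, V v & x = (v * b)%g].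
have cov x : A x -> \forall x' \near x & s \near F, P s x'.
  move=> Ax; exists ([set x' | V (x' * x^-1)%g], [set s : seq G | x \in s]) => /=.
    split; last by exists [:: x] => // s /=; apply; rewrite mem_head.
    have : (fun y => y * x^-1)%g @ x --> (1%g : G).
      by rewrite -[X in _ --> X](mulgV x); apply: cvg_mulg; [exact: cvg_id|exact: cvg_cst].
    by move=> /(_ _ V1).
  by move=> [x' s] /= [Vx xs]; exists x, (x' * x^-1)%g; rewrite mulgVK.
have [s _ sP] := (compact_near_coveringP _).1 Acompact _ F P FF cov.
have {sP}sP x : A x -> P s x by exact: (sP s (fun=> id)).
exists [seq b <- s | `[< A b >]].
  split; last by move=> a; rewrite mem_filter => /andP[/asboolP].
  have [b [v [bs Ab _ _]]] := sP _ (subgroup1 A).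
  rewrite size_filter -has_count; apply/hasP; exists b => //; exact/asboolP.
move=> x Ax; have [b [v [bs Ab Vv xE]]] := sP x Ax; exists b, v; split => //.
  by rewrite mem_filter bs andbT; exact/asboolP.
have -> : v = (x * b^-1)%g by rewrite xE mulgK.
by apply: subgroupM => //; exact: subgroupV.
Qed.

Lemma compact_bounded (f : G -> R) : {within A, continuous f} ->
  exists B, forall x, A x -> `|f x| <= B.
Proof.
move=> fA; have [s ss cov] := finite_cover (uniform_continuity fA ltr01).
exists (1 + \sum_(b <- s) `|f b|) => x Ax.
have [b [v [bs Av Vv ->]]] := cov x Ax; have Ab := ss.2 _ bs.
rewrite -[X in `|X|](subrK (f b)) (le_trans (ler_normD _ _))// lerD//; first exact: Vv.
by rewrite (big_rem b)//= lerDl sumr_ge0.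
Qed.

(** The least upper bound that averaging right translates can achieve in the limit. For continuous f
    it is the normalized Haar integral over A. *)
Definition mean (f : G -> R) : R :=
  inf [set m | exists2 s, sample s &
                 forall x, A x -> avg s (fun a => f (x * a)%g) <= m].

(* Let g be an average of right translates of f whose upper bound is close to *)
(* the infimum. If g were small at x, then averaging the translates of g by a *)
(* fine net of A would push the upper bound below the infimum.                *)
Lemma right_approx_mean (f : G -> R) : {within A, continuous f} -> right_approx f (mean f).
Proof.
move=> fA; set U := [set m | exists2 s, sample s &
    forall x, A x -> avg s (fun a => f (x * a)%g) <= m]; have [B fB] := compact_bounded fA.
have s1 : sample [:: 1%g] by split=> // a; rewrite inE => /eqP ->; exact: subgroup1.
have U_lb m : U m -> - B <= m.
  move=> [s ss /(_ _ (subgroup1 A))]; apply: le_trans.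
  rewrite -[leLHS](avg_cst _ ss); apply: avg_le => // a Aa.
  by rewrite mul1g lerNl (le_trans _ (fB a Aa))// -normrN ler_norm.
have Uinf : has_inf U.
  split; last by exists (- B) => m /U_lb.
  exists B, [:: 1%g] => // x Ax; rewrite /avg big_seq1 mulg1 divr1.
  exact: le_trans (ler_norm _) (fB x Ax).
have Ule m : U m -> mean f <= m by move=> Um; apply: ge_inf => //; case: Uinf.
move=> e3 e30; have {}e30 : 0 < e3 :> R by []; pose e := e3 / 3.
have e0 : 0 < e by rewrite divr_gt0.
have [t tt cov] := finite_cover (uniform_continuity fA e0).
pose n : R := (size t)%:R; have n0 : 0 < n := sample_size_gt0 tt.
(* The margin is chosen for an average of n terms: one term below [mean f - 2e] outweighs n - 1
   terms that exceed [mean f] by at most e / n, and the average falls below [mean f - e / n]. *)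
have en0 : 0 < e / n by rewrite divr_gt0.
have [m [s ss sm] mlt] := inf_adherent en0 Uinf.
pose g x := avg s (fun a => f (x * a)%g).
have gle x : A x -> g x <= mean f + e / n by move=> /sm/le_trans; apply; exact: ltW.
have n1 : 1 <= n by rewrite ler1n; case: tt.
have enle : e / n <= e by rewrite ler_pdivrMr// ler_peMr// ltW.
exists s => // x Ax; rewrite ler_distl; apply/andP; split; last first.
  apply: le_trans (gle x Ax) _; rewrite lerD2l (le_trans enle)//.
  by rewrite /e; lra.
rewrite leNgt; apply/negP => gx; rewrite -/(g x) in gx.
suff /Ule : U (mean f - e / n) by move: en0; lra.
(* For y = v b with v small, the translate by b^-1 x evaluates g at v x, which is within e of the
   small value g x. *)
exists [seq (c * a)%g | c <- [seq (b^-1 * x)%g | b <- t], a <- s].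
  apply: sample_allpairs => //; split; first by rewrite size_map; case: tt.
  move=> _ /mapP[b /(tt.2 b) Ab ->]; apply: subgroupM => //; exact: subgroupV.
move=> y Ay; rewrite -avg_allpairs {1}/avg big_map size_map -/n.
rewrite (eq_bigr (fun b => g (y * (b^-1 * x))%g)) => [|b _]; last first.
  by congr avg; apply/funext => a; rewrite !mulgA.
rewrite ler_pdivrMr//.
have [b [v [bt Av Vv yE]]] := cov y Ay; have Ab := tt.2 _ bt.
have gb : g (y * (b^-1 * x))%g <= g x + e.
  rewrite yE !mulgA mulgK -[g (v * x)%g](subrK (g x)) [leRHS]addrC lerD2r.
  rewrite /g /avg -mulrBl -sumrB -[leRHS](avg_cst _ ss).
  apply: (@avg_le s (fun a => f (v * x * a)%g - f (x * a)%g)) => // a Aa.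
  by rewrite (le_trans (ler_norm _))// -mulgA; apply: Vv => //; exact: subgroupM.
rewrite (big_rem b)//=.
apply: le_trans (_ : (g x + e) + \sum_(b <- rem b t) (mean f + e / n) <= _).
  apply: lerD => //; rewrite big_seq [leRHS]big_seq; apply: ler_sum => c /mem_rem ct.
  apply: gle; apply: subgroupM => //; apply: subgroupM => //; apply: subgroupV.
  exact: tt.2.
rewrite big_const_seq count_predT iter_addr_0 size_rem// -mulr_natr.
have -> : (size t).-1%:R = n - 1 :> R.
  by rewrite /n -(prednK tt.1) /= -natr1 addrK.
have nE : e / n * n = e by rewrite divfK// gt_eqF.
rewrite mulrBr mulr1 mulrDl mulrBl nE.
have e3E : e3 = e + e + e by rewrite /e; lra.
move: gx en0; rewrite e3E; move: (e / n) (mean f * n) (g x) (mean f) => ? ? ? ?; lra.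
Qed.

(** Through inversion f also has a left approximable constant, and it agrees with every right
    approximable one. *)
Lemma mean_right f c : {within A, continuous f} -> right_approx f c -> mean f = c.
Proof.
move=> fA fc; have fiA : {within A, continuous (fun x => f (x^-1)%g)}.
  by apply: within_comp fA => [x /subgroupV//|x Ax]; apply: cvg_invg; exact: cvg_within.
have fl := right_approx_inv (right_approx_mean fiA).
by rewrite (right_left_approx fc fl) (right_left_approx (right_approx_mean fA) fl).
Qed.

Lemma mean_left f c : {within A, continuous f} -> left_approx f c -> mean f = c.
Proof. by move=> fA; exact/right_left_approx/right_approx_mean. Qed.

Lemma left_approx_mean f : {within A, continuous f} -> left_approx f (mean f).
Proof.
move=> fA; have fiA : {within A, continuous (fun x => f (x^-1)%g)}.
  by apply: within_comp fA => [x /subgroupV//|x Ax]; apply: cvg_invg; exact: cvg_within.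
have fl := right_approx_inv (right_approx_mean fiA).
by rewrite (mean_left fA fl).
Qed.

Lemma mean_cst c : mean (fun=> c) = c.
Proof.
apply: mean_right => [|e e0]; first exact: cst_continuous.
exists [:: 1%g] => [|x Ax]; last by rewrite /avg big_seq1 divr1 subrr normr0 ltW.
by split=> // a; rewrite inE => /eqP ->; exact: subgroup1.
Qed.

Lemma eq_mean f g : (forall a, A a -> f a = g a) -> mean f = mean g.
Proof.
move=> fg; rewrite /mean; congr inf; apply/seteqP; split=> m [s ss sm];
  exists s => // x Ax; rewrite (le_trans _ (sm x Ax))//;
  by apply: avg_le => // a Aa; rewrite fg//; exact: subgroupM.
Qed.

(** One sample must serve f and g at once: s makes f nearly constant, t does the same for the
    s-average g' of g, and the product sample works for both. Left averages show that g' has the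
    mean of g. *)
Lemma mean_lin k f g : {within A, continuous f} -> {within A, continuous g} ->
  mean (fun a => k * f a + g a) = k * mean f + mean g.
Proof.
move=> fA gA; apply: mean_right; first by apply: within_lin.
move=> e e0; have k0 : 0 < `|k| + 1 by rewrite ltr_wpDl.
have e20 : 0 < e / 2 by rewrite divr_gt0.
(* Adding 1 to [|k|] keeps the divisor nonzero when k = 0. *)
have d0 : 0 < e / 2 / (`|k| + 1) by rewrite divr_gt0.
have [s ss sf] := right_approx_mean fA d0.
pose g' x := avg s (fun a => g (x * a)%g).
have g'A : {within A, continuous g'}.
  apply: within_mul; last exact: within_cst.
  apply: within_sum => a aS; apply: within_comp gA => [x Ax|x Ax].
    by apply: subgroupM => //; exact: ss.2.
  by apply: cvg_mulg; [exact: cvg_within|exact: cvg_cst].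
have g'g : mean g' = mean g.
  apply: (right_left_approx (right_approx_mean g'A)) => d /(left_approx_mean gA)[t tt tg].
  exists t => // x Ax; rewrite avgC; apply: avg_close => // a Aa.
  rewrite (_ : (fun b => _) = fun b => g (b * (x * a))%g).
    by apply: tg; exact: subgroupM.
  by apply/funext => b; rewrite mulgA.
have [t tt tg] := right_approx_mean g'A e20.
exists [seq (a * b)%g | a <- t, b <- s]; first exact: sample_allpairs.
move=> x Ax; rewrite -avg_allpairs.
set F := fun y => avg s (fun a => f (y * a)%g).
have -> : avg t (fun a => avg s (fun b => k * f (x * (a * b))%g + g (x * (a * b))%g)) =
    k * avg t (fun a => F (x * a)%g) + avg t (fun a => g' (x * a)%g).
  rewrite -avg_lin; congr avg; apply/funext => a; rewrite -avg_lin.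
  by congr avg; apply/funext => b; rewrite mulgA.
rewrite opprD addrACA -mulrBr (splitr e) (le_trans (ler_normD _ _))// lerD//; last first.
  by rewrite -g'g; exact: tg.
have Fm : `|avg t (fun a => F (x * a)%g) - mean f| <= e / 2 / (`|k| + 1).
  by apply: avg_close => // a Aa; apply: sf; exact: subgroupM.
rewrite normrM -[leRHS](divfK (lt0r_neq0 k0)) mulrC.
by rewrite ler_pM// ler_wpDr.
Qed.

Lemma mean_translate b f : A b -> {within A, continuous f} ->
  mean (fun a => f (b * a)%g) = mean f.
Proof.
move=> Ab fA; apply: mean_right.
  apply: within_comp fA => [x Ax|x Ax]; first exact: subgroupM.
  by apply: cvg_mulg; [exact: cvg_cst|exact: cvg_within].
move=> e /(right_approx_mean fA)[s ss sf]; exists s => // x Ax.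
rewrite (_ : (fun a => _) = fun a => f (b * x * a)%g).
  by apply: sf; exact: subgroupM.
by apply/funext => a; rewrite mulgA.
Qed.

Lemma mean_ge f c : {within A, continuous f} -> (forall a, A a -> c <= f a) ->
  c <= mean f.
Proof.
move=> fA fc; apply/ler_addgt0Pr => e /(right_approx_mean fA)[s ss].
move=> /(_ _ (subgroup1 A)); rewrite ler_distl => /andP[_]; apply: le_trans.
rewrite -[leLHS](avg_cst _ ss); apply: avg_le => // a Aa.
by rewrite mul1g fc.
Qed.

Lemma mean_norm_le f c : {within A, continuous f} ->
  (forall a, A a -> `|f a| <= c) -> `|mean f| <= c.
Proof.
move=> fA fc; rewrite -[mean f]subr0; apply/ler_addgt0Pr => e.
move=> /(right_approx_mean fA)[s ss /(_ _ (subgroup1 A)) se].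
rewrite (le_trans (ler_distD (avg s (fun a => f (1 * a)%g)) _ _))// addrC lerD//.
  by apply: avg_close => // a Aa; rewrite mul1g subr0 fc.
by rewrite distrC.
Qed.

(** By compactness the continuous function 1 / f is bounded, so f stays above a positive
    constant. *)
Lemma mean_gt0 f : {within A, continuous f} -> (forall a, A a -> 0 < f a) ->
  0 < mean f.
Proof.
move=> fA f0; have ifA : {within A, continuous (fun a => (f a)^-1)}.
  rewrite subspace_continuousP => a Aa; apply: cvgV; first by rewrite gt_eqF ?f0.
  by move: fA; rewrite subspace_continuousP; exact.
have [B fB] := compact_bounded ifA.
have B0 : 0 < B.
  apply: lt_le_trans (fB _ (subgroup1 A)); rewrite normr_gt0 invr_neq0//.
  by rewrite gt_eqF// f0//; exact: subgroup1.
rewrite (@lt_le_trans _ _ B^-1) ?invr_gt0//; apply: mean_ge => // a Aa.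
rewrite -[leRHS]invrK lef_pV2 ?posrE ?invr_gt0 ?f0//.
exact: le_trans (ler_norm _) (fB a Aa).
Qed.

End averages.

(* The factor 2 comes from averaging real and imaginary parts separately. *)
Record invariant_mean (C : numClosedFieldType) (G : topologicalGroupType)
    (A : subgroup G) := InvariantMean {
  imean :> (G -> C) -> C;
  eq_imean : forall f g : G -> C, (forall a, A a -> f a = g a) ->
    imean f = imean g;
  imean_cst : forall c, imean (fun=> c) = c;
  imean_lin : forall k (f g : G -> C), {within A, continuous f} ->
    {within A, continuous g} ->
    imean (fun a => k * f a + g a) = k * imean f + imean g;
  imean_translate : forall b (f : G -> C), A b -> {within A, continuous f} ->
    imean (fun a => f (b * a)%g) = imean f;
  imean_norm_le : forall (f : G -> C) c, {within A, continuous f} ->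
    (forall a, A a -> `|f a| <= c) -> `|imean f| <= c *+ 2;
  imean_gt0 : forall f : G -> C, {within A, continuous f} ->
    (forall a, A a -> 0 < f a) -> 0 < imean f
}.

Section complex_mean.
Context {R : realType} {G : topologicalGroupType} (A : subgroup G).
Let C : numClosedFieldType := R[i].
Implicit Types f g : G -> C.

Let re (z : C) : R := complex.Re z.
Let im (z : C) : R := complex.Im z.

Let normc_ge_re (z : C) (c : R) : `|z| <= c%:C%C -> `|re z| <= c.
Proof. by move=> /(le_trans (normc_ge_Re z)); rewrite lecR. Qed.

Let normCi : `|'i%C : R[i]| = 1.
Proof. by rewrite normc_def /= expr0n expr1n add0r sqrtr1. Qed.

Let normc_ge_im (z : C) (c : R) : `|z| <= c%:C%C -> `|im z| <= c.
Proof.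
have -> : im z = - re (z * 'i%C).
  by case: (z : R[i]) => a b; rewrite /re /im /= mulr0 mulr1 sub0r opprK.
by move=> zc; rewrite normrN; apply: normc_ge_re; rewrite normrM normCi mulr1.
Qed.

Let re_continuous : continuous re.
Proof.
move=> z; apply/(@cvgrPdist_le R R C (nbhs z) (nbhs_filter z)) => e e0.
have e0C : 0 < e%:C%C :> C by rewrite ltcR.
have := @cvgr_dist_le C C C (nbhs z) (nbhs_filter z) id z cvg_id _ e0C.
by apply: filterS => w; rewrite -raddfB; exact: normc_ge_re.
Qed.

Let im_continuous : continuous im.
Proof.
move=> z; apply/(@cvgrPdist_le R R C (nbhs z) (nbhs_filter z)) => e e0.
have e0C : 0 < e%:C%C :> C by rewrite ltcR.
have := @cvgr_dist_le C C C (nbhs z) (nbhs_filter z) id z cvg_id _ e0C.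
by apply: filterS => w; rewrite -raddfB; exact: normc_ge_im.
Qed.

Let within_re f : {within A, continuous f} -> {within A, continuous (re \o f)}.
Proof. by move=> fA x; apply: cvg_comp (fA x) _; exact: re_continuous. Qed.

Let within_im f : {within A, continuous f} -> {within A, continuous (im \o f)}.
Proof. by move=> fA x; apply: cvg_comp (fA x) _; exact: im_continuous. Qed.

Hypothesis Acompact : compact (A : set G).

Definition complex_mean f : C := (mean A (re \o f) +i* mean A (im \o f))%C.

Lemma eq_complex_mean f g : (forall a, A a -> f a = g a) ->
  complex_mean f = complex_mean g.
Proof. by move=> fg; congr Complex; apply: eq_mean => a /fg /= ->. Qed.

Lemma complex_mean_cst c : complex_mean (fun=> c) = c.
Proof. by rewrite /complex_mean !mean_cst; case: (c : R[i]). Qed.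

Lemma complex_mean_lin k f g : {within A, continuous f} ->
  {within A, continuous g} ->
  complex_mean (fun a => k * f a + g a) = k * complex_mean f + complex_mean g.
Proof.
move=> fA gA; have [[[fr fi] gr] gi] := (within_re fA, within_im fA, within_re gA, within_im gA).
case: k => k l; rewrite /complex_mean; congr Complex => /=.
  rewrite (@eq_mean _ _ _ _ (fun a => k * re (f a) + (- l * im (f a) + re (g a)))).
    rewrite mean_lin//; last exact: within_lin.
    by rewrite mean_lin// mulNr addrA.
  by move=> a _ /=; case: (f a) (g a) => [a1 a2] [b1 b2] /=; rewrite /re /im /= mulNr addrA.
rewrite (@eq_mean _ _ _ _ (fun a => k * im (f a) + (l * re (f a) + im (g a)))).
  rewrite mean_lin//; last exact: within_lin.
  by rewrite mean_lin// addrA.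
by move=> a _ /=; case: (f a) (g a) => [a1 a2] [b1 b2] /=; rewrite /re /im /= addrA.
Qed.

Lemma complex_mean_translate b f : A b -> {within A, continuous f} ->
  complex_mean (fun a => f (b * a)%g) = complex_mean f.
Proof.
move=> Ab fA; rewrite /complex_mean; congr Complex.
  exact: (mean_translate Acompact Ab (within_re fA)).
exact: (mean_translate Acompact Ab (within_im fA)).
Qed.

Lemma complex_mean_norm_le f c : {within A, continuous f} ->
  (forall a, A a -> `|f a| <= c) -> `|complex_mean f| <= c *+ 2.
Proof.
move=> fA fc; have c0 : 0 <= c := le_trans (normr_ge0 _) (fc _ (subgroup1 A)).
have cE : c = (re c)%:C%C by apply/esym; exact: RRe_real (ger0_real c0).
rewrite [complex_mean f]complexE (le_trans (ler_normD _ _))// normrM normCi mul1r.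
have normC (x : R) : `|x%:C%C : R[i]| = `|x|%:C%C.
  by rewrite normc_def /= expr0n addr0 sqrtr_sqr.
rewrite !normC mulr2n lerD// cE lecR.
  by apply: mean_norm_le (within_re fA) _ => // a /fc; rewrite cE; exact: normc_ge_re.
by apply: mean_norm_le (within_im fA) _ => // a /fc; rewrite cE; exact: normc_ge_im.
Qed.

Lemma complex_mean_gt0 f : {within A, continuous f} ->
  (forall a, A a -> 0 < f a) -> 0 < complex_mean f.
Proof.
move=> fA f0; rewrite ltcE /=; apply/andP; split.
  rewrite (@eq_mean _ _ _ _ (fun=> 0)) ?mean_cst// => a /f0.
  by rewrite ltcE => /andP[/eqP].
by apply: mean_gt0 (within_re fA) _ => // a /f0; rewrite ltcE => /andP[].
Qed.

Definition complex_invariant_mean : invariant_mean C A :=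
  InvariantMean eq_complex_mean complex_mean_cst complex_mean_lin
    complex_mean_translate complex_mean_norm_le complex_mean_gt0.

End complex_mean.

(** * Representations of compact groups *)

Lemma cvg_mx {K : topologicalType} {T : Type} {F : set_system T} {FF : Filter F}
    {m n} (f : T -> 'M[K]_(m, n)) (N : 'M[K]_(m, n)) :
  (forall i j, (fun x => f x i j) @ F --> N i j) -> f @ F --> N.
Proof.
move=> fN P [Q NQ QP]; have : \forall x \near F, forall i j, Q i j (f x i j).
  by apply: filter_forall => i; apply: filter_forall => j; exact: fN (NQ i j).
by apply: filterS => x /QP.
Qed.

Lemma cvg_entry {K : numFieldType} {T : Type} {F : set_system T} {FF : Filter F}
    {m n} (f : T -> 'M[K]_(m, n)) (N : 'M[K]_(m, n)) i j :
  f @ F --> N -> (fun x => f x i j) @ F --> N i j.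
Proof.
move=> fN; apply: (@cvg_comp _ _ _ f (fun N : 'M[K]_(m, n) => N i j) _ (nbhs N)) => //.
exact: coord_continuous.
Qed.

Lemma cvg_conjC {K : numClosedFieldType} {T : Type} {F : set_system T}
    {FF : Filter F} (f : T -> K) (z : K) :
  f @ F --> z -> (fun x => (f x)^*) @ F --> z^*.
Proof.
move=> /cvgrPdist_le fz; apply/cvgrPdist_le => e /fz; apply: filterS => x.
by rewrite -rmorphB norm_conjC.
Qed.

Lemma linear_fun0 {K : nzRingType} {V W : lmodType K} (f : V -> W) :
  linear f -> f 0 = 0.
Proof. by move=> /(_ (-1) 0 0); rewrite scaler0 addr0 scaleN1r addNr. Qed.

Lemma eq_mulmx_col {K : comNzRingType} {m n} (N N' : 'M[K]_(m, n)) :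
  (forall v : 'cV_n, N *m v = N' *m v) -> N = N'.
Proof.
move=> NN; apply/matrixP => i j; have /colP/(_ i) := NN (delta_mx j 0).
by rewrite -!colE !mxE.
Qed.

(** With P = C R the rank factorization, C R C R = C R can be cancelled on both sides. *)
Lemma idempotent_row_col_base {K : fieldType} n (P : 'M[K]_n) : P *m P = P ->
  row_base P *m col_base P = 1%:M.
Proof.
move=> PP; have CR := mulmx_base P.
apply: (row_full_inj (col_base_full P)); apply: (row_free_inj (row_base_free P)).
by rewrite mulmx1 mulmxA CR -mulmxA CR PP.
Qed.

(** The trace of an idempotent is thus a natural number, so in characteristic 0 an idempotent whose
    trace is smaller than 1 vanishes. *)
Lemma mxtrace_idempotent {K : fieldType} n (P : 'M[K]_n) :
  P *m P = P -> \tr P = (\rank P)%:R.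
Proof.
move=> PP; rewrite -{1}(mulmx_base P) mxtrace_mulC.
by rewrite idempotent_row_col_base// mxtrace1.
Qed.

Lemma linear_col_mx {K : comNzRingType} {m n} (f : 'cV[K]_n -> 'cV[K]_m) :
  linear f -> exists T : 'M[K]_(m, n), forall v, f v = T *m v.
Proof.
move=> f_lin; pose F : {linear 'cV[K]_n -> 'cV[K]_m} :=
  HB.pack f (GRing.isLinear.Build K _ _ *:%R f f_lin).
exists (\matrix_(i, j) f (delta_mx j 0) i 0) => v.
rewrite {1}[v]matrix_sum_delta -[LHS]/(F _) linear_sum /=.
apply/colP => i; rewrite summxE mxE; apply: eq_bigr => j _.
by rewrite big_ord1 -[f _]/(F _) linearZ /= !mxE mulrC; congr (_ * _).
Qed.

Lemma col_norm_gt0 {C : numClosedFieldType} n (v : 'cV[C]_n) : v != 0 ->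
  0 < (v ^t* *m v)%sesqui 0 0.
Proof.
move=> v0; have [i vi] : exists i, v i 0 != 0.
  by apply/existsP; apply: contraNT v0 => /existsPn v0; apply/eqP/colP => i;
     rewrite mxE; apply/eqP; have := v0 i; rewrite negbK.
have vv k : 0 <= (v ^t*)%sesqui 0 k * v k 0 by rewrite !mxE mulrC mul_conjC_ge0.
rewrite mxE (bigD1 i)//= ltr_pwDl//; last by apply: sumr_ge0.
by rewrite !mxE mulrC mul_conjC_gt0.
Qed.

Section matrix_mean.
Context {C : numClosedFieldType} {G : topologicalGroupType} {A : subgroup G}.
Variable M : invariant_mean C A.

Lemma imean_sum (I : eqType) (r : seq I) (c : I -> C) (f : I -> G -> C) :
  (forall i, {within A, continuous (f i)}) ->
  M (fun a => \sum_(i <- r) c i * f i a) = \sum_(i <- r) c i * M (f i).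
Proof.
move=> fA; elim: r => [|i r IH].
  by rewrite big_nil -[RHS](imean_cst M); apply: eq_imean => a _; rewrite big_nil.
rewrite big_cons -IH -imean_lin //.
  by apply: eq_imean => a _; rewrite big_cons.
by apply: within_sum => j _; apply: within_mul => //; exact: within_cst.
Qed.

Definition mxcont m n (F : G -> 'M[C]_(m, n)) : Prop :=
  forall i j, {within A, continuous (fun a => F a i j)}.

Lemma mxcontP m n (F : G -> 'M[C]_(m, n)) :
  mxcont F <-> {within A, continuous F}.
Proof.
split=> FA; last by move=> i j x; apply: cvg_entry; exact: FA.
by move=> x; apply: cvg_mx => i j; exact: FA.
Qed.

Lemma mxcont_cst m n (N : 'M[C]_(m, n)) : mxcont (fun=> N).
Proof. by move=> i j; exact: within_cst. Qed.

Lemma mxcont_mul m n p (F : G -> 'M[C]_(m, n)) (F' : G -> 'M[C]_(n, p)) :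
  mxcont F -> mxcont F' -> mxcont (fun a => F a *m F' a).
Proof.
move=> FA FA' i j; under eq_fun do rewrite mxE.
by apply: within_sum => k _; exact: within_mul.
Qed.

Lemma mxcont_scale m n (r : G -> C) (F : G -> 'M[C]_(m, n)) :
  {within A, continuous r} -> mxcont F -> mxcont (fun a => r a *: F a).
Proof.
by move=> rA FA i j; under eq_fun do rewrite mxE; exact: within_mul.
Qed.

Lemma mxcont_inv m n (F : G -> 'M[C]_(m, n)) : mxcont F ->
  mxcont (fun a => F (a^-1)%g).
Proof.
move=> FA i j; apply: within_comp (FA i j) => [a|a Aa]; first exact: subgroupV.
by apply: cvg_invg; exact: cvg_within.
Qed.

Lemma mxcont_translate m n b (F : G -> 'M[C]_(m, n)) : A b -> mxcont F ->
  mxcont (fun a => F (b * a)%g).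
Proof.
move=> Ab FA i j; apply: within_comp (FA i j) => [a|a Aa]; first exact: subgroupM.
by apply: cvg_mulg; [exact: cvg_cst|exact: cvg_within].
Qed.

Lemma mxcont_trmxC m n (F : G -> 'M[C]_(m, n)) : mxcont F ->
  mxcont (fun a => (F a ^t*)%sesqui).
Proof.
move=> FA i j; under eq_fun do rewrite !mxE.
by move=> a; apply: cvg_conjC; exact: FA.
Qed.

Definition mxmean m n (F : G -> 'M[C]_(m, n)) : 'M[C]_(m, n) :=
  \matrix_(i, j) M (fun a => F a i j).

Lemma eq_mxmean m n (F F' : G -> 'M[C]_(m, n)) :
  (forall a, A a -> F a = F' a) -> mxmean F = mxmean F'.
Proof.
by move=> FF'; apply/matrixP => i j; rewrite !mxE; apply: eq_imean => a /FF' ->.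
Qed.

Lemma mxmean_cst m n (N : 'M[C]_(m, n)) : mxmean (fun=> N) = N.
Proof. by apply/matrixP => i j; rewrite mxE imean_cst. Qed.

Lemma mxmean_mull m n p (B : 'M[C]_(p, m)) (F : G -> 'M[C]_(m, n)) : mxcont F ->
  mxmean (fun a => B *m F a) = B *m mxmean F.
Proof.
move=> FA; apply/matrixP => i j; rewrite !mxE.
under [RHS]eq_bigr do rewrite mxE; rewrite -imean_sum//.
by apply: eq_imean => a _; rewrite mxE.
Qed.

Lemma mxmean_mulr m n p (B : 'M[C]_(n, p)) (F : G -> 'M[C]_(m, n)) : mxcont F ->
  mxmean (fun a => F a *m B) = mxmean F *m B.
Proof.
move=> FA; apply/matrixP => i j; rewrite !mxE.
under [RHS]eq_bigr do rewrite mxE mulrC; rewrite -imean_sum//.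
by apply: eq_imean => a _; rewrite mxE; apply: eq_bigr => k _; rewrite mulrC.
Qed.

Lemma mxmean_lin m n (k : C) (F F' : G -> 'M[C]_(m, n)) : mxcont F -> mxcont F' ->
  mxmean (fun a => k *: F a + F' a) = k *: mxmean F + mxmean F'.
Proof.
move=> FA FA'; apply/matrixP => i j; rewrite !mxE -imean_lin//.
by apply: eq_imean => a _; rewrite !mxE.
Qed.

Lemma mxmean_translate m n b (F : G -> 'M[C]_(m, n)) : A b -> mxcont F ->
  mxmean (fun a => F (b * a)%g) = mxmean F.
Proof.
move=> Ab FA; apply/matrixP => i j; rewrite !mxE.
exact: (@imean_translate _ _ _ M b (fun a => F a i j)).
Qed.

Lemma mxtrace_mxmean n (F : G -> 'M[C]_n) : mxcont F ->
  \tr (mxmean F) = M (fun a => \tr (F a)).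
Proof.
move=> FA; rewrite /mxtrace.
rewrite (@eq_imean _ _ _ M _ (fun a => \sum_i 1 * F a i i)) => [|a _]; last first.
  by apply: eq_bigr => i _; rewrite mul1r.
by rewrite imean_sum//; apply: eq_bigr => i _; rewrite mul1r mxE.
Qed.

(** The value at 1 is prescribed because multiplicativity alone would only make it an idempotent. No
    unitarity is assumed, since the fibres of E carry no metric. *)
Definition is_rep n (al : G -> 'M[C]_n) : Prop :=
  [/\ al 1%g = 1%:M,
      forall a b, A a -> A b -> al (a * b)%g = al a *m al b & mxcont al].

Lemma rep_mulV n (al : G -> 'M[C]_n) a : is_rep al -> A a ->
  al a *m al (a^-1)%g = 1%:M.
Proof.
by move=> [al1 alM _] Aa; rewrite -alM ?mulgV//; exact: subgroupV.
Qed.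

Lemma rep_Vmul n (al : G -> 'M[C]_n) a : is_rep al -> A a ->
  al (a^-1)%g *m al a = 1%:M.
Proof.
by move=> [al1 alM _] Aa; rewrite -alM ?mulVg//; exact: subgroupV.
Qed.

Lemma irrep_is_rep (rho : irrep C A) : is_rep rho.
Proof.
split; last by apply/mxcontP; exact: irrep_continuous.
  have A1 := subgroup1 A; have /unitarymx_unit U1 := irrep_unitary rho A1.
  by have := mulVmx U1; rewrite -{2}(mulg1 1%g) irrepM// mulKmx.
exact: irrepM.
Qed.

Definition intertwines m n (al : G -> 'M[C]_m) (be : G -> 'M[C]_n)
    (N : 'M[C]_(m, n)) : Prop :=
  forall a, A a -> al a *m N = N *m be a.

Lemma intertwines_mul m n p (al : G -> 'M[C]_m) (be : G -> 'M[C]_n)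
    (ga : G -> 'M[C]_p) (N : 'M[C]_(m, n)) (N' : 'M[C]_(n, p)) :
  intertwines al be N -> intertwines be ga N' -> intertwines al ga (N *m N').
Proof. by move=> NI NI' a Aa; rewrite mulmxA NI// -!mulmxA NI'. Qed.

(** The Reynolds operator: it makes an intertwiner out of any matrix. *)
Definition mxavg m n (al : G -> 'M[C]_m) (be : G -> 'M[C]_n) (N : 'M[C]_(m, n)) :
    'M[C]_(m, n) :=
  mxmean (fun a => al a *m N *m be (a^-1)%g).

Lemma mxavg_cont m n (al : G -> 'M[C]_m) (be : G -> 'M[C]_n) N :
  is_rep al -> is_rep be -> mxcont (fun a => al a *m N *m be (a^-1)%g).
Proof.
move=> [_ _ alA] [_ _ beA]; apply: mxcont_mul; last exact: mxcont_inv.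
by apply: mxcont_mul => //; exact: mxcont_cst.
Qed.

Lemma mxavg_intertwines m n (al : G -> 'M[C]_m) (be : G -> 'M[C]_n) N :
  is_rep al -> is_rep be -> intertwines al be (mxavg al be N).
Proof.
move=> al_rep be_rep b Ab; have cont := mxavg_cont (N := N) al_rep be_rep.
rewrite -mxmean_mull// /mxavg -[in RHS](mxmean_translate Ab cont) -mxmean_mulr.
  apply: eq_mxmean => a Aa; have [_ alM _] := al_rep; have [_ beM _] := be_rep.
  rewrite alM// invgM beM; try exact: subgroupV.
  by rewrite -!mulmxA (rep_Vmul be_rep Ab) mulmx1.
exact: (mxcont_translate Ab cont).
Qed.

(** Maschke's argument: a projector p onto W is averaged to P. The image of P stays in W, whence p P
    = P, and P is the identity on W, whence P p = p. *)
Lemma invariant_idempotent n (al : G -> 'M[C]_n) (W : {vspace 'cV[C]_n}) :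
  is_rep al -> (forall a v, A a -> v \in W -> al a *m v \in W) ->
  exists P : 'M[C]_n, [/\ P *m P = P, intertwines al al P &
    forall v, (v \in W) = (P *m v == v)].
Proof.
move=> al_rep WA.
have [p pE] : exists p : 'M[C]_n, forall v, projv W v = p *m v.
  exact: linear_col_mx (linearP _).
have pW v : p *m v \in W by rewrite -pE memv_proj.
have pid v : v \in W -> p *m v = v by move=> vW; rewrite -pE projv_id.
have papE a : A a -> p *m (al a *m p) = al a *m p.
  by move=> Aa; apply: eq_mulmx_col => v; rewrite -!mulmxA pid// WA.
pose P := mxavg al al p; have cont := mxavg_cont (N := p) al_rep al_rep.
have pP : p *m P = P.
  rewrite -mxmean_mull//; apply: eq_mxmean => a Aa.
  by rewrite !mulmxA -(mulmxA p) papE.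
have Pp : P *m p = p.
  rewrite -mxmean_mulr// -[RHS](mxmean_cst); apply: eq_mxmean => a Aa.
  by rewrite -!mulmxA papE ?mulmxA ?rep_mulV ?mul1mx//; exact: subgroupV.
exists P; split; first by rewrite -{2}pP mulmxA Pp pP.
  exact: mxavg_intertwines.
move=> v; apply/idP/eqP => [vW|<-]; first by rewrite -(pid v vW) mulmxA Pp.
by rewrite -pP -mulmxA.
Qed.

(** Weyl's unitary trick: the averaged Hermitian form K is invariant and positive definite, the
    spectral theorem writes it as L^* L, and conjugation by L turns K into the standard form. *)
Lemma rep_unitarizable n (al : G -> 'M[C]_n) : is_rep al ->
  exists2 L : 'M[C]_n, L \in unitmx &
    forall a, A a -> L *m al a *m invmx L \is unitarymx.
Proof.
move=> al_rep; have [al1 alM alA] := al_rep.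
(* The form is taken at a^-1, so that the action of [al b] on it becomes the left translation by
   b^-1, under which the mean is invariant. *)
pose F a := (al (a^-1)%g ^t* *m al (a^-1)%g)%sesqui.
have FA : mxcont F.
  by apply: mxcont_mul; [apply: mxcont_trmxC|]; exact: mxcont_inv.
pose H := mxmean F.
have Hinv b : A b -> (al b ^t* *m H *m al b)%sesqui = H.
  move=> Ab; have AVb := subgroupV Ab.
  rewrite -mxmean_mull// -mxmean_mulr; last by apply: mxcont_mul => //; exact: mxcont_cst.
  rewrite -[RHS](mxmean_translate AVb FA); apply: eq_mxmean => a Aa.
  rewrite /F invgM invgK alM//; last exact: subgroupV.
  by rewrite trmx_mul map_mxM !mulmxA.
have Hpos (v : 'cV[C]_n) : v != 0 -> 0 < (v ^t* *m H *m v)%sesqui 0 0.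
  move=> v0; rewrite -mxmean_mull// -mxmean_mulr; last first.
    by apply: mxcont_mul => //; exact: mxcont_cst.
  rewrite mxE; apply: imean_gt0 => [|a Aa].
    by apply: mxcont_mul; [apply: mxcont_mul => //|]; exact: mxcont_cst.
  rewrite /F !mulmxA -map_mxM -trmx_mul -mulmxA; apply: col_norm_gt0.
  apply: contraNneq v0 => /(congr1 (mulmx (al a))).
  by rewrite mulmxA rep_mulV// mul1mx mulmx0 => ->.
(* Symmetrized, since M is not assumed to commute with conjugation. *)
pose K := (H + H ^t*)%sesqui.
have Kinv b : A b -> (al b ^t* *m K *m al b)%sesqui = K.
  move=> Ab; rewrite /K mulmxDr mulmxDl Hinv//; congr (_ + _).
  by rewrite -{2}(Hinv b Ab) !trmx_mul !map_mxM !mulmxA trmxCK.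
have Kpos (v : 'cV[C]_n) : v != 0 -> 0 < (v ^t* *m K *m v)%sesqui 0 0.
  move=> v0; rewrite /K mulmxDr mulmxDl mxE addr_gt0 ?Hpos//.
  have -> : (v ^t* *m H ^t* *m v = (v ^t* *m H *m v) ^t*)%sesqui.
    by rewrite !trmx_mul !map_mxM !mulmxA trmxCK.
  by rewrite mxE mxE conj_Creal ?gtr0_real ?Hpos.
have Kherm : (K ^t* = K)%sesqui by rewrite /K linearD map_mxD /= trmxCK addrC.
have /orthomx_spectralP : K \is normalmx by apply/normalmxP; rewrite Kherm.
set P := spectralmx K; set sp := spectral_diag K => KE.
have Pu : P \is unitarymx := spectral_unitarymx K.
have PPt : (P *m P ^t* = 1%:M)%sesqui by apply/unitarymxP.
have sp_gt0 i : 0 < sp 0 i.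
  have := Kpos (P ^t* *m delta_mx i 0)%sesqui.
  have -> : ((P ^t* *m (delta_mx i 0 : 'cV_n)) ^t* *m K *m (P ^t* *m delta_mx i 0) =
      (delta_mx i 0) ^t* *m diag_mx sp *m (delta_mx i 0 : 'cV_n))%sesqui.
    rewrite trmx_mul map_mxM trmxCK KE invmx_unitary//.
    by rewrite !mulmxA -!(mulmxA _ P) !PPt !mulmx1.
  rewrite trmx_delta map_delta_mx -rowE -[row _ _ *m _]colE.
  rewrite [col _ (row _ _) 0 0]mxE [row _ _ _ _]mxE mxE eqxx mulr1n; apply.
  apply/eqP => /(congr1 (mulmx P)); rewrite mulmxA PPt mul1mx mulmx0.
  by move=> /matrixP/(_ i 0)/eqP; rewrite !mxE !eqxx oner_eq0.
pose D := diag_mx (\row_i sqrtC (sp 0 i)).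
have DD : (D ^t* *m D)%sesqui = diag_mx sp.
  rewrite /D tr_diag_mx map_diag_mx mulmx_diag; congr diag_mx; apply/rowP => i.
  rewrite !mxE -[RHS]sqrtCK expr2; congr (_ * _); apply: conj_Creal.
  by rewrite ger0_real// sqrtC_ge0 ltW.
have KL : K = ((D *m P) ^t* *m (D *m P))%sesqui.
  by rewrite trmx_mul map_mxM -mulmxA (mulmxA _ D) DD mulmxA {1}KE invmx_unitary.
have Lu : D *m P \in unitmx.
  rewrite unitmx_mul (unitarymx_unit Pu) andbT unitmxE det_diag unitfE.
  by apply/prodf_neq0 => i _; rewrite mxE sqrtC_eq0 gt_eqF.
(* Passing to the adjoint replaces U U^* = 1 by U^* U = 1, where the invariance of K = L^* L
   applies. *)
exists (D *m P) => // a Aa; rewrite -trmxC_unitary; apply/unitarymxP.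
move: (D *m P) Lu KL => L Lu KL; rewrite trmxCK !trmx_mul !map_mxM.
rewrite !mulmxA -(mulmxA _ _ L) -KL -(mulmxA _ _ K) -(mulmxA _ _ (al a)) Kinv// KL.
by rewrite mulmxA -map_mxM -trmx_mul mulmxV// trmx1 map_mx1 mul1mx mulmxV.
Qed.

(* Complete reducibility is expressed by [isotypic_sum al 1%:M]: the identity *)
(* is a sum of matrices M *m N with M intertwining an irreducible with al.    *)
Inductive isotypic_sum n (al : G -> 'M[C]_n) : 'M[C]_n -> Prop :=
| isotypic_sum0 : isotypic_sum al 0
| isotypic_sumD (rho : irrep C A) (M : 'M[C]_(n, irrep_dim rho))
    (N : 'M[C]_(irrep_dim rho, n)) K :
    intertwines al rho M -> isotypic_sum al K -> isotypic_sum al (M *m N + K).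

Lemma isotypic_sum_add n (al : G -> 'M[C]_n) K K' :
  isotypic_sum al K -> isotypic_sum al K' -> isotypic_sum al (K + K').
Proof.
move=> KI K'I; elim: KI => [|rho M1 N1 K1 M1I _ IH]; first by rewrite add0r.
by rewrite -addrA; exact: isotypic_sumD.
Qed.

Lemma isotypic_sum_mul m n (al : G -> 'M[C]_n) (be : G -> 'M[C]_m) B D K :
  intertwines al be B -> isotypic_sum be K -> isotypic_sum al (B *m K *m D).
Proof.
move=> BI; elim=> [|rho M1 N1 K1 M1I _ IH]; first by rewrite mulmx0 mul0mx; left.
rewrite mulmxDr mulmxDl -!mulmxA mulmxA; apply: isotypic_sumD; last by rewrite mulmxA.
exact: intertwines_mul BI M1I.
Qed.

Lemma rep_simple_dec n (al : G -> 'M[C]_n) :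
  (forall W : {vspace 'cV[C]_n},
    (forall a v, A a -> v \in W -> al a *m v \in W) -> W = 0%VS \/ W = fullv) \/
  exists W : {vspace 'cV[C]_n}, [/\ W <> 0%VS, W <> fullv &
    forall a v, A a -> v \in W -> al a *m v \in W].
Proof.
have [|H] := pselect (exists W : {vspace 'cV[C]_n}, [/\ W <> 0%VS, W <> fullv &
    forall a v, A a -> v \in W -> al a *m v \in W]); [by right|left].
move=> W WA; have [|W0] := pselect (W = 0%VS); [by left|].
have [|WT] := pselect (W = fullv); [by right|].
by case: H; exists W.
Qed.

(** The rank factorization of P gives coordinates on its image, in which al restricts to be. *)
Lemma subrep n (al : G -> 'M[C]_n) (P : 'M[C]_n) : is_rep al -> P *m P = P ->
  intertwines al al P ->
  exists be : G -> 'M[C]_(\rank P),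
    is_rep be /\ intertwines al be (col_base P).
Proof.
move=> [al1 alM alA] PP PA; exists (fun a => row_base P *m al a *m col_base P).
move: (col_base P) (row_base P) (mulmx_base P) (idempotent_row_col_base PP).
move=> Cb Rb CR RC1.
have RP : Rb *m P = Rb by rewrite -[X in _ *m X]CR mulmxA RC1 mul1mx.
have PC : P *m Cb = Cb by rewrite -[X in X *m _]CR -mulmxA RC1 mulmx1.
split; last by move=> a Aa; rewrite !mulmxA CR -PA// -mulmxA PC.
split=> [|a b Aa Ab|]; first by rewrite al1 mulmx1.
  by rewrite alM// !mulmxA -(mulmxA _ Cb) CR -(mulmxA _ _ P) PA// !mulmxA RP.
by apply: mxcont_mul; [apply: mxcont_mul => //|]; exact: mxcont_cst.
Qed.

(** Strong induction on the dimension: a simple representation becomes an [irrep] after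
    unitarization, and otherwise 1 = (1 - P) + P splits it into two representations of smaller
    dimension. *)
Lemma rep_semisimple n (al : G -> 'M[C]_n) : is_rep al -> isotypic_sum al 1%:M.
Proof.
have [k] := ubnP n; elim: k => // k IH in n al *; rewrite ltnS => nk al_rep.
(* The zero space is not irreducible; its identity is the empty sum. *)
have [n0|n0] := posnP n.
  have -> : 1%:M = 0 :> 'M[C]_n; last exact: isotypic_sum0.
  by apply/matrixP => i; have := ltn_ord i; rewrite {2}n0.
have [simple|[W [W0 WT WA]]] := rep_simple_dec al.
  have [L Lu Lal] := rep_unitarizable al_rep; have [al1 alM alA] := al_rep.
  have alLM a b : A a -> A b -> L *m al (a * b)%g *m invmx L =
      (L *m al a *m invmx L) *m (L *m al b *m invmx L).
    by move=> Aa Ab; rewrite alM// !mulmxA mulmxKV.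
  have alLA : {within A, continuous (fun a => L *m al a *m invmx L)}.
    by apply/mxcontP/mxcont_mul; [apply: mxcont_mul => //|]; exact: mxcont_cst.
  have alLs (W : {vspace 'cV[C]_n}) :
      (forall a v, A a -> v \in W -> L *m al a *m invmx L *m v \in W) ->
      W = 0%VS \/ W = fullv.
    move=> WL; pose f := linfun (mulmx L : 'cV[C]_n -> 'cV[C]_n).
    have fE v : f v = L *m v by rewrite lfunE.
    have [a v Aa|W0|WT] := simple (f @^-1: W)%VS.
    - rewrite -!memv_preim !fE => /(WL a _ Aa).
      by rewrite !mulmxA mulmxKV.
    - left; apply/eqP; rewrite -subv0; apply/subvP => w wW.
      have : invmx L *m w \in (f @^-1: W)%VS by rewrite -memv_preim fE mulKVmx.
      by rewrite W0 !memv0 => /eqP/(congr1 (mulmx L)); rewrite mulKVmx// mulmx0 => ->.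
    - right; apply/eqP; rewrite eqEsubv subvf; apply/subvP => w _.
      have : invmx L *m w \in (f @^-1: W)%VS by rewrite WT memvf.
      by rewrite -memv_preim fE mulKVmx.
  pose rho := Irrep Lal alLM alLA n0 alLs.
  have := isotypic_sumD (rho := rho) (al := al) (M := invmx L) L _ (isotypic_sum0 al).
  rewrite mulVmx// addr0; apply => a Aa /=.
  by rewrite !mulmxA mulVmx// mul1mx.
have [P [PP PA PW]] := invariant_idempotent al_rep WA.
have rank_lt (Q : 'M[C]_n) : Q *m Q = Q -> Q != 1%:M -> (\rank Q < n)%N.
  move=> QQ; apply: contraNT; rewrite -leqNgt => Qn.
  have Qu : Q \in unitmx by rewrite -row_full_unit /row_full eqn_leq rank_leq_col.
  by rewrite -(mulKmx Qu Q) QQ mulVmx.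
have part (Q : 'M[C]_n) : Q *m Q = Q -> intertwines al al Q -> Q != 1%:M ->
    isotypic_sum al Q.
  move=> QQ QA Q1; have [be [be_rep beI]] := subrep al_rep QQ QA.
  have := IH _ be (leq_trans (rank_lt Q QQ Q1) nk) be_rep.
  move=> /(isotypic_sum_mul (row_base Q) beI).
  by rewrite mulmx1 mulmx_base.
rewrite -(subrK P 1%:M); apply: isotypic_sum_add; apply: part => //.
- by rewrite mulmxBl mul1mx mulmxBr mulmx1 PP subrr subr0.
- by move=> a Aa; rewrite mulmxBr mulmx1 mulmxBl mul1mx PA.
- apply/eqP => P1; apply: W0; apply/eqP; rewrite -subv0; apply/subvP => v.
  rewrite PW (_ : P = 0) ?mul0mx 1?eq_sym ?memv0//.
  by apply/eqP; rewrite -oppr_eq0 -(inj_eq (addrI 1%:M)) addr0 P1.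
- apply/eqP => P1; apply: WT; apply/eqP; rewrite eqEsubv subvf.
  by apply/subvP => v _; rewrite PW P1 mul1mx.
Qed.

End matrix_mean.

(** * Schur's lemma and the orthogonality relations *)

Section schur.
Context {C : numClosedFieldType} {G : topologicalGroupType}.
Context {A : normal_subgroup G}.
Variable M : invariant_mean C A.

(** By unitarity the adjoint of N is an intertwiner too, so N^* N and N N^* are scalars. They are
    the same c > 0, and N divided by the square root of c is unitary. *)
Lemma schur (rho sigma : irrep C A) (N : 'M[C]_(irrep_dim sigma, irrep_dim rho)) :
  intertwines (A := A) sigma rho N -> N != 0 -> unitary_equiv rho sigma.
Proof.
move=> NI N0; have irrepV (tau : irrep C A) a : A a -> (tau (a^-1)%g ^t* = tau a)%sesqui.
  move=> Aa; have AVa := subgroupV Aa.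
  have /unitarymxP tt := irrep_unitary tau AVa; have tVt := rep_mulV (irrep_is_rep tau) Aa.
  by rewrite -[LHS]mul1mx -tVt -mulmxA tt mulmx1.
have NtI : intertwines (A := A) rho sigma (N ^t*)%sesqui.
  move=> a Aa; have := congr1 (fun B => B ^t*)%sesqui (NI _ (subgroupV Aa)).
  by rewrite !trmx_mul !map_mxM !irrepV.
have [c cE] := @irrep_schur C G A rho _ (intertwines_mul NtI NI).
have [d dE] := @irrep_schur C G A sigma _ (intertwines_mul NI NtI).
have [j Nj] : exists j, col j N != 0.
  apply/existsP; apply: contraNT N0 => /existsPn N0; apply/eqP/matrixP => i j.
  by have := N0 j; rewrite negbK => /eqP/colP/(_ i); rewrite !mxE.
have c0 : 0 < c.
  suff -> : c = (col j N ^t* *m col j N)%sesqui 0 0 by exact: col_norm_gt0.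
  transitivity ((N ^t* *m N)%sesqui j j); first by rewrite cE mxE eqxx.
  by rewrite !mxE; apply: eq_bigr => k _; rewrite !mxE.
have dc : d = c.
  have : c *: N = d *: N by rewrite -mul_mx_scalar -mul_scalar_mx -cE -dE mulmxA.
  move/eqP; rewrite -subr_eq0 -scalerBl scaler_eq0 (negPf N0) orbF subr_eq0.
  by move=> /eqP.
have trmxCZ (k : C) : ((k *: N) ^t* = k^* *: N ^t*)%sesqui.
  by apply/matrixP => a b; rewrite !mxE rmorphM.
have s0 : sqrtC c != 0 by rewrite sqrtC_eq0 gt_eqF.
have sconj : ((sqrtC c)^-1)^* = (sqrtC c)^-1.
  by rewrite conj_Creal// rpredV ger0_real// sqrtC_ge0 ltW.
have ss : (sqrtC c)^-1 * (sqrtC c)^-1 * c = 1.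
  by rewrite -invfM -expr2 sqrtCK mulVf// gt_eqF.
exists ((sqrtC c)^-1 *: N); split.
- rewrite trmxCZ sconj -scalemxAl -scalemxAr scalerA dE dc.
  by rewrite -mul_scalar_mx -scalar_mxM ss.
- rewrite trmxCZ sconj -scalemxAl -scalemxAr scalerA cE.
  by rewrite -mul_scalar_mx -scalar_mxM ss.
- by move=> a Aa; rewrite -scalemxAl -scalemxAr NI.
Qed.

(** The mean of a matrix coefficient times a vector is the averaged rank-one matrix v e_i^T applied
    to w, to which Schur's lemma applies. *)
Lemma mean_coef_avg (rho sigma : irrep C A)
    (v : 'cV[C]_(irrep_dim sigma)) (w : 'cV[C]_(irrep_dim rho)) i :
  mxmean M (fun a => (rho (a^-1)%g *m w) i 0 *: (sigma a *m v)) =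
  mxavg M sigma rho (v *m delta_mx 0 i) *m w.
Proof.
rewrite -mxmean_mulr; last exact: mxavg_cont (irrep_is_rep _) (irrep_is_rep _).
apply: eq_mxmean => a _; rewrite -!mulmxA -rowE mulmxA -mul_mx_scalar.
by congr (_ *m _); apply/matrixP => k l; rewrite !ord1 !mxE mulr1n.
Qed.

Lemma schur_orthogonality_neq (rho sigma : irrep C A)
    (v : 'cV[C]_(irrep_dim sigma)) (w : 'cV[C]_(irrep_dim rho)) i :
  ~ unitary_equiv rho sigma ->
  mxmean M (fun a => (rho (a^-1)%g *m w) i 0 *: (sigma a *m v)) = 0.
Proof.
move=> rs; rewrite mean_coef_avg.
have PI := mxavg_intertwines M (v *m delta_mx 0 i) (irrep_is_rep sigma) (irrep_is_rep rho).
have [->|/(schur PI)//] := eqVneq (mxavg M sigma rho (v *m delta_mx 0 i)) 0.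
by rewrite mul0mx.
Qed.

(** The average of v e_i^T is a scalar matrix with the trace of v e_i^T, which is v_i; hence the
    factor [irrep_dim rho]. *)
Lemma schur_orthogonality (rho : irrep C A) (v w : 'cV[C]_(irrep_dim rho)) i :
  (irrep_dim rho)%:R *: mxmean M (fun a => (rho (a^-1)%g *m w) i 0 *: (rho a *m v)) =
  v i 0 *: w.
Proof.
have rr := irrep_is_rep rho; rewrite mean_coef_avg.
have PI := mxavg_intertwines M (v *m delta_mx 0 i) rr rr.
have [c cE] := @irrep_schur C G A rho _ PI; rewrite cE mul_scalar_mx scalerA; congr (_ *: _).
have := congr1 mxtrace cE; rewrite mxtrace_scalar mulr_natl => <-.
rewrite mxtrace_mxmean; last exact: mxavg_cont.
rewrite (@eq_imean _ _ _ M _ (fun=> v i 0)) ?imean_cst// => a Aa.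
rewrite mxtrace_mulC !mulmxA (rep_Vmul rr Aa) mul1mx mxtrace_mulC.
by rewrite -rowE trace_mx11 mxE.
Qed.

End schur.

(** * The evaluation map *)

Local Notation total := Defs.total.

Section families.
Context {C : numClosedFieldType} {G : topologicalGroupType} {H : subgroup G}.
Context {X : gspace G} {E : gfamily C H X}.

Lemma Total_inj x : injective (@Total C G H X E x).
Proof. by move=> e e' ee'; exact: (@eq_from_Tagged X (fibre E) _ _ _ ee'). Qed.

End families.

Section evaluation.
Context {C : numClosedFieldType} {G : topologicalGroupType}.
Context {A : normal_subgroup G} {X : gspace G} {AX : acts_trivially A X}.
Context {E : gfamily C (whole G) X}.

HB.instance Definition _ (rho : irrep C A) x (phi : homA E rho AX x) :=
  GRing.isLinear.Build C 'cV[C]_(irrep_dim rho) (E x) *:%R (homA_fun phi)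
    (homA_linear phi).

Section irrep.
Context {rho : irrep C A}.
Local Notation n := (irrep_dim rho).
Local Notation F := (rep_homA AX E rho).

(** The map v (x) phi |-> phi(v), since t stands for the sum of the e_i (x) t_i. *)
Definition eval x (t : F x) : E x := \sum_i (t : tens n _) i (delta_mx i 0).

Lemma eval_linear x : linear (@eval x).
Proof.
move=> c s t; rewrite /eval scaler_sumr -big_split; apply: eq_bigr => i _ /=.
by rewrite !ffunE.
Qed.

HB.instance Definition _ x := GRing.isLinear.Build C (F x) (E x) *:%R
  (@eval x) (@eval_linear x).

Definition teval (t : total F) : total E := Total (eval (projT2 t)).

(** The intertwiner cancels: u v (x) g phi u^-1 evaluates to g phi(v). *)
Lemma eval_act g (Hg : isotropy rho g) x (t : F x) :
  eval (fact Hg x t) = fact (I : whole G g) x (eval t).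
Proof.
set u := choose_intertwiner rho g.
have [/unitarymx_unit Uu _] := choose_intertwinerP Hg.
rewrite /eval; under eq_bigr do rewrite rep_homA_act_val.
rewrite exchange_big linear_sum; apply: eq_bigr => i _ /=.
under eq_bigr do rewrite -linearZ -linearZ /= scalemxAr.
have uE : \sum_j invmx u *m (u j i *: delta_mx j 0) = delta_mx i 0 :> 'cV[C]_n.
  rewrite -mulmx_sumr -[RHS](mulKmx Uu); congr (_ *m _); rewrite -colE.
  rewrite [RHS]matrix_sum_delta; apply: eq_bigr => j _.
  by rewrite big_ord1 mxE.
by rewrite -[in RHS]uE !linear_sum.
Qed.

Lemma teval_tact g (Hg : isotropy rho g) t :
  teval (tact Hg t) = tact (I : whole G g) (teval t).
Proof. by rewrite /teval /tact /= eval_act. Qed.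

(** The map [g, t] |-> g eval(t), computed on a chosen representative; [bevalE] removes the
    choice. *)
Definition beval (o : balanced F) : total E :=
  tact (I : whole G (brepr o).1) (teval (brepr o).2).

Lemma bevalE g t : beval (bclass g t) = tact (I : whole G g) (teval t).
Proof.
have /bclassP[h [Hh [rg tE]]] := breprK (bclass g t).
rewrite /beval [in RHS]tE teval_tact -(tactM _ _ (I : whole G (g * h)%g)).
exact: tact_ext.
Qed.

Lemma beval_bact g o : beval (bact g o) = tact (I : whole G g) (beval o).
Proof.
rewrite -(breprK o) bactE !bevalE.
exact: tactM.
Qed.

Lemma base_beval o : base (beval o) = (bproj o).2.
Proof. by rewrite -(breprK o) bevalE bprojE. Qed.

Lemma beval_fibre_ex c x (s : bfibre F c x) : exists e : E x, Total e = beval s.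
Proof.
have : base (beval s) = x by rewrite base_beval bfibre_proj.
by case: (beval s) => y e yx; rewrite /base /= in yx; subst y; exists e.
Qed.

(** [beval] takes values in the total space, over a point that is only provably x; this is the same
    vector, retyped in E x. *)
Definition feval c x (s : bfibre F c x) : E x := sval (cid (beval_fibre_ex s)).

Lemma Total_feval c x (s : bfibre F c x) : Total (feval s) = beval s.
Proof. by rewrite /feval; case: cid. Qed.

Lemma feval_linear c x : linear (@feval c x).
Proof.
move=> k s t; have kc := coset_reprK c.
have [e <-] := bfibre_mk_ex kc s; have [e' <-] := bfibre_mk_ex kc t.
apply: Total_inj; rewrite -bfibre_mk_linear Total_feval /= bevalE.
rewrite /teval /tact /= linearP linearP; apply: existT_lin; symmetry;
  by rewrite -[LHS]/(Total _) Total_feval /= bevalE.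
Qed.

HB.instance Definition _ c x := GRing.isLinear.Build C (bfibre F c x) (E x) *:%R
  (@feval c x) (@feval_linear c x).

End irrep.

Context {S : set (irrep C A)}.
Local Notation D := (decomposition S AX E).

(** One index type for the sum over orbits and the sum over cosets inside [Ind]. By [twist] below it
    plays the role of Irr(A). [classic] supplies the equality and choice structures that big sums
    need. *)
Definition summand : Type :=
  {classic {rho : set_type S & cosets (isotropy (val rho))}}.

Definition summand_act (g : G) (p : summand) : summand :=
  existT _ (tag p) (coset_act g (tagged p)).

Lemma summand_actM g h p : summand_act (g * h)%g p = summand_act g (summand_act h p).
Proof. by rewrite /summand_act /= coset_actM. Qed.

Lemma summand_act1 p : summand_act 1%g p = p.
Proof. by case: p => rho c; rewrite /summand_act /= coset_act1. Qed.

Definition component (p : summand) x (s : D x) :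
    bfibre (rep_homA AX E (val (tag p))) (tagged p) x :=
  ((s : dsum _) (tag p) : dsum _) (tagged p).

Definition term (p : summand) x (s : D x) : E x := feval (component p s).

Lemma term_linear p x : linear (@term p x).
Proof. by move=> c s t; rewrite /term linearP. Qed.

Lemma component_support x (s : D x) :
  exists2 r : seq summand, uniq r & forall p, p \notin r -> component p s = 0.
Proof.
have : finite_set [set p : summand | component p s != 0].
  apply: (@sub_finite_set _ _
    (\bigcup_(rho in [set rho : {classic set_type S} | (s : dsum _) rho != 0])
      (fun c => existT _ rho c : summand) @`
        [set c | ((s : dsum _) rho : dsum _) c != 0])).
    move=> [rho c] /= sc; exists rho => /=; last by exists c.
    by apply: contraNN sc => /eqP s0; rewrite /component /= s0.
  apply: bigcup_finite => [|rho _]; first exact: dsum_finite.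
  by apply: finite_image; exact: dsum_finite.
move=> /finite_seqP[r rE]; exists (undup r); first exact: undup_uniq.
move=> p; rewrite mem_undup => pr; apply/eqP; apply: contraNT pr => sp.
by have : [set p : summand | component p s != 0] p by []; rewrite rE.
Qed.

(** A finitely supported sum; by [Phi_funE] it can be computed along any duplicate-free list that
    contains the support. *)
Definition Phi_fun x (s : D x) : E x := \sum_(p \in [set: summand]) term p s.

Lemma Phi_funE x (s : D x) (r : seq summand) : uniq r ->
  (forall p, p \notin r -> component p s = 0) ->
  Phi_fun s = \sum_(p <- r) term p s.
Proof.
move=> r_uniq s0; rewrite /Phi_fun (@fsbigE _ _ _ _ _ r _ r_uniq) => [||p _ /s0]//.
  by apply: eq_bigl => p; rewrite in_setT.
by rewrite /term => ->; rewrite linear0.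
Qed.

Lemma Phi_linear x : linear (@Phi_fun x).
Proof.
move=> c s t; have [r r_uniq rs] := component_support s.
have [q q_uniq qt] := component_support t.
pose w := undup (r ++ q); have w_uniq : uniq w := undup_uniq _.
have ws p : p \notin w -> component p s = 0.
  by rewrite mem_undup mem_cat negb_or => /andP[/rs].
have wt p : p \notin w -> component p t = 0.
  by rewrite mem_undup mem_cat negb_or => /andP[_ /qt].
rewrite (Phi_funE w_uniq ws) (Phi_funE w_uniq wt) (Phi_funE w_uniq).
  rewrite scaler_sumr -big_split; apply: eq_bigr => p _ /=; exact: term_linear.
move=> p pw; have := ws p pw; have := wt p pw; rewrite /component => t0 s0.
by rewrite !dsum_linE s0 t0 scaler0 addr0.
Qed.

HB.instance Definition _ x := GRing.isLinear.Build C (D x) (E x) *:%R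
  (@Phi_fun x) (@Phi_linear x).

Lemma term_act g p x (s : D x) :
  term p (fact (I : whole G g) x s) =
  fact (I : whole G g) x (term (summand_act g^-1%g p) s).
Proof.
apply: Total_inj; rewrite Total_feval /component /= beval_bact.
exact: (congr1 (tact _) (esym (Total_feval _))).
Qed.

(** The action of g permutes the summands, so the support of g s is covered by the g-translate of a
    list for s, and the terms match by [term_act]. *)
Lemma Phi_fact g (Hg : whole G g) x (s : D x) :
  Total (Phi_fun (fact Hg x s)) = tact Hg (Total (Phi_fun s)).
Proof.
case: Hg; congr Total; have [r r_uniq rs] := component_support s.
have actK h : cancel (summand_act h) (summand_act h^-1%g).
  by move=> p; rewrite -summand_actM mulVg summand_act1.
have actKV h : cancel (summand_act h^-1%g) (summand_act h).
  by move=> p; rewrite -summand_actM mulgV summand_act1.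
rewrite (Phi_funE r_uniq rs) (@Phi_funE _ _ (map (summand_act g) r)).
- rewrite big_map linear_sum; apply: eq_bigr => p _ /=.
  by rewrite term_act actK.
- by rewrite map_inj_uniq//; exact: can_inj (actK g).
move=> p pr; have {}pr : summand_act g^-1%g p \notin r.
  by apply: contraNN pr => pr; rewrite -(actKV g p) map_f.
have := rs _ pr; rewrite /component /= => s0.
by rewrite s0 linear0.
Qed.

Definition Phi : gmap idfun D E :=
  @GMap C G (whole G) X X idfun D E (fun x => @Phi_fun x) Phi_fact.

End evaluation.

(** * Naturality of the evaluation map *)

Section naturality.
Context {C : numClosedFieldType} {G : topologicalGroupType}.
Context {A : normal_subgroup G} {Y X : gspace G} {f : Y -> X}.
Context (fG : equivariant f).
Context (AY : acts_trivially A Y) (AX : acts_trivially A X).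
Context {E' : gfamily C (whole G) Y} {E : gfamily C (whole G) X}.
Variable m : gmap f E' E.

Lemma eval_natural (rho : irrep C A) y (t : rep_homA AY E' rho y) :
  eval (rep_homA_map fG AY AX m rho y t) = m y (eval t).
Proof.
rewrite /eval linear_sum; apply: eq_bigr => i _.
by rewrite -[LHS]/((rep_homA_map_fun AX m t : tens _ _) i _) rep_homA_map_funE.
Qed.

Lemma beval_natural (rho : irrep C A) (o : balanced (rep_homA AY E' rho)) :
  beval (bmap (rep_homA_map fG AY AX m rho) o) = tmap m (beval o).
Proof.
rewrite -(breprK o) bmapE !bevalE tmap_tact; congr tact.
by rewrite /teval /tmap /= eval_natural.
Qed.

Lemma term_natural (S : set (irrep C A)) (p : summand) y
    (s : decomposition S AY E' y) :
  term p (decomposition_map S fG AY AX m y s) = m y (term p s).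
Proof.
apply: Total_inj; rewrite Total_feval -[RHS]/(tmap m (Total (term p s))).
by rewrite Total_feval -beval_natural.
Qed.

(** Each term is natural because m commutes with the action and with evaluation, and a list
    supporting s also supports its image. *)
Lemma Phi_natural (S : set (irrep C A)) y (s : decomposition S AY E' y) :
  m y (Phi y s) = Phi (f y) (decomposition_map S fG AY AX m y s).
Proof.
have [r r_uniq rs] := component_support s.
rewrite -[Phi y s]/(Phi_fun s) -[RHS]/(Phi_fun _).
rewrite (Phi_funE r_uniq rs) (Phi_funE r_uniq).
  by rewrite linear_sum; apply: eq_bigr => p _; rewrite term_natural.
move=> p /rs; rewrite /component /= => s0.
by rewrite s0 linear0.
Qed.

End naturality.

(** * Averages in the fibres of a bundle *)

Section topology.
Context {T : Type} {F : set_system T} {FF : Filter F}.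

Lemma prod_topology_cvg {I : Type} {K : I -> topologicalType}
    (h : T -> prod_topology K) (f : prod_topology K) :
  (forall i, (fun t => h t i) @ F --> f i) -> h @ F --> f.
Proof.
move=> hf; apply/cvg_sup => i P; rewrite nbhsE => -[B [[W oW <-] Of] BP].
by apply: filterS BP _; apply: (hf i); exact: open_nbhs_nbhs.
Qed.

Lemma cvg_comp_pair {U V W : nbhsType}
    (f : T -> U) (g : T -> V) (k : U * V -> W) (u : U) (v : V) (w : W) :
  f @ F --> u -> g @ F --> v -> k @ (u, v) --> w -> (fun t => k (f t, g t)) @ F --> w.
Proof.
move=> fu gv kw P /kw [[B D] [/= uB vD] BD].
apply: (@filterS2 _ F _ (f @^-1` B) (g @^-1` D)) (fu _ uB) (gv _ vD) => t Bt Dt.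
exact: (BD (f t, g t)).
Qed.

(** The total spaces of [rep_homA], [Ind] and [bigoplus] have initial topologies; this reduces
    convergence in them to convergence of coordinates. *)
Lemma cvg_total_initial {C : numClosedFieldType} {G : topologicalGroupType}
    {H : subgroup G} {X : gspace G} {S : topologicalType} (E : gfamily C H X)
    (emb : total E -> S) (h : T -> total E) (e : total E) :
  @total_open _ _ _ _ E = initial_open emb ->
  (fun t => emb (h t)) @ F --> emb e -> h @ F --> e.
Proof.
move=> openE he P; rewrite nbhsE => -[B [oB Be] BP].
have : initial_open emb B by rewrite -openE; exact: oB.
move=> [W oW WB]; apply: filterS BP _; rewrite -WB.
by apply: he; apply: open_nbhs_nbhs; split => //; rewrite -WB in Be.
Qed.

End topology.

Lemma prod_topology_proj_continuous {I : Type} {K : I -> topologicalType} (i : I) :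
  continuous (fun f : prod_topology K => f i).
Proof.
move=> f; have /cvg_sup/(_ i) fi : f --> f by exact: cvg_id.
move=> P /(@initial_continuous _ _ (fun f : forall i, K i => f i) f); exact: fi.
Qed.

Lemma total_initial_continuous {C : numClosedFieldType} {G : topologicalGroupType}
    {H : subgroup G} {X : gspace G} {S : topologicalType} (E : gfamily C H X)
    (emb : total E -> S) :
  @total_open _ _ _ _ E = initial_open emb -> continuous emb.
Proof.
move=> openE; apply/continuousP => W oW.
suff : initial_open emb (emb @^-1` W) by rewrite -openE.
by exists W.
Qed.

Section mean_continuity.
Context {C : numClosedFieldType} {G : topologicalGroupType} {A : subgroup G}.
Hypothesis Acompact : compact (A : set G).
Variable M : invariant_mean C A.

(** Joint continuity and compactness of A make f t uniformly close to f t0 on A, and the norm bound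
    of the mean finishes the estimate. *)
Lemma imean_continuous {T : topologicalType} (f : T -> G -> C) (t0 : T) :
  (\forall t \near t0, {within A, continuous (f t)}) ->
  (forall a, A a -> (fun p => f p.2 p.1) @ filter_prod (within A (nbhs a)) (nbhs t0)
     --> f t0 a) ->
  (fun t => M (f t)) @ t0 --> M (f t0).
Proof.
move=> fcont fjoint; apply/cvgrPdist_le => e e0.
(* Two errors of e / 4 give e / 2, and the factor 2 in [imean_norm_le] restores e. *)
have e40 : 0 < e / 4 by rewrite divr_gt0.
pose P t a := A a -> `|f t0 a - f t a| <= e / 2.
have cov a : A a -> \forall a' \near a & t \near nbhs t0, P t a'.
  move=> Aa; have [[U V] [/= Ua Vt] UV] := @cvgr_dist_le C C _
    (filter_prod (within A (nbhs a)) (nbhs t0)) _ (fun p => f p.2 p.1) _ (fjoint a Aa) _ e40.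
  exists ([set a' | A a' -> U a'], V) => //= -[a' t] /= [Ua' Vt'] Aa'.
  have h1 := UV (a', t) (conj (Ua' Aa') Vt'); have h2 := UV (a', t0) (conj (Ua' Aa') (nbhs_singleton Vt)).
  have -> : e / 2 = e / 4 + e / 4 by rewrite -mulrDr -[4]/(2 * 2)%:R natrM invfM -mulrDl; field.
  rewrite (le_trans (ler_distD (f t0 a) _ _))// lerD//.
  by rewrite distrC.
have := (compact_near_coveringP _).1 Acompact _ (nbhs t0) P _ cov.
have fA : {within A, continuous (f t0)} := nbhs_singleton fcont.
move=> /(_ (nbhs_filter t0)) /(filterS2 _) h; apply: h fcont => t tP ftA.
have -> : M (f t0) - M (f t) = M (fun a => (-1) * f t a + f t0 a).
  by rewrite imean_lin// mulN1r addrC.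
rewrite (le_trans (@imean_norm_le _ _ _ M _ (e / 2) _ _))//.
- by apply: within_lin.
- by move=> a Aa; rewrite mulN1r addrC; exact: tP.
- by rewrite mulr2n -splitr.
Qed.

End mean_continuity.

(** * Local trivializations as charts of the total space *)

Section trivializations.
Context {C : numClosedFieldType} {G : topologicalGroupType}.
Context {X : gspace G} (E : gfamily C (whole G) X).

Record trivialization := Trivialization {
  triv_dim : nat;
  triv_dom : set X;
  triv_phi : forall x, E x -> 'cV[C]_triv_dim;
  triv_psi : forall x, 'cV[C]_triv_dim -> E x;
  triv_open : open triv_dom;
  triv_linear : forall x, triv_dom x -> linear (@triv_phi x);
  triv_phiK : forall x, triv_dom x -> cancel (@triv_phi x) (triv_psi x);
  triv_psiK : forall x, triv_dom x -> cancel (triv_psi x) (@triv_phi x);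
  triv_phi_within : {within base (E := E) @^-1` triv_dom,
    continuous (fun e : total E => triv_phi (projT2 e))};
  triv_psi_within : {within triv_dom `*` setT,
    continuous (fun p : X * 'cV[C]_triv_dim => Total (triv_psi p.1 p.2))}
}.

Arguments triv_phi t {x} e : rename.
Arguments triv_psi : clear implicits.

Hypothesis Ebundle : is_gbundle E.

Lemma trivialization_ex x : exists L : trivialization, triv_dom L x.
Proof.
have [_ /(_ x)[n [U [phi [psi [[Uo Ux] UP phic psic]]]]] _] := Ebundle.
have lin y : U y -> linear (phi y) by move=> /UP[].
have phiK y : U y -> cancel (phi y) (psi y) by move=> /UP[].
have psiK y : U y -> cancel (psi y) (phi y) by move=> /UP[].
by exists (Trivialization Uo lin phiK psiK phic psic).
Qed.

Section triv.
Variable L : trivialization.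
Local Notation n := (triv_dim L).
Local Notation U := (triv_dom L).

Definition coord (e : total E) : 'cV[C]_n := triv_phi L (projT2 e).

Lemma coord_cvg (e : total E) : U (base e) -> coord @ e --> coord e.
Proof.
move=> Ue; have [base_cont _ _] := Ebundle.
have oU : open (base (E := E) @^-1` U).
  by apply: open_comp => [z _|]; [exact: base_cont|exact: triv_open].
move: (triv_phi_within (t := L)); rewrite continuous_open_subspace// => h.
by apply: h; rewrite inE.
Qed.

Lemma psi_cvg (x : X) (v : 'cV[C]_n) : U x ->
  (fun p : X * 'cV[C]_n => Total (triv_psi L p.1 p.2)) @ (x, v) -->
  Total (triv_psi L x v).
Proof.
move=> Ux; have oU : open (U `*` [set: 'cV[C]_n]).
  rewrite openE => -[y w] [/= Uy _]; exists (U, setT) => //=; split; last exact: filterT.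
  by apply: open_nbhs_nbhs; split => //; exact: triv_open.
move: (triv_psi_within (t := L)); rewrite continuous_open_subspace// => h.
by apply: (h (x, v)); rewrite inE.
Qed.

Lemma coord_inj (e e' : total E) : U (base e) -> base e = base e' ->
  coord e = coord e' -> e = e'.
Proof.
case: e e' => x e [y e'] /= Ux xy; rewrite /base /= in Ux xy; subst y.
move=> /(congr1 (triv_psi L x)).
by rewrite /coord /= !triv_phiK// => ->.
Qed.

Lemma psi_linear x : U x -> linear (triv_psi L x).
Proof.
move=> Ux c v w; rewrite -{1}(triv_psiK Ux v) -{1}(triv_psiK Ux w).
by rewrite -triv_linear// triv_phiK.
Qed.

(** Over an open trivializing set h t is eventually psi applied to its base point and coordinates,
    and psi is jointly continuous. *)
Lemma cvg_total {T : Type} {F : set_system T} {FF : Filter F} (h : T -> total E)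
    (e : total E) : U (base e) ->
  (fun t => base (h t)) @ F --> base e -> (fun t => coord (h t)) @ F --> coord e ->
  h @ F --> e.
Proof.
move=> Ue hb hc; have UF : \forall t \near F, U (base (h t)).
  by apply: hb; apply: open_nbhs_nbhs; split => //; exact: triv_open.
have psiE e' : U (base e') -> Total (triv_psi L (base e') (coord e')) = e'.
  by case: e' => x e' Ux; rewrite /coord /= triv_phiK.
have := cvg_comp_pair hb hc (psi_cvg (v := coord e) Ue).
move=> /(_ FF); rewrite /= psiE//; apply: cvg_trans; apply: near_eq_cvg.
by apply: filterS UF => t Ut; rewrite psiE.
Qed.

End triv.

(** Continuity of the action is given on the subspace [set_type (whole G)]; it is transferred to G
    through [inj]. *)
Lemma tact_cvg {T : Type} {F : set_system T} {FF : Filter F} (f : T -> G)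
    (h : T -> total E) g e : f @ F --> g -> h @ F --> e ->
  (fun t => tact (I : whole G (f t)) (h t)) @ F --> tact (I : whole G g) e.
Proof.
move=> fg he; have [_ _ act_cont] := Ebundle.
pose inj (g : G) : set_type (whole G) := exist _ g (mem_set (I : whole G g)).
have inj_cvg : (fun t => inj (f t)) @ F --> inj g.
  move=> P; rewrite nbhsE => -[B [[W oW <-] Og] BP].
  by apply: filterS BP _; apply: fg; exact: open_nbhs_nbhs.
have actE g' e' : tact (set_valP (inj g')) e' = tact (I : whole G g') e'.
  exact: tact_ext.
have := cvg_comp_pair inj_cvg he (act_cont (inj g, e)).
move=> /(_ FF); rewrite /= actE; apply: cvg_trans; apply: near_eq_cvg.
by apply: nearW => t; rewrite actE.
Qed.

End trivializations.
Arguments triv_psi {C G X E} L x v : rename.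
Arguments triv_phi {C G X E} L {x} e : rename.
Arguments coord {C G X E} L e.

Section weighted_means.
Context {C : numClosedFieldType} {G : topologicalGroupType}.
Context {A : normal_subgroup G}.
Hypothesis Acompact : compact (A : set G).
Variable M : invariant_mean C A.
Context {X : gspace G} {AX : acts_trivially A X}.
Context {E : gfamily C (whole G) X}.
Hypothesis Ebundle : is_gbundle E.

Local Notation tau a e := (tact (I : whole G a) e).

Section triv.
Variable L : trivialization E.
Local Notation n := (triv_dim L).
Local Notation U := (triv_dom L).

Lemma coord_within (a : G) (e : total E) : A a -> U (base e) ->
  coord L @ tau a e --> coord L (tau a e).
Proof. by move=> Aa Ue; apply: coord_cvg => //; rewrite /base /= AX. Qed.

(** The action on the fibre over x in coordinates. It is meaningful for a in A and x in the domain,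
    where a preserves the fibre. *)
Definition triv_rep (x : X) (a : G) : 'M[C]_n :=
  \matrix_(i, j) coord L (tau a (Total (triv_psi L x (delta_mx j 0)))) i 0.

Lemma triv_repE x a (e : E x) : A a -> U x ->
  coord L (tau a (Total e)) = triv_rep x a *m triv_phi L e.
Proof.
move=> Aa Ux; have Uax : U (act a x) by rewrite AX.
have lin : linear (fun v => coord L (tau a (Total (triv_psi L x v)))).
  by move=> c v w; rewrite psi_linear// /coord /= linearP triv_linear.
have [T TE] := linear_col_mx lin.
rewrite -{1}(triv_phiK Ux e) TE; congr (_ *m _).
apply/matrixP => i j; rewrite !mxE TE -colE.
by rewrite mxE.
Qed.

Lemma triv_rep_cont x : U x -> mxcont (A := A) (triv_rep x).
Proof.
move=> Ux i j; pose w := Total (triv_psi L x (delta_mx j 0)).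
rewrite (_ : (fun a => _) = fun a : G => coord L (tau a w) i 0); last first.
  by apply/funext => b; rewrite mxE.
apply/subspace_continuousP => a Aa.
apply: cvg_entry; apply: cvg_comp (coord_within (e := Total _) Aa Ux).
apply: tact_cvg => //; last exact: cvg_cst.
exact: cvg_within.
Qed.

Lemma triv_rep_is_rep x : U x -> is_rep (A := A) (triv_rep x).
Proof.
move=> Ux; split; last exact: triv_rep_cont.
  apply: eq_mulmx_col => v; rewrite -{1}(triv_psiK Ux v) -triv_repE//; last exact: subgroup1.
  by rewrite tact1 /coord /= triv_psiK// mul1mx.
move=> a b Aa Ab; apply: eq_mulmx_col => v; rewrite -mulmxA -{1 2}(triv_psiK Ux v).
rewrite -triv_repE//; last exact: subgroupM.
rewrite (tactM (I : whole G a) (I : whole G b)) -triv_repE//.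
have : base (tau b (Total (triv_psi L x v))) = x by rewrite /base /= AX.
case: (tau b _) => y e yx; rewrite /base /= in yx; subst y.
exact: triv_repE.
Qed.

(** The integral over A of r(a) a e, computed in the coordinates of L. *)
Definition triv_mean (r : G -> C) x (e : E x) : E x :=
  triv_psi L x (mxmean M (fun a => r a *: triv_rep x a) *m triv_phi L e).

(** The mean commutes with equivariant linear maps into the fibre. This gives both its independence
    of L ([wmeanE]) and its values on irreducible pieces. *)
Lemma triv_mean_map (r : G -> C) x d (sigma : G -> 'M[C]_d) (f : 'cV[C]_d -> E x) :
  U x -> {within A, continuous r} -> mxcont (A := A) sigma -> linear f ->
  (forall a v, A a -> Total (f (sigma a *m v)) = tau a (Total (f v))) ->
  forall v, triv_mean r (f v) = f (mxmean M (fun a => r a *: sigma a) *m v).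
Proof.
move=> Ux rA sA f_lin fA v.
have [B BE] : exists B : 'M[C]_(n, d), forall w, triv_phi L (f w) = B *m w.
  by apply: linear_col_mx => c w w'; rewrite f_lin triv_linear.
have BI a : A a -> triv_rep x a *m B = B *m sigma a.
  move=> Aa; apply/matrixP => i j.
  have /colP/(_ i) : triv_rep x a *m B *m delta_mx j 0 = B *m sigma a *m (delta_mx j 0 : 'cV_d).
    by rewrite -!mulmxA -!BE -triv_repE// -fA.
  by rewrite -!colE !mxE.
rewrite /triv_mean BE mulmxA -mxmean_mulr; last first.
  by apply: mxcont_scale => //; exact: triv_rep_cont.
rewrite (@eq_mxmean _ _ _ M _ _ _ (fun a => B *m (r a *: sigma a))).
  rewrite mxmean_mull; last exact: mxcont_scale.
  by rewrite -mulmxA -BE triv_phiK.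
by move=> a Aa; rewrite -scalemxAl BI// scalemxAr.
Qed.

Lemma triv_mean_linear r x : U x -> linear (@triv_mean r x).
Proof.
by move=> Ux c e e'; rewrite /triv_mean triv_linear// mulmxDr -scalemxAr psi_linear.
Qed.

Lemma triv_mean_linear_weight (r r' : G -> C) c x (e : E x) : U x ->
  {within A, continuous r} -> {within A, continuous r'} ->
  triv_mean (fun a => c * r a + r' a) e = c *: triv_mean r e + triv_mean r' e.
Proof.
move=> Ux rA r'A; have repA := triv_rep_cont Ux.
rewrite /triv_mean -psi_linear// scalemxAl -mulmxDl -mxmean_lin; try exact: mxcont_scale.
congr (triv_psi _ _ (_ *m _)); apply: eq_mxmean => a _.
by rewrite scalerDl scalerA.
Qed.

Lemma triv_mean_translate (r : G -> C) x (e : E x) b : U x -> A b ->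
  {within A, continuous r} ->
  Total (triv_mean (fun a => r (b^-1 * a)%g) e) = tau b (Total (triv_mean r e)).
Proof.
move=> Ux Ab rA; have repA := triv_rep_cont Ux; have [_ repM _] := triv_rep_is_rep Ux.
have AVb := subgroupV Ab.
apply: (coord_inj (L := L)) => //; first by rewrite /base /= AX.
rewrite triv_repE// /coord /= !triv_psiK// mulmxA; congr (_ *m _).
have contrA : mxcont (A := A) (fun a => r (b^-1 * a)%g *: triv_rep x a).
  apply: mxcont_scale => //; apply: within_comp rA => [a|a Aa]; first exact: subgroupM.
  by apply: cvg_mulg; [exact: cvg_cst|exact: cvg_within].
rewrite -mxmean_mull; last exact: mxcont_scale.
rewrite -(mxmean_translate M Ab contrA); apply: eq_mxmean => a Aa.
by rewrite mulKg repM// scalemxAr.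
Qed.

(** In coordinates the integrand is jointly continuous in a and e, so [imean_continuous] applies to
    each entry. *)
Lemma triv_mean_cvg (r : G -> C) (e0 : total E) : U (base e0) -> {within A, continuous r} ->
  (fun e : total E => Total (triv_mean r (projT2 e))) @ e0 -->
  Total (triv_mean r (projT2 e0)).
Proof.
move=> Ue0 rA; have [base_cont _ _] := Ebundle.
apply: (@cvg_total _ _ _ _ L _ (nbhs e0) _
  (fun e : total E => Total (triv_mean r (projT2 e)))
  (Total (triv_mean r (projT2 e0))) Ue0 (base_cont e0)).
have Unear : \forall e \near e0, U (base e).
  by apply: base_cont; apply: open_nbhs_nbhs; split => //; exact: triv_open.
pose F (e : total E) a : 'cV[C]_n := r a *: coord L (tau a e).
have FE (e : total E) : U (base e) -> coord L (Total (triv_mean r (projT2 e))) = mxmean M (F e).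
  case: e => x e Ux; rewrite /coord /= triv_psiK// -mxmean_mulr; last first.
    by apply: mxcont_scale => //; exact: triv_rep_cont.
  by apply: eq_mxmean => a Aa; rewrite -scalemxAl -triv_repE.
have Fcont (e : total E) : U (base e) -> mxcont (A := A) (F e).
  case: e => x e Ux i j; rewrite /F.
  apply: (@subspace_eq_continuous _ _ _ (fun a => (r a *: (triv_rep x a *m triv_phi L e)) i j)).
    by move=> a; rewrite inE => Aa; rewrite -triv_repE.
  move: i j; apply: mxcont_scale => //; apply: mxcont_mul; first exact: triv_rep_cont.
  exact: mxcont_cst.
rewrite FE//; apply: (cvg_trans (G := (fun e => mxmean M (F e)) @ e0)).
  by apply: near_eq_cvg; apply: filterS Unear => e Ue; rewrite FE.
apply: (@cvg_mx C (total E) (nbhs e0) _ n 1 (fun e => mxmean M (F e))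
  (mxmean M (F e0))) => i j.
have -> : (fun e => mxmean M (F e) i j) = fun e => M (fun a => F e a i j).
  by apply/funext => e; rewrite mxE.
rewrite mxE; apply: (@imean_continuous _ _ _ Acompact M _ (fun e a => F e a i j) e0).
  by apply: filterS Unear => e Ue; exact: Fcont.
move=> a Aa; apply: cvg_entry.
have fstc : fst @ filter_prod (within A (nbhs a)) (nbhs e0) --> within A (nbhs a).
  exact: cvg_fst.
apply: cvgZ.
  have ra : r @ within A (nbhs a) --> r a.
    by move: rA; rewrite subspace_continuousP; exact.
  exact: (@cvg_comp _ _ _ fst r _ _ _ fstc ra).
apply: (@cvg_comp _ _ _ (fun p : G * total E => tau p.1 p.2) (coord L) _
  (nbhs (tau a e0)) _ _ (coord_within Aa Ue0)).
apply: tact_cvg => //; last exact: cvg_snd.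
by apply: cvg_trans fstc _; exact: cvg_within.
Qed.

End triv.
End weighted_means.

(** * Isotypic projections *)

Section representations.
Context {C : numClosedFieldType} {G : topologicalGroupType}.
Context {A : normal_subgroup G}.

Lemma irrep_actKV (g : G) (rho sigma : irrep C A) :
  unitary_equiv rho (irrep_act g^-1%g sigma) -> unitary_equiv (irrep_act g rho) sigma.
Proof.
move=> rs; apply: unitary_equiv_trans (irrep_act_equiv g rs) _.
apply: unitary_equiv_trans (unitary_equiv_sym (irrep_act_comp _ _ _)) _.
by rewrite mulgV; exact: irrep_act_id.
Qed.

Lemma irrep_actK (g : G) (rho sigma : irrep C A) :
  unitary_equiv (irrep_act g rho) sigma -> unitary_equiv rho (irrep_act g^-1%g sigma).
Proof.
move=> rs; apply: unitary_equiv_trans (irrep_act_equiv g^-1%g rs).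
apply: unitary_equiv_trans (irrep_act_comp _ _ _).
by rewrite mulVg; apply: unitary_equiv_sym; exact: irrep_act_id.
Qed.

Context {S : set (irrep C A)}.
Hypothesis Sreps : orbit_representatives S.

(** The irreducible representation of the orbit that sits at the given coset. By orbit-stabilizer,
    summands correspond bijectively to classes in Irr(A). *)
Definition twist (p : summand (S := S)) : irrep C A :=
  irrep_act (coset_repr (tagged p)) (val (tag p)).

Lemma twist_surj (sigma : irrep C A) :
  exists p : summand (S := S), unitary_equiv (twist p) sigma.
Proof.
have [rho Srho [g /irr_classP gs]] := Sreps.1 sigma.
pose c := coset (isotropy rho) g.
exists (existT _ (exist _ rho (mem_set Srho)) c); apply: unitary_equiv_trans gs.
rewrite /twist /=; have /cosetP[h /irr_classP hr ->] := coset_reprK c.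
apply: unitary_equiv_sym; apply: unitary_equiv_trans (irrep_act_comp _ _ _) _.
exact: irrep_act_equiv.
Qed.

Lemma twist_inj (p q : summand (S := S)) :
  unitary_equiv (twist p) (twist q) -> p = q.
Proof.
case: p q => [[rho Srho] c] [[sigma Ssigma] d]; rewrite /twist /= => rs.
set k := coset_repr c in rs; set l := coset_repr d in rs.
have rs' : unitary_equiv (irrep_act (l^-1 * k)%g rho) sigma.
  apply: unitary_equiv_trans (irrep_act_comp _ _ _) _.
  by apply/unitary_equiv_sym; apply: irrep_actK; exact: unitary_equiv_sym.
have rsE : rho = sigma.
  apply: Sreps.2; [exact: set_mem Srho|exact: set_mem Ssigma|].
  by exists (l^-1 * k)%g; apply/irr_classP.
subst sigma; rewrite (bool_irrelevance Ssigma Srho) in d @l rs rs' *.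
congr existT; rewrite -(coset_reprK c) -(coset_reprK d); apply/esym/cosetP.
exists (l^-1 * k)%g; last by rewrite mulgA mulgV mul1g.
exact/irr_classP.
Qed.

End representations.

Section isotypic_projections.
Context {C : numClosedFieldType} {G : topologicalGroupType}.
Context {A : normal_subgroup G}.
Hypothesis Acompact : compact (A : set G).
Variable M : invariant_mean C A.
Context {X : gspace G}.
Hypothesis AX : acts_trivially A X.
Context {E : gfamily C (whole G) X}.
Hypothesis Ebundle : is_gbundle E.

Definition fibre_triv (x : X) : trivialization E :=
  sval (cid (trivialization_ex Ebundle x)).

Lemma fibre_trivP x : triv_dom (fibre_triv x) x.
Proof. by rewrite /fibre_triv; case: cid. Qed.

(** The trivialization is chosen at each point without any coherence; [wmeanE] allows a single one
    to be used near a point, which is what continuity requires. *)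
Definition wmean (r : G -> C) x (e : E x) : E x := triv_mean M (fibre_triv x) r e.

Lemma wmean_map (r : G -> C) x d (sigma : G -> 'M[C]_d) (f : 'cV[C]_d -> E x) :
  {within A, continuous r} -> mxcont (A := A) sigma -> linear f ->
  (forall a v, A a -> Total (f (sigma a *m v)) = tact (I : whole G a) (Total (f v))) ->
  forall v, wmean r (f v) = f (mxmean M (fun a => r a *: sigma a) *m v).
Proof. by move=> *; apply: triv_mean_map => //; exact: fibre_trivP. Qed.

Lemma wmeanE (L : trivialization E) (r : G -> C) x (e : E x) : triv_dom L x ->
  {within A, continuous r} -> wmean r e = triv_mean M L r e.
Proof.
move=> Ux rA; rewrite -{1}(triv_phiK Ux e) (wmean_map (sigma := triv_rep L x))//.
- exact: triv_rep_cont.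
- exact: psi_linear.
move=> a v Aa; apply: (coord_inj (L := L)) => //; first by rewrite /base /= AX.
by rewrite (triv_repE (AX := AX))// /coord /= !triv_psiK.
Qed.

Lemma eq_wmean (r r' : G -> C) x (e : E x) : (forall a, A a -> r a = r' a) ->
  wmean r e = wmean r' e.
Proof.
move=> rr'; congr (triv_psi _ _ (_ *m _)); apply: eq_mxmean => a /rr' ->.
by [].
Qed.

Lemma wmean_linear r x : linear (@wmean r x).
Proof. exact/triv_mean_linear/fibre_trivP. Qed.

HB.instance Definition _ r x := GRing.isLinear.Build C (E x) (E x) *:%R
  (@wmean r x) (@wmean_linear r x).

Lemma wmean_cvg (r : G -> C) (e0 : total E) : {within A, continuous r} ->
  (fun e : total E => Total (wmean r (projT2 e))) @ e0 -->
  Total (wmean r (projT2 e0)).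
Proof.
move=> rA; pose L := fibre_triv (base e0); have Ue0 : triv_dom L (base e0) := fibre_trivP _.
have [base_cont _ _] := Ebundle.
have Unear : \forall e \near e0, triv_dom L (base e).
  by apply: base_cont; apply: open_nbhs_nbhs; split => //; exact: triv_open.
rewrite (wmeanE (L := L))//.
move: (triv_mean_cvg (M := M) (AX := AX) Acompact Ebundle Ue0 rA); apply: cvg_trans.
apply: (@near_eq_cvg _ _ (nbhs e0)).
by apply: (@filterS _ (nbhs e0) _ _ _ _ Unear) => e Ue; rewrite (wmeanE (L := L)).
Qed.

Section hom.
Variable rho : irrep C A.
Local Notation d := (irrep_dim rho).

(** A matrix coefficient, normalized by the dimension so that [schur_orthogonality] comes out
    without a factor. *)
Definition coef (i : 'I_d) (v : 'cV[C]_d) (a : G) : C :=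
  d%:R * (rho (a^-1)%g *m v) i 0.

Lemma coef_cont i v : {within A, continuous (coef i v)}.
Proof.
have [_ _ rhoA] := irrep_is_rep rho; apply: within_mul; first exact: within_cst.
suff h : mxcont (A := A) (fun a => rho (a^-1)%g *m v) by exact: h.
by apply: mxcont_mul; [exact: mxcont_inv|exact: mxcont_cst].
Qed.

(** Replacing v by rho(b) v translates the weight by b^-1, and the invariance of the mean turns this
    into the action of b. *)
Lemma projection_homA x (e : E x) i :
  homA_pred (A := A) (fun v : 'cV[C]_d => wmean (coef i v) e).
Proof.
apply/asboolP; split=> [c v w|b v Ab].
  rewrite -[RHS]triv_mean_linear_weight//; try exact: coef_cont; last exact: fibre_trivP.
  apply: eq_wmean => a _; rewrite /coef mulmxDr -scalemxAr !mxE mulrDr.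
  by rewrite mulrCA.
rewrite -triv_mean_translate//; [|exact: fibre_trivP|exact: coef_cont].
congr Total; apply: eq_wmean => a Aa; rewrite /coef mulmxA -irrepM//; last exact: subgroupV.
by rewrite invgM invgK.
Qed.

Definition tau x (e : E x) : rep_homA AX E rho x :=
  [ffun i => HomA AX (projection_homA e i)].

(* By Schur orthogonality tau kills the other isotypic parts of E x and       *)
(* inverts eval on the rho-isotypic one; being an average over A it depends   *)
(* continuously on e.                                                         *)
Lemma tau_linear x : linear (@tau x).
Proof.
move=> c e e'; apply/ffunP => i; rewrite !ffunE; apply: homAP => v.
exact: wmean_linear.
Qed.

HB.instance Definition _ x := GRing.isLinear.Build C (E x) (rep_homA AX E rho x)
  *:%R (@tau x) (@tau_linear x).

Lemma wmean_homA (sigma : irrep C A) x (phi : homA E sigma AX x) i v w :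
  wmean (coef i v) (phi w) =
  phi (d%:R *: mxmean M (fun a => (rho (a^-1)%g *m v) i 0 *: (sigma a *m w))).
Proof.
have [_ _ sA] := irrep_is_rep sigma; have [_ _ rA] := irrep_is_rep rho.
have rvA : {within A, continuous (fun a => (rho (a^-1)%g *m v) i 0)}.
  suff h : mxcont (A := A) (fun a => rho (a^-1)%g *m v) by exact: h.
  by apply: mxcont_mul; [exact: mxcont_inv|exact: mxcont_cst].
rewrite (wmean_map (sigma := sigma)) //.
- congr (homA_fun _ _); rewrite -mxmean_mulr; last first.
    by apply: mxcont_scale => //; exact: coef_cont.
  (* The zero summand lets [mxmean_lin] absorb the scalar d. *)
  rewrite -[RHS]addr0 -(mxmean_cst M 0) -mxmean_lin; last exact: mxcont_cst.
    by apply: eq_mxmean => a _; rewrite addr0 -scalemxAl scalerA.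
  by apply: mxcont_scale => //; apply: mxcont_mul => //; exact: mxcont_cst.
- exact: coef_cont.
- exact: homA_linear.
- by move=> a u; exact: homA_equiv.
Qed.

Lemma tau_neq (sigma : irrep C A) x (phi : homA E sigma AX x) w :
  ~ unitary_equiv rho sigma -> tau (phi w) = 0.
Proof.
move=> rs; apply/ffunP => i; rewrite !ffunE; apply: homAP => v.
rewrite -[LHS]/(wmean (coef i v) (phi w)) wmean_homA schur_orthogonality_neq//.
by rewrite scaler0 linear0.
Qed.

Lemma tau_homA x (phi : homA E rho AX x) w : tau (phi w) = pure_tensor w phi.
Proof.
apply/ffunP => i; rewrite !ffunE; apply: homAP => v.
rewrite -[LHS]/(wmean (coef i v) (phi w)) wmean_homA schur_orthogonality.
by rewrite linearZ.
Qed.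

Lemma tau_evalK x (t : rep_homA AX E rho x) : tau (eval t) = t.
Proof.
rewrite /eval linear_sum; apply/ffunP => i; rewrite sum_ffunE.
rewrite (bigD1 i)//= big1 => [|j ji]; rewrite tau_homA ffunE mxE.
  by rewrite !eqxx scale1r addr0.
by rewrite eq_sym (negPf ji) scale0r.
Qed.

Lemma eval_pure x (phi : homA E rho AX x) w :
  eval (pure_tensor w phi : rep_homA AX E rho x) = phi w.
Proof.
rewrite /eval [in RHS](matrix_sum_delta w) linear_sum; apply: eq_bigr => i _.
by rewrite big_ord1 ffunE linearZ.
Qed.

(** An equivalence u turns phi into a homomorphism from rho, for which [tau_homA] applies. *)
Lemma eval_tau (sigma : irrep C A) x (phi : homA E sigma AX x) w :
  unitary_equiv rho sigma -> eval (tau (phi w)) = phi w.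
Proof.
move=> [u [uu u'u uA]].
have psiP : homA_pred (A := A) (fun v : 'cV[C]_d => phi (u *m v)).
  apply/asboolP; split=> [c v v'|a v Aa].
    by rewrite mulmxDr -scalemxAr linearP.
  by rewrite mulmxA -uA// -mulmxA homA_equiv.
pose psi := HomA AX psiP.
have -> : phi w = psi ((u ^t*)%sesqui *m w) by rewrite /psi /= mulmxA uu mul1mx.
by rewrite tau_homA eval_pure.
Qed.

End hom.

Lemma homA_translate_subproof (sigma : irrep C A) g x (phi : homA E sigma AX x) :
  homA_pred (A := A) (rho := irrep_act g sigma)
    (fun v => fact (I : whole G g) x (phi v)).
Proof.
apply/asboolP; split=> [c v w|a v Aa]; first by rewrite linearP linearP.
rewrite -[LHS]/(tact (I : whole G g) (Total (phi (sigma (g^-1 * a * g)%g *m v)))).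
rewrite homA_equiv; last exact: subgroupJV.
rewrite -(tactM _ _ (I : whole G (g * (g^-1 * a * g))%g)).
rewrite -[X in _ = tact _ X]/(tact (I : whole G g) (Total (phi v))).
rewrite -(tactM _ _ (I : whole G (a * g)%g)).
by apply: tact_ext; rewrite !mulgA mulgV mul1g.
Qed.

Definition homA_translate (sigma : irrep C A) g x (phi : homA E sigma AX x) :
    homA E (irrep_act g sigma) AX (act g x) :=
  HomA AX (homA_translate_subproof g phi).

Context {S : set (irrep C A)}.
Hypothesis Sreps : orbit_representatives S.
Local Notation summand := (summand (S := S)).
Local Notation F p := (rep_homA AX E (val (tag p))).

(** With k the representative of the coset: e is moved back by k^-1, projected to the part of the
    orbit representative, and labelled by k. *)
Definition Psi_comp (p : summand) x (e : E x) : bfibre (F p) (tagged p) x :=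
  bfibre_mk (coset_reprK (tagged p))
    (tau (val (tag p)) (fact (I : whole G (coset_repr (tagged p))^-1%g) x e)).

Lemma Psi_comp_linear p x : linear (@Psi_comp p x).
Proof. by move=> c e e'; rewrite /Psi_comp linearP linearP bfibre_mk_linear. Qed.

HB.instance Definition _ p x := GRing.isLinear.Build C (E x)
  (bfibre (F p) (tagged p) x) *:%R (@Psi_comp p x) (@Psi_comp_linear p x).

Lemma Psi_comp_neq (p : summand) (sigma : irrep C A) x (phi : homA E sigma AX x) v :
  ~ unitary_equiv (twist p) sigma -> Psi_comp p (phi v) = 0.
Proof.
move=> ps; rewrite /Psi_comp.
have -> : fact (I : whole G (coset_repr (tagged p))^-1%g) x (phi v) =
  homA_translate (coset_repr (tagged p))^-1%g phi v by [].
rewrite tau_neq; last by move=> /irrep_actKV.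
have := bfibre_mk_linear (x := x) (coset_reprK (tagged p)) (-1) 0 (0 : F p _).
by rewrite scaler0 addr0 scaleN1r addNr.
Qed.

Lemma feval_Psi_comp (p : summand) (sigma : irrep C A) x (phi : homA E sigma AX x) v :
  unitary_equiv (twist p) sigma -> feval (Psi_comp p (phi v)) = phi v.
Proof.
move=> ps; apply: Total_inj; rewrite Total_feval /= bevalE /teval /=.
rewrite (eval_tau (homA_translate (coset_repr (tagged p))^-1%g phi)).
  exact: (tactKV _ _ (Total (phi v))).
exact: irrep_actK.
Qed.

Lemma Psi_comp_feval (p : summand) x (s : bfibre (F p) (tagged p) x) :
  Psi_comp p (feval s) = s.
Proof.
have kc := coset_reprK (tagged p); have [t <-] := bfibre_mk_ex kc s.
rewrite /Psi_comp (_ : fact _ x _ = eval t).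
  by rewrite tau_evalK; apply: bfibreP.
apply: Total_inj; rewrite -[LHS]/(tact _ (Total (feval _))) Total_feval /= bevalE.
exact: tactK.
Qed.

Lemma Psi_comp_feval_neq (p q : summand) x (s : bfibre (F q) (tagged q) x) :
  p <> q -> Psi_comp p (feval s) = 0.
Proof.
move=> pq; have kc := coset_reprK (tagged q); have [t <-] := bfibre_mk_ex kc s.
(* The points are generalized because acting by k and then k^-1 returns to x only up to a proved
   equality. *)
have aux y z (t' : F q y) (e : E z) : act (coset_repr (tagged q)) y = z ->
    Total e = tact (I : whole G (coset_repr (tagged q))) (Total (eval t')) ->
    Psi_comp p e = 0.
  move=> yz; subst z => /Total_inj ->; rewrite /eval linear_sum linear_sum.
  apply: big1 => i _; apply: (Psi_comp_neq (homA_translate _ _)).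
  by move=> /(twist_inj Sreps).
apply: (aux _ _ t); first by rewrite actKV.
by rewrite Total_feval /= bevalE.
Qed.

(** By complete reducibility the fibre is spanned by vectors phi(v) with phi equivariant from an
    irreducible; on each of them exactly one projection is the identity and the others vanish. *)
Lemma sum_Psi_comp x : exists2 r : seq summand, uniq r &
  forall e : E x, \sum_(p <- r) feval (Psi_comp p e) = e.
Proof.
pose L := fibre_triv x; have Ux : triv_dom L x := fibre_trivP x.
have al_rep := triv_rep_is_rep (AX := AX) Ebundle Ux.
have psi0 : triv_psi L x 0 = 0 := linear_fun0 (psi_linear Ux).
(* The claim ranges over all lists containing r, so that the lists of successive pieces can be
   merged, and [1%:M] is written out so that induction on [isotypic_sum] can generalize it. *)
suff [r rP] : exists r : seq summand, forall r', uniq r' -> {subset r <= r'} ->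
    forall v, \sum_(p <- r') feval (Psi_comp p (triv_psi L x (1%:M *m v))) =
              triv_psi L x (1%:M *m v).
  exists (undup r); first exact: undup_uniq.
  move=> e; have := rP (undup r) (undup_uniq r) _ (triv_phi L e).
  by rewrite mul1mx triv_phiK//; apply => p; rewrite mem_undup.
elim: (rep_semisimple M al_rep) => [|rho N N' K NI _ [r rP]].
  exists [::] => r' _ _ v; rewrite mul0mx psi0.
  by apply: big1 => p _; rewrite linear0 linear0.
have [p0 p0E] := twist_surj Sreps rho.
have phiP : homA_pred (A := A) (fun v : 'cV[C]_(irrep_dim rho) => triv_psi L x (N *m v)).
  apply/asboolP; split=> [c v w|a v Aa]; first by rewrite mulmxDr -scalemxAr psi_linear.
  apply: (coord_inj (L := L)) => //; first by rewrite /base /= AX.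
  by rewrite (triv_repE (AX := AX))// /coord /= !triv_psiK// !mulmxA NI.
pose phi := HomA AX phiP.
exists (p0 :: r) => r' r'_uniq sub v.
have -> : triv_psi L x ((N *m N' + K) *m v) = phi (N' *m v) + triv_psi L x (K *m v).
  have := psi_linear Ux 1 (N *m (N' *m v)) (K *m v); rewrite !scale1r => <-.
  by rewrite mulmxDl mulmxA.
have projD p (e e' : E x) :
    feval (Psi_comp p (e + e')) = feval (Psi_comp p e) + feval (Psi_comp p e').
  by rewrite linearD linearD.
rewrite (eq_bigr _ (fun p _ => projD p _ _)) big_split; apply: congr2; last first.
  by apply: rP => // p pr; apply: sub; rewrite inE pr orbT.
have p0r : p0 \in r' by apply: sub; rewrite mem_head.
rewrite (bigD1_seq p0)// feval_Psi_comp// big1 => [|p pp0]; first exact: addr0.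
rewrite Psi_comp_neq ?linear0// => pE; move/eqP: pp0; apply.
by apply: (twist_inj Sreps); apply: unitary_equiv_trans pE _; exact: unitary_equiv_sym.
Qed.

End isotypic_projections.

(** * Continuity *)

Lemma cvg_continuous_comp {T : Type} {F : set_system T} {U V : topologicalType}
    (h : T -> U) (u : U) (k : U -> V) :
  h @ F --> u -> {for u, continuous k} -> (fun t => k (h t)) @ F --> k u.
Proof. by move=> hu ku; exact: cvg_comp hu ku. Qed.

Lemma continuous_compose {U V W : topologicalType} (f : U -> V) (g : V -> W) :
  continuous f -> continuous g -> continuous (fun x => g (f x)).
Proof. by move=> fc gc x; exact: cvg_continuous_comp (fc x) (gc _). Qed.

Lemma fst_continuous {U V : topologicalType} : continuous (@fst U V).
Proof. by move=> p; exact: cvg_fst. Qed.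

Lemma snd_continuous {U V : topologicalType} : continuous (@snd U V).
Proof. by move=> p; exact: cvg_snd. Qed.

Lemma cvg_sum {K : numFieldType} {T : Type} {F : set_system T} {FF : Filter F}
    {I : Type} (r : seq I) (f : I -> T -> K) (l : I -> K) :
  (forall i, f i @ F --> l i) ->
  (fun t => \sum_(i <- r) f i t) @ F --> \sum_(i <- r) l i.
Proof.
move=> fl; elim: r => [|i r IH].
  rewrite (_ : (fun t => _) = fun=> 0); last by apply/funext => t; rewrite big_nil.
  by rewrite big_nil; exact: cvg_cst.
rewrite big_cons (_ : (fun t => _) = fun t => f i t + \sum_(j <- r) f j t).
  by apply: cvgD; [exact: fl|exact: IH].
by apply/funext => t; rewrite big_cons.
Qed.

Section sums_of_sections.
Context {C : numClosedFieldType} {G : topologicalGroupType}.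
Context {X : gspace G} {E : gfamily C (whole G) X}.
Hypothesis Ebundle : is_gbundle E.

Lemma triv_phi_sum (L : trivialization E) x (I : Type) (r : seq I) (e : I -> E x) :
  triv_dom L x -> triv_phi L (\sum_(i <- r) e i) = \sum_(i <- r) triv_phi L (e i).
Proof.
move=> Ux; have phi_lin := triv_linear Ux; elim: r => [|i r IH].
  by rewrite !big_nil (linear_fun0 phi_lin).
by rewrite !big_cons -IH; have := phi_lin 1 (e i) (\sum_(j <- r) e j); rewrite !scale1r.
Qed.

Lemma total_sum_cvg {T : Type} {F : set_system T} {FF : Filter F} (I : Type)
    (r : seq I) (b : T -> X) (b0 : X) (h : I -> forall t, E (b t)) (h0 : I -> E b0) :
  b @ F --> b0 -> (forall i, (fun t => Total (h i t)) @ F --> Total (h0 i)) ->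
  (fun t => Total (\sum_(i <- r) h i t)) @ F --> Total (\sum_(i <- r) h0 i).
Proof.
move=> bF hF; have [L Ub0] := trivialization_ex Ebundle b0.
have Unear : \forall t \near F, triv_dom L (b t).
  by apply: bF; apply: open_nbhs_nbhs; split => //; exact: triv_open.
apply: (@cvg_total _ _ _ _ L _ F _ (fun t => Total (\sum_(i <- r) h i t))
  (Total (\sum_(i <- r) h0 i)) Ub0 bF).
rewrite /coord /= triv_phi_sum//.
have lim : (fun t => \sum_(i <- r) coord L (Total (h i t))) @ F -->
    \sum_(i <- r) coord L (Total (h0 i)).
  apply: cvg_mx => k l; rewrite summxE.
  rewrite (_ : (fun t => _) = fun t => \sum_(i <- r) coord L (Total (h i t)) k l).
    apply: cvg_sum => i; apply: cvg_entry; apply: (cvg_continuous_comp (hF i)).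
    exact: (coord_cvg Ebundle (L := L) (e := Total (h0 i)) Ub0).
  by apply/funext => t; rewrite summxE.
move: lim; apply: cvg_trans; apply: (@near_eq_cvg _ _ F).
by apply: (@filterS _ F _ _ _ _ Unear) => t Ut; rewrite triv_phi_sum.
Qed.

End sums_of_sections.

Section transfer.
Context {C : numClosedFieldType} {G : topologicalGroupType} {H : subgroup G}.
Context {X : gspace G} {E F : gfamily C H X}.

(** Trivializations and the action are conjugated by the isomorphism. *)
Lemma is_gbundle_transfer (m : gmap idfun F E) :
  is_gbundle_iso m -> is_gbundle E -> is_gbundle F.
Proof.
move=> [m' [m_cont m'_cont mK m'K]] [base_cont triv act_cont].
have tmK : cancel (tmap m) (tmap m') by case=> x e; rewrite /tmap /= mK.
split.
- by move=> e; exact: (cvg_continuous_comp (m_cont e) (base_cont _)).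
- move=> x0; have [n [U [phi [psi [Ux0 UP phic psic]]]]] := triv x0.
  exists n, U, (fun x e => phi x (m x e)), (fun x v => m' x (psi x v)); split => //.
  + move=> x /UP[phi_lin phiK psiK]; split.
    * by move=> c e e'; rewrite linearP phi_lin.
    * by move=> e; rewrite phiK mK.
    * by move=> v; rewrite m'K psiK.
  + apply: (within_comp (h := tmap m)) phic => // e _.
    by apply: cvg_trans (m_cont e); exact: cvg_app (cvg_within _).
  + by move=> p; exact: (cvg_continuous_comp (psic p) (m'_cont _)).
- have c1 : continuous (fun p : set_type H * total F => (p.1, tmap m p.2)).
    move=> p; apply: (@cvg_pair _ _ _ (nbhs p) (nbhs p.1) (nbhs (tmap m p.2))).
      exact: cvg_fst.
    exact: (continuous_compose snd_continuous m_cont).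
  rewrite (_ : (fun p => _) = fun p : set_type H * total F =>
      tmap m' (tact (set_valP p.1) (tmap m p.2))).
    exact: (continuous_compose (continuous_compose c1 act_cont) m'_cont).
  by apply/funext => p; rewrite -tmap_tact tmK.
Qed.

End transfer.

Section evaluation_continuity.
Context {C : numClosedFieldType} {G : topologicalGroupType}.
Context {A : normal_subgroup G} {X : gspace G} {AX : acts_trivially A X}.
Context {E : gfamily C (whole G) X}.
Hypothesis Ebundle : is_gbundle E.

Section irrep.
Variable rho : irrep C A.
Local Notation F := (rep_homA AX E rho).

Lemma rep_homA_base_continuous : continuous (base (E := F)).
Proof.
have embc : continuous (@rep_homA_embed _ _ _ _ AX E rho : total F -> _).
  exact: (total_initial_continuous (E := F)).
exact: (continuous_compose embc fst_continuous).
Qed.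

Lemma rep_homA_value_continuous i v :
  continuous (fun t : total F => Total ((projT2 t : tens _ _) i v)).
Proof.
have embc : continuous (@rep_homA_embed _ _ _ _ AX E rho : total F -> _).
  exact: (total_initial_continuous (E := F)).
exact: (continuous_compose (continuous_compose embc snd_continuous)
  (@prod_topology_proj_continuous _ (fun _ => total E : topologicalType) (i, v))).
Qed.

Lemma teval_continuous : continuous (@teval _ _ _ _ AX E rho).
Proof.
move=> t; apply: (@total_sum_cvg _ _ _ _ Ebundle _ (nbhs t) _ _ _ (fun t : total F => projT1 t)
  _ (fun i (t : total F) => (projT2 t : tens _ _) i (delta_mx i 0))
  (fun i => (projT2 t : tens _ _) i (delta_mx i 0))).
  exact: rep_homA_base_continuous.
by move=> i; exact: rep_homA_value_continuous.
Qed.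

(** By the quotient topology it suffices to check continuity on pairs (g, t), where the map is g
    eval(t). *)
Lemma beval_continuous : continuous (@beval _ _ _ _ AX E rho).
Proof.
apply/quotient_continuous => -[g t] /=.
rewrite /continuous_at /=.
have bE (p : G * total F) : beval (bclass p.1 p.2) = tact (I : whole G p.1) (teval p.2).
  exact: bevalE.
rewrite (_ : beval \o _ = fun p => tact (I : whole G p.1) (teval p.2)); last first.
  by apply/funext => -[g' t']; exact: (bE (g', t')).
rewrite -[X in beval X]/(bclass g t) bevalE; apply: tact_cvg => //; first exact: cvg_fst.
apply: (cvg_continuous_comp (k := @teval _ _ _ _ AX E rho) _ (@teval_continuous t)).
exact: cvg_snd.
Qed.

End irrep.

Context {S : set (irrep C A)}.
Local Notation D := (decomposition S AX E).

Lemma decomposition_base_continuous : continuous (base (E := D)).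
Proof.
have embc : continuous (bigoplus_embed (F := _) : total D -> _).
  exact: (total_initial_continuous (E := D)).
exact: (continuous_compose embc fst_continuous).
Qed.

Lemma component_continuous (p : summand (S := S)) :
  continuous (fun s : total D => bfibre_val (component p (projT2 s))).
Proof.
case: p => rho c; pose FI (rho : set_type S) := Ind (rep_homA AX E (val rho)).
have embc : continuous (bigoplus_embed (F := FI) : total D -> _).
  exact: (total_initial_continuous (E := D)).
have c1 : continuous (fun s : total D => Total ((projT2 s : dsum _) rho) : total (FI rho)).
  exact: (continuous_compose (continuous_compose embc snd_continuous)
    (@prod_topology_proj_continuous _ (fun rho => total (FI rho) : topologicalType) rho)).
have embc' : continuous (@Ind_embed _ _ _ _ _ : total (FI rho) -> _).
  exact: (total_initial_continuous (E := FI rho)).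
exact: (continuous_compose c1 (continuous_compose (continuous_compose embc' snd_continuous)
  (@prod_topology_proj_continuous _ (fun _ =>
    balanced (rep_homA AX E (val rho)) : topologicalType) c))).
Qed.

Lemma term_continuous (p : summand (S := S)) :
  continuous (fun s : total D => Total (term p (projT2 s))).
Proof.
rewrite (_ : (fun u => _) = fun u : total D => beval (component p (projT2 u))).
  exact: (continuous_compose (@component_continuous p) (@beval_continuous (val (tag p)))).
by apply/funext => u; exact: Total_feval.
Qed.

End evaluation_continuity.

(** * The inverse map, local finiteness and the isomorphism *)

Section decomposition_iso.
Context {C : numClosedFieldType} {G : topologicalGroupType}.
Context {A : normal_subgroup G}.
Hypothesis Acompact : compact (A : set G).
Variable M : invariant_mean C A.
Context {X : gspace G}.
Hypothesis AX : acts_trivially A X.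
Context {E : gfamily C (whole G) X}.
Hypothesis Ebundle : is_gbundle E.
Context {S : set (irrep C A)}.
Hypothesis Sreps : orbit_representatives S.
Local Notation D := (decomposition S AX E).
Local Notation summand := (summand (S := S)).
Local Notation Psi_comp := (Psi_comp M AX Ebundle).
Local Notation proj p e := (feval (Psi_comp p e)).

(** For p outside r, applying [Psi_comp p] to e = sum of the [proj q e] gives 0 by orthogonality.
    The list depends on x but not on e, since the fibre has finite dimension. *)
Lemma Psi_comp_supp x : exists r : seq summand, [/\ uniq r,
  forall e : E x, \sum_(p <- r) proj p e = e &
  forall p, p \notin r -> forall e : E x, Psi_comp p e = 0].
Proof.
have [r r_uniq rE] := sum_Psi_comp M AX Ebundle Sreps x.
exists r; split=> // p pr e; rewrite -[e]rE linear_sum big_seq.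
apply: big1 => q qr; apply: Psi_comp_feval_neq => // pq.
by move: pr; rewrite pq qr.
Qed.

Section fibre.
Variables (x : X) (e : E x).

Fact Psi_cosets_finite (rho : set_type S) :
  finite_set [set c | Psi_comp (existT _ rho c) e != 0].
Proof.
have [r [r_uniq _ r0]] := Psi_comp_supp x.
apply: (@sub_finite_set _ _
  ((fun c => existT _ rho c : summand) @^-1` [set` r])).
  by move=> c /= ec; apply: contraNT ec => /r0 ->.
apply: finite_preimage; last exact: finite_seq.
move=> c c' _ _ cc'.
exact: (@eq_from_Tagged {classic set_type S}
  (fun rho => cosets (isotropy (val rho))) _ _ _ cc').
Qed.

Definition Psi_cosets (rho : set_type S) : Ind (rep_homA AX E (val rho)) x :=
  DSum (Psi_cosets_finite rho).

Fact Psi_finite : finite_set [set rho : set_type S | Psi_cosets rho != 0].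
Proof.
have [r [r_uniq _ r0]] := Psi_comp_supp x.
apply: (@sub_finite_set _ _ ((fun p : summand => tag p) @` [set` r])).
  move=> rho /= /eqP er; apply: contrapT => nr; apply: er.
  apply: dsumP => c; apply: (r0 (existT _ rho c)); apply/negP => cr; apply: nr.
  by exists (existT _ rho c).
by apply: finite_image; exact: finite_seq.
Qed.

Definition Psi_fun : D x := DSum Psi_finite.

Lemma component_Psi p : component p Psi_fun = Psi_comp p e.
Proof. by case: p. Qed.

End fibre.

Lemma Psi_linear x : linear (@Psi_fun x).
Proof.
move=> c e e'; apply: dsumP => rho; apply: dsumP => k.
exact: (Psi_comp_linear M AX Ebundle (existT _ rho k)).
Qed.

HB.instance Definition _ x := GRing.isLinear.Build C (E x) (D x) *:%R
  (@Psi_fun x) (@Psi_linear x).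

Lemma Psi_funK x : cancel (@Psi_fun x) (@Phi_fun _ _ _ _ AX E S x).
Proof.
move=> e; have [r [r_uniq rE r0]] := Psi_comp_supp x.
rewrite (Phi_funE r_uniq) => [|p pr]; last by rewrite component_Psi r0.
by rewrite -[RHS]rE; apply: eq_bigr => p _; rewrite /term component_Psi.
Qed.

Lemma Psi_comp_Phi p x (s : D x) : Psi_comp p (Phi_fun s) = component p s.
Proof.
(* Adding p to the list keeps the p-th term available even when p is outside the support. *)
have [r r_uniq rs] := component_support s; pose w := undup (p :: r).
have pw : p \in w by rewrite mem_undup mem_head.
rewrite (@Phi_funE _ _ _ _ _ _ _ _ _ w) ?undup_uniq//; last first.
  by move=> q; rewrite mem_undup inE negb_or => /andP[_ /rs].
rewrite linear_sum (bigD1_seq p) ?undup_uniq//= Psi_comp_feval big1 ?addr0// => q qp.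
by apply: Psi_comp_feval_neq => // pq; rewrite pq eqxx in qp.
Qed.

Lemma Phi_funK x : cancel (@Phi_fun _ _ _ _ AX E S x) (@Psi_fun x).
Proof.
move=> s; apply: dsumP => rho; apply: dsumP => c.
exact: (Psi_comp_Phi (existT _ rho c)).
Qed.

Fact Psi_fact g (Hg : whole G g) x (e : E x) :
  Total (Psi_fun (fact Hg x e)) = tact Hg (Total (Psi_fun e)).
Proof.
congr Total; apply: (can_inj (@Phi_funK _)); rewrite Psi_funK.
by apply: Total_inj; rewrite Phi_fact Psi_funK.
Qed.

Definition Psi : gmap idfun E D :=
  @GMap C G (whole G) X X idfun E D (fun x => @Psi_fun x) Psi_fact.

Lemma tau_continuous (rho : irrep C A) :
  continuous (fun e : total E =>
    Total (tau M AX Ebundle rho (projT2 e)) : total (rep_homA AX E rho)).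
Proof.
move=> e; have [base_cont _ _] := Ebundle.
pose h (e : total E) : total (rep_homA AX E rho) :=
  Total (tau M AX Ebundle rho (projT2 e)).
apply: (@cvg_total_initial _ (nbhs e) _ C G _ X _ (rep_homA AX E rho)
  (@rep_homA_embed _ _ _ _ AX E rho) h (h e)) => //.
apply: (@cvg_pair _ _ _ (nbhs e) (nbhs (projT1 e))
  (nbhs (rep_homA_embed (h e)).2)); first exact: base_cont.
apply: prod_topology_cvg => -[i v] /=; rewrite ffunE.
rewrite (_ : (fun t => _) = fun t : total E =>
  Total (wmean M Ebundle (coef i v) (projT2 t))); last first.
  by apply/funext => t; rewrite ffunE.
exact: (wmean_cvg Acompact AX (@coef_cont _ _ _ rho i v)).
Qed.

(** The representative k is fixed, so this is the action of k^-1, then [tau], then the quotient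
    map. *)
Lemma Psi_comp_continuous (p : summand) :
  continuous (fun e : total E => bfibre_val (Psi_comp p (projT2 e))).
Proof.
pose k := coset_repr (tagged p); pose rho := val (tag p).
have c1 : continuous (fun e : total E => tact (I : whole G k^-1%g) e).
  move=> e; apply: (@tact_cvg _ _ _ _ Ebundle _ (nbhs e) _ (fun=> k^-1%g) id _ e).
    exact: cvg_cst.
  exact: cvg_id.
have c2 : continuous (fun t : total (rep_homA AX E rho) => bclass k t).
  move=> t; rewrite /continuous_at.
  apply: (@cvg_continuous_comp _ (nbhs t) _ _ (fun t => (k, t)) (k, t)
    (fun p => bclass p.1 p.2)).
    apply: (@cvg_pair _ _ _ (nbhs t) (nbhs k) (nbhs t)); first exact: cvg_cst.
    exact: cvg_id.
  rewrite (_ : (fun p => _) =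
    (\pi_({eq_quot balanced_rel (E := rep_homA AX E rho)})%qT : _ -> balanced _)).
    exact: pi_continuous.
  by apply/funext => -[].
exact: (continuous_compose (continuous_compose c1 (@tau_continuous rho)) c2).
Qed.

Lemma proj_continuous (p : summand) :
  continuous (fun e : total E => Total (proj p (projT2 e))).
Proof.
rewrite (_ : (fun e => _) = fun e : total E => beval (Psi_comp p (projT2 e))).
  exact: (continuous_compose (@Psi_comp_continuous p)
    (@beval_continuous _ _ _ _ AX E Ebundle (val (tag p)))).
by apply/funext => e; exact: Total_feval.
Qed.

Lemma Psi_continuous : continuous (tmap Psi).
Proof.
have [base_cont _ _] := Ebundle.
move=> e; pose FI (rho : set_type S) := Ind (rep_homA AX E (val rho)).
apply: (@cvg_total_initial _ (nbhs e) _ C G _ X _ D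
  (bigoplus_embed (F := FI)) (tmap Psi) (tmap Psi e)) => //.
apply: (@cvg_pair _ _ _ (nbhs e) (nbhs (projT1 e))
  (nbhs (bigoplus_embed (tmap Psi e)).2)); first exact: base_cont.
apply: prod_topology_cvg => rho.
pose h (e : total E) : total (FI rho) := Total (Psi_cosets (projT2 e) rho).
apply: (@cvg_total_initial _ (nbhs e) _ C G _ X _ (FI rho)
  (@Ind_embed _ _ _ _ _) h (h e)) => //.
apply: (@cvg_pair _ _ _ (nbhs e) (nbhs (projT1 e))
  (nbhs (Ind_embed (h e)).2)); first exact: base_cont.
by apply: prod_topology_cvg => c; exact: (@Psi_comp_continuous (existT _ rho c)).
Qed.

(* Near x0 the operator 1 - sum_(p in r) proj p is idempotent and its trace,  *)
(* an integer, is close to its value 0 at x0.                                 *)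
Lemma Psi_comp_locally_finite (x0 : X) : exists2 r : seq summand, uniq r &
  \forall x \near x0, forall p, p \notin r -> forall e : E x, Psi_comp p e = 0.
Proof.
have [r [r_uniq rE _]] := Psi_comp_supp x0; exists r => //.
have [L Ux0] := trivialization_ex Ebundle x0; pose n := triv_dim L.
pose q x (e : E x) := e - \sum_(p <- r) proj p e.
have q_lin x : linear (@q x).
  move=> c e e'; rewrite /q scalerBr scaler_sumr addrACA -opprD -big_split.
  by congr (_ - _); apply: eq_bigr => p _; rewrite linearP linearP.
have Psi_q x (e : E x) p : p \in r -> Psi_comp p (q x e) = 0.
  move=> pr; rewrite /q linearB linear_sum (bigD1_seq p)//= Psi_comp_feval big1.
    by rewrite addr0 subrr.
  move=> p' pp'; apply: Psi_comp_feval_neq => // pE.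
  by rewrite pE eqxx in pp'.
have qq x (e : E x) : q x (q x e) = q x e.
  rewrite {1}/q big_seq big1 ?subr0// => p pr.
  by rewrite Psi_q// linear0.
pose N x : 'M[C]_n := \matrix_(i, j) triv_phi L (q x (triv_psi L x (delta_mx j 0))) i 0.
have NE x (e : E x) : triv_dom L x -> triv_phi L (q x e) = N x *m triv_phi L e.
  move=> Ux; have [T TE] : exists T : 'M[C]_n, forall v,
      triv_phi L (q x (triv_psi L x v)) = T *m v.
    by apply: linear_col_mx => c v w; rewrite psi_linear// q_lin triv_linear.
  rewrite -{1}(triv_phiK Ux e) TE; congr (_ *m _); apply/matrixP => i j.
  by rewrite mxE TE -colE mxE.
have NN x : triv_dom L x -> N x *m N x = N x.
  move=> Ux; apply: eq_mulmx_col => v.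
  by rewrite -mulmxA -(triv_psiK Ux v) -!NE// qq.
have N0 : N x0 = 0.
  apply/matrixP => i j; rewrite !mxE /q rE subrr.
  by rewrite (linear_fun0 (triv_linear Ux0)) mxE.
have Unear : \forall x \near x0, triv_dom L x.
  by apply: open_nbhs_nbhs; split => //; exact: triv_open.
have psi_cont j : (fun x => Total (triv_psi L x (delta_mx j 0))) @ x0 -->
    Total (triv_psi L x0 (delta_mx j 0)).
  have lim := @psi_cvg _ _ _ _ L _ (delta_mx j 0) Ux0.
  pose k (p : X * 'cV[C]_n) := Total (triv_psi L p.1 p.2).
  apply: (@cvg_comp_pair _ (nbhs x0) _ X 'cV[C]_n (total E) id (fun=> delta_mx j 0)
    k x0 (delta_mx j 0) _ (@cvg_id _ _) _ lim).
  exact: cvg_cst.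
pose s x j := \sum_(p <- r) proj p (triv_psi L x (delta_mx j 0)).
have s_cont j : (fun x => Total (s x j)) @ x0 --> Total (s x0 j).
  apply: (@total_sum_cvg _ _ _ _ Ebundle _ (nbhs x0) _ _ _ id _
    (fun p x => proj p (triv_psi L x (delta_mx j 0)))
    (fun p => proj p (triv_psi L x0 (delta_mx j 0)))); first exact: cvg_id.
  by move=> p; exact: (cvg_continuous_comp (psi_cont j) (@proj_continuous p _)).
have NsE x j : triv_dom L x -> N x j j =
    coord L (Total (triv_psi L x (delta_mx j 0))) j 0 - coord L (Total (s x j)) j 0.
  move=> Ux; rewrite mxE /coord /= /q addrC -scaleN1r triv_linear//.
  by rewrite scaleN1r addrC !mxE.
have trN : (fun x => \tr (N x)) @ x0 --> \tr (N x0).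
  rewrite /mxtrace (eq_bigr _ (fun j _ => NsE x0 j Ux0)).
  have : (fun x => \sum_j (coord L (Total (triv_psi L x (delta_mx j 0))) j 0 -
        coord L (Total (s x j)) j 0)) @ x0 -->
      \sum_j (coord L (Total (triv_psi L x0 (delta_mx j 0))) j 0 -
        coord L (Total (s x0 j)) j 0).
    apply: cvg_sum => j; apply: cvgB; apply: cvg_entry.
      apply: (cvg_continuous_comp (psi_cont j)).
      exact: (coord_cvg Ebundle (L := L) (e := Total _) Ux0).
    apply: (cvg_continuous_comp (s_cont j)).
    exact: (coord_cvg Ebundle (L := L) (e := Total _) Ux0).
  apply: cvg_trans; apply: (@near_eq_cvg _ _ (nbhs x0)).
  apply: (@filterS _ (nbhs x0) _ _ _ _ Unear) => x Ux.
  by apply: eq_bigr => j _; rewrite NsE.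
have : \forall x \near x0, `|\tr (N x)| < 1.
  have := @cvgr_norm_lt _ _ _ (nbhs x0) _ _ _ trN 1.
  by rewrite N0 mxtrace0 normr0; apply; exact: ltr01.
apply: filterS2 Unear => x Ux trx p pr e.
have rank0 : N x = 0.
  apply/eqP; rewrite -mxrank_eq0 -leqn0 -ltnS; move: trx.
  by rewrite mxtrace_idempotent ?NN// normr_nat ltrn1.
have q0 : q x e = 0.
  rewrite -(triv_phiK Ux (q x e)) NE// rank0 mul0mx.
  exact: linear_fun0 (psi_linear Ux).
move/eqP: q0; rewrite subr_eq0 => /eqP ->; rewrite linear_sum big_seq.
apply: big1 => p' pr'; apply: Psi_comp_feval_neq => // pp'.
by move: pr; rewrite pp' pr'.
Qed.

(** Since the components of s are recovered from [Phi] by [Psi_comp], local finiteness over X bounds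
    the support of all s near a given one; there [Phi] is a finite sum of continuous terms. *)
Lemma Phi_continuous : continuous (tmap (Phi : gmap idfun D E)).
Proof.
move=> s; have [r r_uniq rnear] := Psi_comp_locally_finite (base s).
have Dbase := @decomposition_base_continuous _ _ _ _ AX E S.
have snear : \forall t \near s, forall p, p \notin r -> component p (projT2 t) = 0.
  have := Dbase s _ rnear; apply: (@filterS _ (nbhs s)) => t tr p pr.
  by rewrite -Psi_comp_Phi; exact: tr.
have PhiE (t : total D) : (forall p, p \notin r -> component p (projT2 t) = 0) ->
    tmap (Phi : gmap idfun D E) t = Total (\sum_(p <- r) term p (projT2 t)).
  by move=> t0; congr Total; exact: Phi_funE.
rewrite /continuous_at PhiE; last exact: nbhs_singleton snear.
have : (fun t : total D => Total (\sum_(p <- r) term p (projT2 t))) @ s -->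
    Total (\sum_(p <- r) term p (projT2 s)).
  apply: (@total_sum_cvg _ _ _ _ Ebundle _ (nbhs s) _ _ _ (fun t : total D => projT1 t)
    _ (fun p (t : total D) => term p (projT2 t)) (fun p => term p (projT2 s))).
    exact: Dbase.
  by move=> p; exact: (@term_continuous _ _ _ _ AX E Ebundle S p s).
apply: cvg_trans; apply: (@near_eq_cvg _ _ (nbhs s)).
by apply: (@filterS _ (nbhs s) _ _ _ _ snear) => t /PhiE.
Qed.

Lemma Phi_iso : is_gbundle_iso (Phi : gmap idfun D E).
Proof.
exists Psi; split; [exact: Phi_continuous|exact: Psi_continuous| |] => x.
  exact: Phi_funK.
exact: Psi_funK.
Qed.

End decomposition_iso.

Theorem theorem2p12 (R : realType) (G : topologicalGroupType)
    (Glie : lie_group R G) (A : normal_subgroup G)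
    (Acompact : compact (A : set G)) (S : set (irrep R[i] A))
    (Sreps : orbit_representatives S) :
  exists Phi : forall (X : gspace G) (AX : acts_trivially A X)
                 (E : gfamily R[i] (whole G) X),
                 gmap idfun (decomposition S AX E) E,
    (forall (X : gspace G) (AX : acts_trivially A X)
       (E : gfamily R[i] (whole G) X),
       is_gbundle E ->
       is_gbundle (decomposition S AX E) /\ is_gbundle_iso (Phi X AX E)) /\
    (forall (Y X : gspace G)
       (AY : acts_trivially A Y) (AX : acts_trivially A X)
       (f : Y -> X) (fG : equivariant f)
       (E' : gfamily R[i] (whole G) Y) (E : gfamily R[i] (whole G) X)
       (m : gmap f E' E),
       continuous f -> is_gbundle E' -> is_gbundle E -> cartesian m ->
       forall (y : Y) (s : decomposition S AY E' y),
         m y (Phi Y AY E' y s) =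
         Phi X AX E (f y) (decomposition_map S fG AY AX m y s)).
Proof.
pose M : invariant_mean R[i] A := complex_invariant_mean Acompact.
exists (fun X AX E => Phi); split=> [X AX E Ebundle|Y X AY AX f fG E' E m _ _ _ _ y s].
  have iso := Phi_iso Acompact M AX Ebundle Sreps.
  by split=> //; exact: is_gbundle_transfer iso Ebundle.
exact: Phi_natural.
Qed.
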